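(* Let $\Gamma$ be a $G$-symmetric graph, $G \le \mathrm{Aut}(\Gamma)$, with $V(\Gamma)$ admitting a nontrivial $G$-invariant partition $\mathcal{B}$ such that $k = v-3 \ge 1$ and $\Gamma_{\mathcal{B}}$ is connected of valency $b \ge 2$. Then $\Gamma_{\mathcal{B}}$ is $(G,2)$-arc transitive if and only if one of the following holds: (a) $(v,b,r,\lambda) = (4,4,1,0)$ and $G_B^B \cong A_4$ or $S_4$; (b) $(v,b,r,\lambda) = (6,2,1,0)$ and $\Gamma_{\mathcal{B}} \cong C_n$, where $n = |V(\Gamma)|/6$; (c) $(v,b,r,\lambda) = (7,7,4,2)$ and $G_B^B \cong \mathrm{PSL}(3,2)$; (d) $(v,b,r,\lambda) = (3a,a,a-1,3a-6)$ for some integer $a \ge 3$; (e) $(v,b,r,\lambda) = (6,4,2,1)$ and $G_B^{\Gamma_{\mathcal{B}}(B)} \cong A_4$ or $S_4$. Moreover: In (a), $G_B^{\Gamma_{\mathcal{B}}(B)} \cong A_4$ or $S_4$, $\Gamma \cong (|V(\Gamma)|/2)\cdot K_2$, and every connected $4$-valent $2$-arc transitive graph can occur as $\Gamma_{\mathcal{B}}$ in (a). In (b), $\Gamma \cong 3n\cdot K_2$, $n\cdot C_6$ or $n\cdot K_{3,3}$, and $G/G_{(\mathcal{B})} = D_{2n}$. In (c), $\overline{\mathcal{D}}(B)$ is isomorphic to the Fano plane $\mathrm{PG}(2,2)$, $G_B^{\Gamma_{\mathcal{B}}(B)} \cong \mathrm{PSL}(3,2)$, $G$ is faithful on $\mathcal{B}$,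 and $\Gamma[B,C] \cong 4\cdot K_2$, $K_{4,4} - 4\cdot K_2$ or $K_{4,4}$; in the first case $\Gamma$ is $(G,2)$-arc transitive, and in the last two cases $\Gamma$ is connected of valency $12$ and $16$ respectively. In (d), $V(\Gamma)$ admits a $G$-invariant partition $\mathcal{P}$ with block size $3$ which is a refinement of $\mathcal{B}$ such that $\Gamma_{\mathcal{P}} \cong \Xi(\Gamma_{\mathcal{B}},\Delta)$ for some self-paired $G$-orbit $\Delta$ on the set of $3$-arcs of $\Gamma_{\mathcal{B}}$; moreover $\hat{\mathcal{B}} = \{\hat{B}: B\in\mathcal{B}\}$, where $\hat{B}$ is the set of blocks of $\mathcal{P}$ contained in $B$, is a $G$-invariant partition of $\mathcal{P}$ such that $(\Gamma_{\mathcal{P}})_{\hat{\mathcal{B}}} \cong \Gamma_{\mathcal{B}}$ and the parameters with respect to $(\Gamma_{\mathcal{P}},\hat{\mathcal{B}})$ are $v_{\hat{\mathcal{B}}} = b_{\hat{\mathcal{B}}} = a$ and $k_{\hat{\mathcal{B}}} = r_{\hat{\mathcal{B}}} = a-1$. In (e), $\Gamma \cong \Gamma_2(\Gamma_{\mathcal{B}},\Delta)$ for some self-paired $G$-orbit $\Delta$ on the $3$-arcs of $\Gamma_{\mathcal{B}}$, and every connected $4$-valent $(G,2)$-arc transitive graph can occur as $\Gamma_{\mathcal{B}}$ in (e).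
   Context: All graphs are finite and simple. For $G\le\mathrm{Aut}(\Gamma)$, $\Gamma$ is $G$-symmetric if $G$ is transitive on vertices and on arcs (ordered pairs of adjacent vertices). An $s$-arc is a sequence $(\alpha_0,\dots,\alpha_s)$ with consecutive vertices adjacent and $\alpha_{i-1}\ne\alpha_{i+1}$; a graph is $(G,s)$-arc transitive if $G$ acts transitively on its vertices and $s$-arcs. A nontrivial $G$-invariant partition $\mathcal{B}$ of $V(\Gamma)$: $1<|B|<|V(\Gamma)|$ and $B^g\in\mathcal{B}$ for all $B,g$. Quotient graph $\Gamma_{\mathcal{B}}$: vertex set $\mathcal{B}$, $B,C$ adjacent iff some edge of $\Gamma$ joins them (assumed to have an edge). $\Gamma(\alpha)$ neighbourhood; $\Gamma(B)=\bigcup_{\alpha\in B}\Gamma(\alpha)$; $\Gamma_{\mathcal{B}}(\alpha)=\{C:\Gamma(\alpha)\cap C\neq\emptyset\}$; $\Gamma_{\mathcal{B}}(B)$ the neighbourhood of $B$ in $\Gamma_{\mathcal{B}}$; $\Gamma[B,C]$ the bipartite subgraph induced by $(B\cap\Gamma(C))\cup(C\cap\Gamma(B))$. Parameters: $v=|B|$, $k=|B\cap\Gamma(C)|$, $r=|\Gamma_{\mathcal{B}}(\alpha)|$, $b$ = valency of $\Gamma_{\mathcal{B}}$, and $\lambda=|\Gamma(C)\cap\Gamma(D)\cap B|$ for distinct $C,D\in\Gamma_{\mathcal{B}}(B)$ (in the statement each listed $(v,b,r,\lambda)$ includes the assertion that this quantity is constant with the given value). $\overline{\mathcal{D}}(B)$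 is the incidence structure with points $B$, blocks $\Gamma_{\mathcal{B}}(B)$, $\alpha$ incident with $C$ iff $\alpha\notin\Gamma(C)$. $G_B$ setwise stabiliser of $B$; $G_B^B=G_B/G_{(B)}$ acting on $B$ ($G_{(B)}$ the pointwise stabiliser); $G_B^{\Gamma_{\mathcal{B}}(B)}=G_B/G_{[B]}$ acting on $\Gamma_{\mathcal{B}}(B)$ ($G_{[B]}$ the kernel on $\Gamma_{\mathcal{B}}(B)$); isomorphisms of these mean permutation isomorphism with the group in its natural action. $G_{(\mathcal{B})}$ is the kernel of $G$ on $\mathcal{B}$; $G$ faithful on $\mathcal{B}$ means $G_{(\mathcal{B})}=1$. $n\cdot\Sigma$: $n$ disjoint copies; $C_n$ cycle; $K_{n,n}$ complete bipartite; $\Sigma_1-\Sigma_2$ deletes the edges of a spanning subgraph $\Sigma_2$; $D_{2n}$ dihedral of order $2n$. A set $\Delta$ of $3$-arcs of $\Sigma$ is self-paired if $(\tau,\sigma,\sigma',\tau')\in\Delta$ implies $(\tau',\sigma',\sigma,\tau)\in\Delta$. The $3$-arc graph $\Xi(\Sigma,\Delta)$ has vertex set the arcs of $\Sigma$, $(\sigma,\tau)\sim(\sigma',\tau')$ iff $(\tau,\sigma,\sigma',\tau')\in\Delta$. $\Gamma_2(\Sigma,\Delta)$ (for $\Sigma$ regular of valency $\ge2$) has vertex set the $2$-paths $\tau\sigma\tau'$ of $\Sigma$, with distinct $\tau\sigma\tau'$ and $\eta\varepsilon\eta'$ adjacent iff $\sigma\in\{\eta,\eta'\}$, $\varepsilon\in\{\tau,\tau'\}$,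 and the two (mutually reverse) $3$-arcs obtained by gluing along the common edge $\sigma\varepsilon$ lie in $\Delta$. For a partition $\mathcal{P}$, $\Gamma_{\mathcal{P}}$ is the quotient graph and $v_{\hat{\mathcal{B}}}$ etc. denote the parameters for $(\Gamma_{\mathcal{P}},\hat{\mathcal{B}})$. *)

(* Defs.v *)
From HB Require Import structures.
From mathcomp Require Import all_boot all_order all_fingroup all_algebra.
From mathcomp Require Import all_solvable.

Set Implicit Arguments.
Unset Strict Implicit.
Unset Printing Implicit Defensive.

(* The vertex set is a subset of an ambient finite type, so that the quotient
   of a graph on T by a partition is again a graph, on {set T}. *)
Record graph (T : finType) := Graph { vert : {set T}; adj : rel T }.

Definition simple_graph (T : finType) (Ga : graph T) : Prop :=
  [/\ symmetric (adj Ga), irreflexive (adj Ga)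
    & forall x y, adj Ga x y -> x \in vert Ga].

Definition nbr (T : finType) (Ga : graph T) (x : T) : {set T} :=
  [set y | adj Ga x y].

Definition nbrs (T : finType) (Ga : graph T) (B : {set T}) : {set T} :=
  \bigcup_(x in B) nbr Ga x.

Definition regular (T : finType) (Ga : graph T) (d : nat) : Prop :=
  forall x, x \in vert Ga -> #|nbr Ga x| = d.

Definition connected (T : finType) (Ga : graph T) : Prop :=
  {in vert Ga &, forall x y, connect (adj Ga) x y}.

Definition is_giso (T S : finType) (Ga : graph T) (Si : graph S)
    (f : T -> S) : Prop :=
  [/\ {in vert Ga &, injective f}, f @: vert Ga = vert Si
    & {in vert Ga &, forall x y, adj Si (f x) (f y) = adj Ga x y}].

Definition giso (T S : finType) (Ga : graph T) (Si : graph S) : Prop :=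
  exists f : T -> S, is_giso Ga Si f.

Definition induced (T : finType) (Ga : graph T) (A : {set T}) : graph T :=
  Graph A (fun x y => [&& x \in A, y \in A & adj Ga x y]).

Definition copies (n : nat) (T : finType) (Ga : graph T) : graph ('I_n * T)%type :=
  Graph [set p | p.2 \in vert Ga]
        (fun p q => (p.1 == q.1) && adj Ga p.2 q.2).

Definition Kgraph (n : nat) : graph 'I_n := Graph setT (fun i j => i != j).

Definition Kbip (m n : nat) : graph ('I_m + 'I_n)%type :=
  Graph setT (fun x y => match x, y with
                         | inl _, inr _ | inr _, inl _ => true
                         | _, _ => false
                         end).

Definition cycle_graph (n : nat) : graph 'I_n :=
  Graph setT (fun i j => (i != j) && ((ordS i == j) || (ordS j == i))).

Definition spanning_sub (T : finType) (S1 S2 : graph T) : Prop :=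
  vert S1 = vert S2 /\ subrel (adj S1) (adj S2).

Definition del_edges (T : finType) (S1 S2 : graph T) : graph T :=
  Graph (vert S1) (fun x y => adj S1 x y && ~~ adj S2 x y).

(* Permutations of the ambient type fixing every non-vertex, i.e.,
   permutations of the vertex set. *)
Definition gaut (T : finType) (Ga : graph T) : {set {perm T}} :=
  [set g : {perm T} | perm_on (vert Ga) g
     & [forall x, forall y, adj Ga (g x) (g y) == adj Ga x y]].

Definition sarcs (T : finType) (Ga : graph T) (s : nat) :
    {set s.+1.-tuple T} :=
  [set p : s.+1.-tuple T |
    [&& all (mem (vert Ga)) p, sorted (adj Ga) p
      & [forall i : 'I_s.+1, forall j : 'I_s.+1,
          (j == i + 2 :> nat) ==> (tnth p i != tnth p j)]]].

Definition arc_transitive (aT : finGroupType) (T : finType)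
    (to : {action aT &-> T}) (G : {set aT}) (Ga : graph T) (s : nat) : Prop :=
  [transitive G, on vert Ga | to] /\ [transitive G, on sarcs Ga s | to * s.+1].

Definition self_paired (T : finType) (D : {set 4.-tuple T}) : Prop :=
  forall t, t \in D -> [tuple of rev t] \in D.

Definition orbit_on_3arcs (aT : finGroupType) (T : finType)
    (to : {action aT &-> T}) (G : {set aT}) (Si : graph T)
    (D : {set 4.-tuple T}) : Prop :=
  exists2 t, t \in sarcs Si 3 & D = orbit (to * 4)%act G t.

(* Xi(Sigma, Delta) *)
Definition arc3_graph (T : finType) (Si : graph T) (D : {set 4.-tuple T}) :
    graph (T * T)%type :=
  let arcs := [set p : T * T | adj Si p.1 p.2] in
  Graph arcs (fun p q => [&& p \in arcs, q \in arcs
                           & [tuple p.2; p.1; q.1; q.2] \in D]).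

(* Gamma_2(Sigma, Delta); the 2-path t s t' is encoded as (s, {t, t'}). *)
Definition two_path_graph (T : finType) (Si : graph T)
    (D : {set 4.-tuple T}) : graph (T * {set T})%type :=
  let paths :=
    [set p : T * {set T} | (p.2 \subset nbr Si p.1) && (#|p.2| == 2)] in
  Graph paths (fun p q =>
    [&& p \in paths, q \in paths, p != q &
      [exists t, exists u,
        [&& p.2 == [set q.1; t], q.2 == [set p.1; u],
            [tuple t; p.1; q.1; u] \in D & [tuple u; q.1; p.1; t] \in D]]]).

Definition quot (T : finType) (Ga : graph T) (P : {set {set T}}) :
    graph {set T} :=
  Graph P (fun B C => [&& B \in P, C \in P, B != C
                        & [exists x in B, exists y in C, adj Ga x y]]).

(* Gamma_P(alpha) *)
Definition blocks_at (T : finType) (Ga : graph T) (P : {set {set T}}) (x : T) :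
    {set {set T}} := [set C in P | nbr Ga x :&: C != set0].

(* Gamma[B, C] *)
Definition between (T : finType) (Ga : graph T) (B C : {set T}) : graph T :=
  induced Ga ((B :&: nbrs Ga C) :|: (C :&: nbrs Ga B)).

Definition v_is (T : finType) (P : {set {set T}}) (v : nat) : Prop :=
  forall B, B \in P -> #|B| = v.

Definition k_is (T : finType) (Ga : graph T) (P : {set {set T}}) (k : nat) :
    Prop :=
  forall B C, adj (quot Ga P) B C -> #|B :&: nbrs Ga C| = k.

Definition r_is (T : finType) (Ga : graph T) (P : {set {set T}}) (r : nat) :
    Prop :=
  forall x, x \in vert Ga -> #|blocks_at Ga P x| = r.

Definition b_is (T : finType) (Ga : graph T) (P : {set {set T}}) (b : nat) :
    Prop := regular (quot Ga P) b.

Definition lambda_is (T : finType) (Ga : graph T) (P : {set {set T}})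
    (l : nat) : Prop :=
  forall B C D, B \in P -> C \in nbr (quot Ga P) B ->
    D \in nbr (quot Ga P) B -> C != D ->
    #|nbrs Ga C :&: nbrs Ga D :&: B| = l.

Definition params (T : finType) (Ga : graph T) (P : {set {set T}})
    (v b r l : nat) : Prop :=
  [/\ v_is P v, b_is Ga P b, r_is Ga P r & lambda_is Ga P l].

Definition invariant_partition (aT : finGroupType) (T : finType)
    (to : {action aT &-> T}) (G : {set aT}) (P : {set {set T}})
    (V : {set T}) : Prop :=
  partition P V /\ [acts G, on P | to^*].

(* The set of blocks of Q contained in B, and the partition of Q so induced
   by P. *)
Definition hat (T : finType) (Q : {set {set T}}) (B : {set T}) :
    {set {set T}} := [set A in Q | A \subset B].
Definition hats (T : finType) (Q P : {set {set T}}) : {set {set {set T}}} :=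
  [set hat Q B | B in P].

Record setting (T : finType) (Ga : graph T) (G : {group {perm T}})
    (P : {set {set T}}) (v k b : nat) : Prop := Setting {
  st_simple : simple_graph Ga;
  st_aut : G \subset gaut Ga;
  st_symmetric : arc_transitive 'P G Ga 1;
  st_partition : invariant_partition 'P G P (vert Ga);
  st_nontrivial : forall B, B \in P -> 1 < #|B| < #|vert Ga|;
  st_v : v_is P v;
  st_k : k_is Ga P k;
  st_kv : k = v - 3;
  st_k_ge1 : 1 <= k;
  st_connected : connected (quot Ga P);
  st_b : b_is Ga P b;
  st_b_ge2 : 2 <= b }.

Record incidence (T S : finType) :=
  Incidence { points : {set T}; blocks : {set S}; inc : T -> S -> bool }.

Definition incidence_iso (T S T' S' : finType)
    (D : incidence T S) (D' : incidence T' S') : Prop :=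
  exists (f : T -> T') (g : S -> S'),
  [/\ {in points D &, injective f} /\ f @: points D = points D',
      {in blocks D &, injective g} /\ g @: blocks D = blocks D'
    & {in points D & blocks D, forall x c, inc D' (f x) (g c) = inc D x c}].

Definition Dbar (T : finType) (Ga : graph T) (P : {set {set T}})
    (B : {set T}) : incidence T {set T} :=
  Incidence B (nbr (quot Ga P) B) (fun x C => x \notin nbrs Ga C).

(* The d-dimensional subspaces of F^(n+1), as sets of row vectors. *)
Definition subspaces (F : finFieldType) (n d : nat) :
    {set {set 'rV[F]_n.+1}} :=
  [set [set w : 'rV[F]_n.+1 | (w <= A)%MS] | A : 'M[F]_(d, n.+1) & row_free A].

Definition PG2 (F : finFieldType) :
    incidence {set 'rV[F]_3} {set 'rV[F]_3} :=
  Incidence (subspaces F 2 1) (subspaces F 2 2) (fun p l => p \subset l).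

Section SpecialLinear.
Variables (F : finFieldType) (n : nat).

Definition GLact (w : 'rV[F]_n.+1) (u : {'GL_n.+1[F]}) : 'rV[F]_n.+1 :=
  (w *m GLval u)%R.

Lemma GLact1 : GLact^~ 1%g =1 id.
Proof. by move=> w; rewrite /GLact GL_1E mulmx1. Qed.

Lemma GLactM w : act_morph GLact w.
Proof. by move=> u1 u2; rewrite /GLact GL_MxE mulmxA. Qed.

Canonical GL_action := TotalAction GLact1 GLactM.

Definition SL : {set {'GL_n.+1[F]}} :=
  [set u | (\det (GLval u) == 1)%R].

Lemma SL_group_set : group_set SL.
Proof.
apply/group_setP; split=> [|u1 u2]; first by rewrite inE GL_1E det1.
by rewrite !inE GL_MxE det_mulmx => /eqP-> /eqP->; rewrite GRing.mulr1.
Qed.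

Canonical SL_group := Group SL_group_set.

End SpecialLinear.

(* The groups compared are the permutation groups H^X = H / H_(X) and
   K^Y = K / K_(Y) induced by H on X and by K on Y. *)
Definition perm_isomorphic (aT bT : finGroupType) (T S : finType)
    (to : {action aT &-> T}) (H : {group aT}) (X : {set T})
    (to' : {action bT &-> S}) (K : {group bT}) (Y : {set S}) : Prop :=
  exists (f : T -> S)
         (phi : {morphism (H / 'C_H(X | to))%g >-> coset_of 'C_K(Y | to')%g}),
  [/\ {in X &, injective f} /\ f @: X = Y,
      isom (H / 'C_H(X | to))%g (K / 'C_K(Y | to'))%g phi
    & forall x h k, x \in X -> h \in H -> k \in K ->
        phi (coset 'C_H(X | to)%g h) = coset 'C_K(Y | to')%g k ->
        f (to x h) = to' (f x) k].

Definition is_A4_or_S4 (aT : finGroupType) (T : finType)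
    (to : {action aT &-> T}) (H : {group aT}) (X : {set T}) : Prop :=
  perm_isomorphic to H X 'P 'Alt_('I_4)%G [set: 'I_4] \/
  perm_isomorphic to H X 'P 'Sym_('I_4)%G [set: 'I_4].

(* SL(3, 2) acting on the points of PG(2, 2); perm_isomorphic divides out the
   kernel of this action, the scalar matrices. *)
Definition is_PSL32 (aT : finGroupType) (T : finType)
    (to : {action aT &-> T}) (H : {group aT}) (X : {set T}) : Prop :=
  perm_isomorphic to H X
    (GL_action 'F_2 2)^* (SL_group 'F_2 2) (subspaces 'F_2 2 1).

Section Cases.
Variables (T : finType) (Ga : graph T) (G : {group {perm T}}).
Variable P : {set {set T}}.

Local Notation GaP := (quot Ga P).
Local Notation stab B := ('N_G(B | 'P)%G).

Definition case_a : Prop :=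
  params Ga P 4 4 1 0 /\
  (forall B, B \in P -> is_A4_or_S4 'P (stab B) B).

Definition case_b : Prop :=
  params Ga P 6 2 1 0 /\ giso GaP (cycle_graph (#|vert Ga| %/ 6)).

Definition case_c : Prop :=
  params Ga P 7 7 4 2 /\
  (forall B, B \in P -> is_PSL32 'P (stab B) B).

Definition case_d (a : nat) : Prop :=
  3 <= a /\ params Ga P (3 * a) a (a - 1) (3 * a - 6).

Definition case_e : Prop :=
  params Ga P 6 4 2 1 /\
  (forall B, B \in P -> is_A4_or_S4 'P^* (stab B) (nbr GaP B)).

Definition more_a : Prop :=
  (forall B, B \in P -> is_A4_or_S4 'P^* (stab B) (nbr GaP B)) /\
  giso Ga (copies (#|vert Ga| %/ 2) (Kgraph 2)).

Definition more_b : Prop :=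
  let n := #|vert Ga| %/ 6 in
  [\/ giso Ga (copies (3 * n) (Kgraph 2)),
      giso Ga (copies n (cycle_graph 6))
    | giso Ga (copies n (Kbip 3 3))] /\
  ((G / 'C_G(P | 'P^*)) \isog 'D_(2 * n)%N)%g.

Definition all_between (isoto : graph T -> Prop) : Prop :=
  forall B C, adj GaP B C -> isoto (between Ga B C).

Definition iso_4K2 (Si : graph T) : Prop := giso Si (copies 4 (Kgraph 2)).
Definition iso_K44_minus_4K2 (Si : graph T) : Prop :=
  exists M : graph ('I_4 + 'I_4)%type,
  [/\ spanning_sub M (Kbip 4 4), giso M (copies 4 (Kgraph 2))
    & giso Si (del_edges (Kbip 4 4) M)].
Definition iso_K44 (Si : graph T) : Prop := giso Si (Kbip 4 4).

Definition more_c : Prop :=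
  [/\ forall B, B \in P -> incidence_iso (Dbar Ga P B) (PG2 'F_2),
      forall B, B \in P -> is_PSL32 'P^* (stab B) (nbr GaP B),
      [faithful G, on P | 'P^*],
      [\/ all_between iso_4K2, all_between iso_K44_minus_4K2
        | all_between iso_K44]
    & [/\ all_between iso_4K2 -> arc_transitive 'P G Ga 2,
          all_between iso_K44_minus_4K2 -> connected Ga /\ regular Ga 12
        & all_between iso_K44 -> connected Ga /\ regular Ga 16]].

Definition more_d (a : nat) : Prop :=
  exists Q : {set {set T}},
  [/\ invariant_partition 'P G Q (vert Ga) /\ v_is Q 3,
      forall A, A \in Q -> exists2 B, B \in P & A \subset B,
      exists D : {set 4.-tuple {set T}},
        [/\ self_paired D, orbit_on_3arcs 'P^* G GaP D
          & giso (quot Ga Q) (arc3_graph GaP D)],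
      invariant_partition 'P^* G (hats Q P) Q /\
      giso (quot (quot Ga Q) (hats Q P)) GaP
    & [/\ v_is (hats Q P) a, b_is (quot Ga Q) (hats Q P) a,
          k_is (quot Ga Q) (hats Q P) (a - 1)
        & r_is (quot Ga Q) (hats Q P) (a - 1)]].

Definition more_e : Prop :=
  exists D : {set 4.-tuple {set T}},
  [/\ self_paired D, orbit_on_3arcs 'P^* G GaP D
    & giso Ga (two_path_graph GaP D)].

End Cases.

Definition giso_equivariant (aT bT : finGroupType) (T S : finType)
    (to : {action aT &-> T}) (G : {group aT}) (Ga : graph T)
    (to' : {action bT &-> S}) (H : {group bT}) (Si : graph S) : Prop :=
  exists (f : T -> S) (phi : {morphism G >-> bT}),
  [/\ is_giso Ga Si f, isom G H phi
    & {in vert Ga & G, forall x g, f (to x g) = to' (f x) (phi g)}].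

(* Main.v *)
Require Import Defs.
From mathcomp Require Import all_boot all_order all_fingroup all_algebra.
From mathcomp Require Import all_solvable.
From mathcomp Require Import zify.

(** Fix a block B and call C in the neighbourhood N(B) incident with x in B when
    no vertex of C is adjacent to x.  Every C is incident with exactly 3 points,
    every point with s = b - r of the C's, and 2-transitivity of G_B on N(B)
    makes any two C's share a constant number mu of points.  Double counting
    gives v s = 3 b and 3 (s - 1) = (b - 1) mu with mu <= 3, which leaves
    mu = 0 (cases b and d), mu = 1 (cases c and e; s = 6 dies because the s
    triples through a point need 2 s + 1 points) and mu = 2 (case a).

    In case (c) the structure is a Fano plane, a self-dual configuration.  Three
    non-concurrent lines coordinatize it by F_2^3, and a group of collineations
    that is 2-transitive on points contains all transvections, hence is
    transitive on triangles, hence is PSL(3,2); everything else in (c) follows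
    from triangle-transitivity and its dual.  In cases (d) and (e) a vertex is
    recovered (up to its triple in case d) from the C it misses, respectively
    from the two C's it meets, so that the arcs of Gamma become a self-paired
    orbit of 3-arcs of the quotient.

    Conversely, 4-valent examples are built on the pairs (s, A) with A a set of
    one (case a) or two (case e) neighbours of s; the classification itself then
    tells which case they fall in. *)

Set Implicit Arguments.
Unset Strict Implicit.
Unset Printing Implicit Defensive.

(** * Actions, short arcs and permutation isomorphism *)

(** The group conditions in (a), (c) and (e) all amount to 2-transitivity of the block stabiliser,
    on the points of B or on its neighbouring blocks. So [perm_isomorphic], an isomorphism of
    quotient groups, is unpacked once into the statement that every element on either side acts like
    some element on the other, and afterwards only [trans2_on] is handled.

    Transvections enter as follows. A 2-transitive group has an element exchanging two points of the
    plane, hence of even order. Elements of even order in GL(3,2) have order 2 or 4, and its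
    involutions are transvections, so this element or its square is one; conjugation then yields all
    the others. Vectors are Boolean triples so that such facts about eight vectors can be decided by
    evaluation.

    The sizes one and two of the sets A in the examples come from the constant 3: of the m-subsets
    of four neighbours, C(3,m) avoid a given neighbour, and C(3,m) = 3 exactly for m = 1 and m =
    2. *)

Lemma atrans_intro (aT : finGroupType) (T : finType) (to : {action aT &-> T})
    (G : {group aT}) (S : {set T}) x0 :
    x0 \in S -> (forall x a, x \in S -> a \in G -> to x a \in S) ->
    (forall x, x \in S -> exists2 a, a \in G & to x0 a = x) ->
  [transitive G, on S | to].
Proof.
move=> Sx0 cl tr; apply/imsetP; exists x0 => //.
apply/setP=> x; apply/idP/orbitP=> [/tr[a Ga <-]|[a Ga <-]]; last exact: cl.
by exists a.
Qed.

Lemma double_count (T S : finType) (X : {set T}) (Y : {set S})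
    (R : T -> S -> bool) :
  \sum_(x in X) #|[set y in Y | R x y]| = \sum_(y in Y) #|[set x in X | R x y]|.
Proof.
have cs (U : finType) (Z : {set U}) (p : pred U) :
    #|[set z in Z | p z]| = \sum_(z in Z) (p z : nat).
  rewrite -sum1dep_card big_mkcondr /=.
  by apply: eq_bigr => z _; case: (p z).
under eq_bigr do rewrite cs; rewrite exchange_big /=.
by apply: eq_bigr => y _; rewrite cs.
Qed.

Lemma cards1P_ex (T : finType) (A : {set T}) :
  #|A| = 1 -> exists x, A = [set x].
Proof. by move/eqP/cards1P. Qed.

Lemma card_compl_in (T : finType) (A : {set T}) (p : pred T) :
  #|[set x in A | ~~ p x]| = #|A| - #|[set x in A | p x]|.
Proof.
rewrite -(cardsID [set x in A | p x] A).
have -> : A :&: [set x in A | p x] = [set x in A | p x].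
  by apply/setP=> x; rewrite !inE; case: (x \in A).
rewrite addKn; congr #|pred_of_set _|; apply/setP=> x.
by rewrite !inE; case: (x \in A); rewrite /= ?andbT.
Qed.

Section SmallArcs.
Variables (T : finType) (Ga : graph T).
Hypothesis sG : simple_graph Ga.

Let adj_sym : symmetric (adj Ga). Proof. by case: sG. Qed.
Let adjv x y : adj Ga x y -> (x \in vert Ga) * (y \in vert Ga).
Proof.
case: sG => _ _ h a; split; first exact: h a.
by rewrite adj_sym in a; exact: h a.
Qed.

Lemma sarcs1E x y : ([tuple x; y] \in sarcs Ga 1) = adj Ga x y.
Proof.
rewrite inE /= !andbT; apply/idP/idP; first by case/and3P.
move=> a; rewrite !(adjv a) a /=.
apply/forallP=> -[i hi]; apply/forallP=> -[j hj].
(* Positions in a 2-tuple never differ by 2, so the condition against backtracking is vacuous. *)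
by apply/implyP=> /= /eqP; lia.
Qed.

Lemma sarcs2E x y z :
  ([tuple x; y; z] \in sarcs Ga 2) = [&& adj Ga x y, adj Ga y z & x != z].
Proof.
rewrite inE /= !andbT; apply/idP/idP.
  case/and3P=> _ /andP[-> ->] /forallP/(_ ord0)/forallP/(_ ord_max).
  by rewrite !(tnth_nth x).
case/and3P=> a1 a2 ne; rewrite !(adjv a1) !(adjv a2) a1 a2 /=.
apply/forallP=> -[i hi]; apply/forallP=> -[j hj].
apply/implyP=> /= /eqP e; have i0 : i = 0 by lia.
by subst i j; rewrite !(tnth_nth x).
Qed.

Lemma sarcs3E w x y z :
  ([tuple w; x; y; z] \in sarcs Ga 3) =
  [&& adj Ga w x, adj Ga x y, adj Ga y z, w != y & x != z].
Proof.
rewrite inE /= !andbT; apply/idP/idP.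
  case/and3P=> _ /and3P[-> -> ->] h /=; apply/andP; split.
    move/forallP: h=> /(_ ord0)/forallP/(_ (inord 2)).
    by rewrite !(tnth_nth x) !inordK.
  move/forallP: h=> /(_ (inord 1))/forallP/(_ (inord 3)).
  by rewrite !(tnth_nth x) !inordK.
case/and5P=> a1 a2 a3 ne1 ne2; rewrite !(adjv a1) !(adjv a2) !(adjv a3) a1 a2 a3.
apply/forallP=> -[i hi]; apply/forallP=> -[j hj].
apply/implyP=> /= /eqP e; have i0 : (i == 0) || (i == 1) by lia.
by case/orP: i0 => /eqP i0; subst i j; rewrite !(tnth_nth x).
Qed.

Variables (aT : finGroupType) (to : {action aT &-> T}) (G : {group aT}).

(** Transitivity is restated on elements here and in the next two definitions, so that tuples occur
    only in the lemmas that pass to and from [arc_transitive]. *)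
Definition vertex_trans := {in vert Ga &, forall x y, exists2 g, g \in G & to x g = y}.

Definition arc_trans := forall x y x' y', adj Ga x y -> adj Ga x' y' ->
  exists2 g, g \in G & to x g = x' /\ to y g = y'.

Definition arc2_trans := forall x y z x' y' z',
  [&& adj Ga x y, adj Ga y z & x != z] ->
  [&& adj Ga x' y', adj Ga y' z' & x' != z'] ->
  exists2 g, g \in G & [/\ to x g = x', to y g = y' & to z g = z'].

Lemma atrans_vertex : [transitive G, on vert Ga | to] -> vertex_trans.
Proof. by move=> tr x y Vx Vy; have [g ? ?] := atransP2 tr Vx Vy; exists g. Qed.

Lemma arc_transitive1_elim : arc_transitive to G Ga 1 ->
  [/\ vertex_trans, arc_trans & exists x, exists y, adj Ga x y].
Proof.
case=> /atrans_vertex tv ta; split=> // [x y x' y'|].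
  rewrite -!sarcs1E => a1 a2; have [g Gg e] := atransP2 ta a1 a2.
  exists g => //; have := congr1 (fun t => tnth t ord0) e.
  have := congr1 (fun t => tnth t ord_max) e.
  by rewrite !(tnth_nth x) /= => -> ->.
case/imsetP: ta => t; case/tupleP: t => x t; case/tupleP: t => y t.
by rewrite tuple0 sarcs1E; exists x, y.
Qed.

Lemma arc_transitive2_elim : arc_transitive to G Ga 2 ->
  vertex_trans /\ arc2_trans.
Proof.
case=> /atrans_vertex tv ta; split=> // x y z x' y' z'.
rewrite -!sarcs2E => a1 a2; have [g Gg e] := atransP2 ta a1 a2.
exists g => //; have := congr1 (fun t => tnth t ord0) e.
have := congr1 (fun t => tnth t ord_max) e.
have := congr1 (fun t => tnth t (inord 1)) e.
by rewrite !(tnth_nth x) /= !inordK //= => -> -> ->.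
Qed.

Hypothesis cadj : forall x y g, g \in G -> adj Ga (to x g) (to y g) = adj Ga x y.
Hypothesis cvert : forall x g, g \in G -> x \in vert Ga -> to x g \in vert Ga.

Lemma vertex_atrans x0 : x0 \in vert Ga -> vertex_trans ->
  [transitive G, on vert Ga | to].
Proof.
move=> V0 tv; apply: (atrans_intro V0) => [x a Vx Ga'|x Vx]; first exact: cvert.
by have [g] := tv _ _ V0 Vx; exists g.
Qed.

Lemma arc_transitive1_intro x0 y0 : adj Ga x0 y0 ->
  vertex_trans -> arc_trans -> arc_transitive to G Ga 1.
Proof.
move=> a0 tv ta; split; first by apply: (vertex_atrans _ tv); exact: (adjv a0).1.
apply: (@atrans_intro _ _ _ _ _ [tuple x0; y0]); first by rewrite sarcs1E.
  move=> t a; case/tupleP: t => x t; case/tupleP: t => y t; rewrite tuple0 => h Ga'.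
  have -> : (to * 2)%act [tuple of [:: x, y & [tuple]]] a =
            [tuple to x a; to y a] by apply: val_inj.
  by rewrite sarcs1E cadj // -sarcs1E.
move=> t; case/tupleP: t => x t; case/tupleP: t => y t; rewrite tuple0.
rewrite sarcs1E => h; have [g Gg [ex ey]] := ta _ _ _ _ a0 h.
by exists g => //; apply: val_inj; rewrite /= ex ey.
Qed.

Lemma arc_transitive2_intro x0 y0 z0 :
  [&& adj Ga x0 y0, adj Ga y0 z0 & x0 != z0] ->
  vertex_trans -> arc2_trans -> arc_transitive to G Ga 2.
Proof.
move=> a0 tv ta; split.
  by apply: (vertex_atrans _ tv); case/andP: a0 => a0 _; exact: (adjv a0).1.
apply: (@atrans_intro _ _ _ _ _ [tuple x0; y0; z0]); first by rewrite sarcs2E.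
  move=> t a; case/tupleP: t => x t; case/tupleP: t => y t; case/tupleP: t => z t.
  rewrite tuple0 => h Ga'.
  have -> : (to * 3)%act [tuple of [:: x, y, z & [tuple]]] a =
            [tuple to x a; to y a; to z a] by apply: val_inj.
  by rewrite sarcs2E !cadj // (inj_eq (act_inj to a)) -sarcs2E.
move=> t; case/tupleP: t => x t; case/tupleP: t => y t; case/tupleP: t => z t.
rewrite tuple0 sarcs2E => h; have [g Gg [ex ey ez]] := ta _ _ _ _ _ _ a0 h.
by exists g => //; apply: val_inj; rewrite /= ex ey ez.
Qed.

End SmallArcs.

(** * Permutation isomorphism, element by element *)

Section PermIso.
Variables (aT bT : finGroupType) (T S : finType).
Variables (to : {action aT &-> T}) (H : {group aT}) (X : {set T}).
Variables (to' : {action bT &-> S}) (K : {group bT}) (Y : {set S}).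

Definition acts_like (f : T -> S) (h : aT) (k : bT) :=
  {in X, forall x, f (to x h) = to' (f x) k}.

Lemma perm_isomorphic_elim : perm_isomorphic to H X to' K Y ->
  [acts H, on X | to] -> [acts K, on Y | to'] ->
  exists f : T -> S, [/\ {in X &, injective f}, f @: X = Y,
    {in H, forall h, exists2 k, k \in K & acts_like f h k}
  & {in K, forall k, exists2 h, h \in H & acts_like f h k}].
Proof.
move=> [f [phi [[injf imf] isom_phi like]]] aH aK.
have nH : H \subset 'N('C_H(X | to))%g by rewrite normsI ?normG // (subset_trans _ (astab_norm _ _)).
exists f; split=> // [h Hh | k Kk].
  have : phi (coset 'C_H(X | to)%g h) \in (K / 'C_K(Y | to'))%g.
    by rewrite -(isom_im isom_phi) mem_morphim ?mem_quotient.
  by case/morphimP=> k _ Kk e; exists k => // x Xx; apply: like.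
have : coset 'C_K(Y | to')%g k \in (phi @* (H / 'C_H(X | to)))%g.
  by rewrite (isom_im isom_phi) mem_quotient.
case/morphimP=> u _ /morphimP[h _ Hh ->] e; exists h => // x Xx.
by apply: like.
Qed.

(** An element of K acting like h is unique modulo the kernel on Y, because f maps X onto Y. Sending
    h to the coset of such an element is therefore a morphism; its kernel is the kernel of H on X,
    so it factors through the quotient. *)
Lemma perm_isomorphic_intro (f : T -> S) :
    [acts H, on X | to] -> [acts K, on Y | to'] ->
    {in X &, injective f} -> f @: X = Y ->
    {in H, forall h, exists2 k, k \in K & acts_like f h k} ->
    {in K, forall k, exists2 h, h \in H & acts_like f h k} ->
  perm_isomorphic to H X to' K Y.
Proof.
move=> aH aK injf imf HK KH.
have nH : H \subset 'N('C_H(X | to))%g by rewrite normsI ?normG // (subset_trans _ (astab_norm _ _)).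
have nK : K \subset 'N('C_K(Y | to'))%g by rewrite normsI ?normG // (subset_trans _ (astab_norm _ _)).
pose like h k := (k \in K) && [forall x in X, f (to x h) == to' (f x) k].
have likeP h k : reflect (k \in K /\ acts_like f h k) (like h k).
  apply: (iffP andP) => -[Kk /= e]; split=> //.
    by move=> x Xx; apply/eqP; exact: (forall_inP e).
  by apply/forall_inP=> x Xx; rewrite e.
(* For h in H the default 1 is never reached, by [HK]; it only makes F total. *)
pose F h := coset 'C_K(Y | to')%g (odflt 1%g [pick k | like h k]).
have cosetF k k' : k \in K -> k' \in K -> {in Y, forall y, to' y k = to' y k'} ->
    coset 'C_K(Y | to')%g k = coset 'C_K(Y | to')%g k'.
  move=> Kk Kk' e; apply/eqP; rewrite eq_mulgV1 -morphV ?(subsetP nK) //.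
  rewrite -morphM ?groupV ?(subsetP nK) //; apply/eqP; apply: coset_id.
  rewrite inE groupM ?groupV //=; apply/astabP=> y Yy.
  by rewrite actM e // actK.
have FP h k : h \in H -> k \in K -> acts_like f h k ->
    F h = coset 'C_K(Y | to')%g k.
  move=> Hh Kk lk; rewrite /F; case: pickP => [k' /likeP[Kk' lk'] /=|/(_ k)].
    apply: cosetF => // y; rewrite -imf => /imsetP[x Xx ->].
    by rewrite -lk // -lk'.
  by move/likeP; case.
have FM : {in H &, {morph F : x y / (x * y)%g}}.
  move=> h1 h2 Hh1 Hh2; have [k1 Kk1 l1] := HK _ Hh1; have [k2 Kk2 l2] := HK _ Hh2.
  rewrite (FP h1 k1) // (FP h2 k2) // -morphM ?(subsetP nK) //.
  apply: FP; rewrite ?groupM // => x Xx; rewrite !actM l2 ?l1 //.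
  by rewrite (acts_act aH).
pose Fm := Morphism FM.
have kerF : ('ker Fm = 'C_H(X | to))%g.
  apply/setP=> h; apply/idP/idP=> [/morphpreP[Hh]|].
    rewrite inE => /eqP /= e1; have [k Kk lk] := HK _ Hh.
    move: e1; rewrite (FP _ k) // => /coset_idr - /(_ (subsetP nK _ Kk)).
    rewrite inE => /andP[_ /astabP cY]; rewrite inE Hh; apply/astabP=> x Xx.
    apply: injf; rewrite ?(acts_act aH) // lk // cY // -imf.
    exact: imset_f.
  rewrite inE => /andP[Hh /astabP cX]; rewrite !inE Hh /= (FP _ 1%g) //.
    by rewrite morph1.
  by move=> x Xx; rewrite cX // act1.
have kerq : ('ker (coset 'C_H(X | to)) \subset 'ker Fm)%g by rewrite ker_coset kerF.
exists f, (factm_morphism kerq nH); split=> //.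
  apply/isomP; split=> /=.
    rewrite ker_factm kerF; apply/subsetP=> u /morphimP[h _ Hh ->].
    by rewrite inE; apply/eqP; exact: coset_id.
  rewrite morphim_factm; apply/setP=> u; apply/idP/idP=> /morphimP[].
    move=> h _ Hh -> /=; have [k Kk lk] := HK _ Hh.
    by rewrite (FP _ k) // mem_quotient.
  move=> k _ Kk -> /=; have [h Hh lk] := KH _ Kk.
  by apply/morphimP; exists h => //=; rewrite (FP h k).
move=> x h k Xx Hh Kk; set u := (X in X = _) => e.
have {}e : F h = coset 'C_K(Y | to')%g k by rewrite -e; apply/esym/factmE.
have [k' Kk' lk'] := HK _ Hh; rewrite lk' //.
move: e; rewrite (FP _ k') // => /eqP.
rewrite eq_mulgV1 -morphV ?(subsetP nK) // -morphM ?groupV ?(subsetP nK) //.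
move/eqP/coset_idr; rewrite groupM ?groupV ?(subsetP nK) // => /(_ isT).
rewrite inE => /andP[_ /astabP/(_ (f x))]; rewrite -imf imset_f // actM => /(_ isT) e.
by rewrite -{2}e actKV.
Qed.

End PermIso.

(** * Groups of degree four and elementary graphs *)

Lemma set_bij_ord (T : finType) (X : {set T}) n : #|X| = n.+1 ->
  exists f : T -> 'I_n.+1, {in X &, injective f} /\ f @: X = setT.
Proof.
move=> cX; pose f x : 'I_n.+1 := inord (index x (enum X)).
have lt x : x \in X -> index x (enum X) < n.+1.
  by move=> Xx; rewrite -cX cardE index_mem mem_enum.
have injf : {in X &, injective f}.
  move=> x y Xx Xy /(congr1 val) /=; rewrite !inordK ?lt //.
  by move=> e; rewrite -(nth_index x (s := enum X) (x := x)) ?e ?nth_index ?mem_enum.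
exists f; split=> //; apply/eqP; rewrite eqEcard subsetT cardsT card_ord.
by rewrite (card_in_imset injf) cX leqnn.
Qed.

Definition trans2_on (aT : finGroupType) (T : finType) (to : {action aT &-> T})
    (H : {set aT}) (X : {set T}) :=
  forall x y x' y', x \in X -> y \in X -> x' \in X -> y' \in X ->
    x != y -> x' != y' ->
  exists2 h, h \in H & to x h = x' /\ to y h = y'.

Lemma index2_mul (gT : finGroupType) (K : {group gT}) x y :
  #|[set: gT] : K|%g = 2 -> x \notin K -> y \notin K -> (x * y)%g \in K.
Proof.
move=> iK nx ny; rewrite -groupV invMg.
have dis : [disjoint K & K :* x]%g.
  rewrite -setI_eq0; apply/eqP/setP=> z; rewrite !inE; apply/negP=> /andP[Kz].
  rewrite mem_rcoset => Kzx; case/negP: nx.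
  by rewrite -groupV -(groupMl _ Kz).
have full : (K :|: K :* x)%g = setT.
  apply/eqP; rewrite eqEcard subsetT cardsU disjoint_setI0 // cards0 subn0.
  by rewrite card_rcoset -(Lagrange (subsetT K)) iK muln2 addnn /=.
have : (y^-1)%g \in (K :|: K :* x)%g by rewrite full inE.
by rewrite inE groupV (negPf ny) mem_rcoset.
Qed.

(** If K contains a transposition, 2-transitivity conjugates it to every other one and K is
    symmetric. Otherwise the orbit of a point (4) and of its stabiliser on the other points (3) give
    12 | #|K|, so K has index 2 and omits every transposition, which makes membership in K the
    parity. *)
Lemma trans2_deg4_Alt_or_Sym (K : {group 'S_4}) :
  trans2_on 'P K [set: 'I_4] -> (K :=: 'Alt_('I_4))%g \/ (K :=: 'Sym_('I_4))%g.
Proof.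
move=> tr2; pose i0 : 'I_4 := ord0; pose i1 : 'I_4 := inord 1.
have i01 : i0 != i1 by rewrite -val_eqE /= inordK.
have [nt|nt] := boolP [exists a, exists b, (a != b) && (tperm a b \in K)].
  have [a /existsP[b /andP[ab Kab]]] := existsP nt.
  have allt c d : c != d -> tperm c d \in K.
    move=> cd; have [k Kk [kc kd]] := tr2 a b c d (in_setT _) (in_setT _)
      (in_setT _) (in_setT _) ab cd.
    by rewrite -kc -kd -[X in X \in _]/(tperm (k a) (k b)) -tpermJ groupJ.
  right; apply/setP=> s; rewrite [in RHS]inE.
  have [ts -> dts] := prod_tpermP s.
  elim: ts dts => [|t ts IH] /=; first by rewrite big_nil group1.
  by case/andP=> dt dts; rewrite big_cons groupM ?allt ?IH.
have nK c d : c != d -> tperm c d \notin K.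
  move=> cd; apply: contra nt => Kcd; apply/existsP; exists c; apply/existsP.
  by exists d; rewrite cd.
have tr1 : [transitive K, on [set: 'I_4] | 'P].
  apply: (atrans_intro (in_setT i0)) => [//|x _].
  have [y xy] : exists y, x != y.
    by have [<-|] := eqVneq i0 x; [exists i1 | exists i0; rewrite eq_sym].
  by have [k Kk [kx _]] := tr2 i0 i1 x y (in_setT _) (in_setT _)
      (in_setT _) (in_setT _) i01 xy; exists k.
have d4 : 4 %| #|K| by have := atrans_dvd tr1; rewrite cardsT card_ord.
have tr3 : [transitive 'C_K[i0 | 'P], on [set~ i0] | 'P].
  apply: (@atrans_intro _ _ _ _ _ i1).
  - by rewrite !inE eq_sym.
  - move=> x a; rewrite !inE => xi /andP[_].
    rewrite sub1set inE /= => /eqP {1}<-.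
    by rewrite (inj_eq (act_inj 'P a)).
  move=> x; rewrite !inE eq_sym => xi.
  have [k Kk [kx ky]] := tr2 i0 i1 i0 x (in_setT _) (in_setT _)
      (in_setT _) (in_setT _) i01 xi; exists k => //.
  by rewrite inE Kk; apply/astab1P.
have d3 : 3 %| #|K|.
  have := atrans_dvd tr3; rewrite cardsC1 card_ord => d.
  by apply: (dvdn_trans d); apply: cardSg; apply: subsetIl.
have cS : #|[set: 'S_4]| = 24 by rewrite card_Sym card_ord.
have dK := cardSg (subsetT K); rewrite cS in dK.
have d12 : 12 %| #|K| by rewrite (@Gauss_dvd 4 3) ?d4.
have iK : #|[set: 'S_4] : K|%g = 2.
  rewrite -divgS ?subsetT // cS; case/dvdnP: d12 => q eq.
  have nf : K :!=: setT.
    by apply/negP=> /eqP e; move: (nK _ _ i01); rewrite e inE.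
  have : #|K| < 24.
    rewrite ltn_neqAle dvdn_leq // andbT; apply: contra nf => /eqP e.
    by rewrite eqEcard subsetT cS e.
  have := cardG_gt0 K; rewrite eq; by case: q eq => [|[|q]].
left; apply/setP=> s; rewrite Alt_even.
have [ts -> dts] := prod_tpermP s; rewrite odd_perm_prod //.
elim: ts dts => [|t ts IH] /=; first by rewrite big_nil group1.
case/andP=> dt dts; rewrite big_cons negbK.
have {}IH := IH dts; have nt1 := nK _ _ dt.
have [o|o] := boolP (odd (size ts)).
  by apply: index2_mul => //; rewrite IH o.
by rewrite groupMr ?IH ?o // (negPf nt1).
Qed.

Section DegreeFour.
Variables (aT : finGroupType) (T : finType) (to : {action aT &-> T}).
Variables (H : {group aT}) (X : {set T}).
Hypothesis aH : [acts H, on X | to].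

Let acts_setT_ord (K : {group 'S_4}) : [acts K, on [set: 'I_4] | 'P].
Proof. by apply/subsetP=> k _; apply/astabsP=> x; rewrite !inE. Qed.

(** The permutations of ['I_4] induced by H through a numbering f of X form a 2-transitive group K,
    to which the classification in degree four applies. *)
Lemma A4_or_S4_intro : #|X| = 4 -> trans2_on to H X -> is_A4_or_S4 to H X.
Proof.
move=> cX tr2; have [f [injf imf]] := set_bij_ord cX.
have [x0 Xx0] : exists x, x \in X by apply/card_gt0P; rewrite cX.
pose g i := odflt x0 [pick x in X | f x == i].
have gP i : g i \in X /\ f (g i) = i.
  rewrite /g; case: pickP => [x /andP[Xx /eqP] //|/=].
  have : i \in f @: X by rewrite imf inE.
  by case/imsetP=> x Xx -> /(_ x); rewrite Xx eqxx.
have fK x : x \in X -> g (f x) = x.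
  by move=> Xx; apply: injf => //; case: (gP (f x)).
pose like h s := [forall x in X, f (to x h) == 'P%act (f x) s].
pose K := [set s : 'S_4 | [exists h in H, like h s]].
have KP s : reflect (exists2 h, h \in H & acts_like to X 'P f h s) (s \in K).
  rewrite inE; apply: (iffP existsP) => [[h /andP[Hh l]]|[h Hh l]]; exists h => //.
    by move=> x Xx; apply/eqP; exact: (forall_inP l).
  by rewrite Hh; apply/forall_inP=> x Xx; rewrite l.
have gK : group_set K.
  apply/group_setP; split.
    by apply/KP; exists 1%g => // x Xx; rewrite !act1.
  move=> s1 s2 /KP[h1 Hh1 l1] /KP[h2 Hh2 l2]; apply/KP.
  exists (h1 * h2)%g; first exact: groupM.
  by move=> x Xx; rewrite !actM l2 ?l1 ?(acts_act aH).
have HK h : h \in H -> exists2 s : 'S_4, s \in K & acts_like to X 'P f h s.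
  move=> Hh; pose s0 i := f (to (g i) h).
  have inj0 : injective s0.
    move=> i j /injf e; have [Xi fi] := gP i; have [Xj fj] := gP j.
    rewrite -fi -fj; congr f; apply: (act_inj to h); apply: e.
      by rewrite (acts_act aH).
    by rewrite (acts_act aH).
  have l : acts_like to X 'P f h (perm inj0).
    by move=> x Xx; rewrite [RHS]permE /s0 fK.
  by exists (perm inj0) => //; apply/KP; exists h.
have trK : trans2_on 'P (Group gK) [set: 'I_4].
  move=> i j i' j' _ _ _ _ ij ij'.
  have [[Xi fi] [Xj fj]] := (gP i, gP j).
  have [[Xi' fi'] [Xj' fj']] := (gP i', gP j').
  have [||h Hh [hi hj]] := tr2 _ _ _ _ Xi Xj Xi' Xj'.
  - by apply: contra ij => /eqP e; rewrite -fi -fj e.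
  - by apply: contra ij' => /eqP e; rewrite -fi' -fj' e.
  have [s Ks l] := HK _ Hh; exists s => //.
  by rewrite -{1}fi -{1}fj -!l // hi hj.
have [e|e] := trans2_deg4_Alt_or_Sym trK; [left|right].
  apply: (perm_isomorphic_intro aH (acts_setT_ord _) injf imf).
    by move=> h /HK[s Ks l]; exists s => //=; rewrite -e.
  by move=> s /=; rewrite -e => /KP.
apply: (perm_isomorphic_intro aH (acts_setT_ord _) injf imf).
  by move=> h /HK[s Ks l]; exists s => //=; rewrite -e.
by move=> s /=; rewrite -e => /KP.
Qed.

Lemma Alt4_trans2 (K : {group 'S_4}) :
  ('Alt_('I_4) \subset K)%g -> trans2_on 'P K [set: 'I_4].
Proof.
move=> sK x y x' y' _ _ _ _ xy xy'.
(* The alternating group of degree n is (n-2)-transitive, and n - 2 = 2 here. *)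
have := Alt_trans 'I_4; rewrite card_ord => tr.
have d (a c : 'I_4) : a != c -> [tuple a; c] \in 2.-dtuple(setT).
  move=> ac; rewrite inE /= inE ac; apply/subsetP=> z _; exact: in_setT.
have [s As e] := atransP2 tr (d _ _ xy) (d _ _ xy').
exists s; first exact: (subsetP sK).
have := congr1 (fun t => tnth t ord0) e.
have := congr1 (fun t => tnth t ord_max) e.
by rewrite !(tnth_nth x) /= => -> ->.
Qed.

Lemma A4_or_S4_trans2 : is_A4_or_S4 to H X -> trans2_on to H X.
Proof.
suff tr (K : {group 'S_4}) : ('Alt_('I_4) \subset K)%g ->
    perm_isomorphic to H X 'P K [set: 'I_4] -> trans2_on to H X.
  by case; apply: tr => //; exact: subsetT.
move=> sK /perm_isomorphic_elim - /(_ aH (acts_setT_ord _)) [f [injf imf HK KH]] x y x' y' Xx Xy Xx' Xy' xy xy'.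
have [|||||| k Kk [kx ky]] := Alt4_trans2 sK (x := f x) (y := f y) (x' := f x') (y' := f y');
  rewrite ?in_setT ?(inj_in_eq injf) //.
have [h Hh l] := KH _ Kk; exists h => //; split; apply: injf;
  by rewrite ?(acts_act aH) // l // ?kx ?ky.
Qed.

End DegreeFour.

Lemma is_giso_comp (T S U : finType) (Ga : graph T) (Si : graph S) (Th : graph U)
    f g : is_giso Ga Si f -> is_giso Si Th g -> is_giso Ga Th (g \o f).
Proof.
move=> [injf imf af] [injg img ag].
have fV x : x \in vert Ga -> f x \in vert Si by rewrite -imf; exact: imset_f.
split.
- by move=> x y Vx Vy /injg - /(_ (fV _ Vx) (fV _ Vy)) /injf; apply.
- by rewrite imset_comp imf.
- by move=> x y Vx Vy; rewrite /= ag ?fV // af.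
Qed.

Lemma giso_trans (T S U : finType) (Ga : graph T) (Si : graph S) (Th : graph U) :
  giso Ga Si -> giso Si Th -> giso Ga Th.
Proof. by move=> [f hf] [g hg]; exists (g \o f); exact: is_giso_comp hf hg. Qed.

Lemma card_fibers (T I : finType) (V : {set T}) (e : T -> I) m :
  (forall j, j \in e @: V -> #|[set x in V | e x == j]| = m) ->
  #|V| = #|e @: V| * m.
Proof.
move=> h; rewrite -sum1_card (partition_big_imset e) /=.
rewrite -sum_nat_const; apply: eq_bigr => j Jj.
by rewrite -(h j Jj) -sum1dep_card.
Qed.

(** The label e is constant along edges, so no edge joins two fibres and an isomorphism may be
    chosen on each fibre separately. The vertex s0 only provides a value at labels that do not
    occur. *)
Lemma giso_copies (T S I : finType) (Ga : graph T) (Si : graph S) (e : T -> I) (s0 : S) :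
    vert Ga != set0 ->
    {in vert Ga &, forall x y, adj Ga x y -> e x = e y} ->
    (forall j, j \in e @: vert Ga ->
       giso (induced Ga [set x in vert Ga | e x == j]) Si) ->
  giso Ga (copies #|e @: vert Ga| Si).
Proof.
case/set0Pn=> x0 Vx0 ade loc; set J := e @: vert Ga.
have J0 : e x0 \in J by exact: imset_f.
have /fin_all_exists[l lP] : forall j : I, exists l : T -> S,
    j \in J -> is_giso (induced Ga [set x in vert Ga | e x == j]) Si l.
  move=> j; have [Jj|_] := boolP (j \in J); last by exists (fun=> s0).
  by have [l hl] := loc _ Jj; exists l.
exists (fun x => (enum_rank_in J0 (e x), l (e x) x)).
have eJ x : x \in vert Ga -> e x \in J by exact: imset_f.
have rk x y : x \in vert Ga -> y \in vert Ga ->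
    (enum_rank_in J0 (e x) == enum_rank_in J0 (e y)) = (e x == e y).
  move=> Vx Vy; apply/eqP/eqP=> [|-> //] h.
  by rewrite -(enum_rankK_in J0 (eJ x Vx)) h enum_rankK_in ?eJ.
split.
- move=> x y Vx Vy [/eqP]; rewrite rk // => /eqP exy el.
  have [injl _ _] := lP _ (eJ _ Vy); rewrite exy in el.
  by apply: injl el; rewrite !inE ?Vx ?Vy ?exy eqxx.
- apply/setP=> -[i s]; rewrite [in RHS]inE /=; apply/imsetP/idP.
    case=> x Vx [_ ->]; have [_ <- _] := lP _ (eJ _ Vx).
    by apply: imset_f; rewrite !inE Vx eqxx.
  move=> Vs; have Ji := enum_valP i.
  have [_ im _] := lP _ Ji; rewrite -im in Vs.
  case/imsetP: Vs => x; rewrite !inE => /andP[Vx /eqP ex] es.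
  by exists x => //; rewrite ex enum_valK_in es.
move=> x y Vx Vy; rewrite /= rk //; case: eqP => [exy|ne] /=; last first.
  by apply/esym/negP=> /ade - /(_ Vx Vy).
have [_ _ al] := lP _ (eJ _ Vx); rewrite -exy al.
- by rewrite /= !inE Vx Vy exy eqxx.
- by rewrite !inE Vx eqxx.
- by rewrite !inE Vy exy eqxx.
Qed.

(** The closed neighbourhood of a vertex is the edge through it, so the fibres of e are the edges
    themselves. *)
Lemma regular1_giso (T : finType) (Ga : graph T) :
  simple_graph Ga -> regular Ga 1 -> vert Ga != set0 ->
  giso Ga (copies (#|vert Ga| %/ 2) (Kgraph 2)).
Proof.
move=> [sy irr av] reg V0; pose e x := x |: nbr Ga x.
have nb x : x \in vert Ga -> exists y, [/\ nbr Ga x = [set y], nbr Ga y = [set x],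
    y \in vert Ga & x != y].
  move=> Vx; have [y ey] := cards1P_ex (reg _ Vx).
  have axy : adj Ga x y by have := set11 y; rewrite -ey inE.
  have Vy : y \in vert Ga by apply: (av y x); rewrite sy.
  have [z ez] := cards1P_ex (reg _ Vy).
  have : x \in nbr Ga y by rewrite inE sy.
  rewrite ez inE => /eqP xz; exists y; split=> //; first by rewrite xz.
  by apply: contraTN axy => /eqP ->; rewrite irr.
have fib j : j \in e @: vert Ga -> exists x y, [/\ x \in vert Ga, x != y,
    [set z in vert Ga | e z == j] = [set x; y] & adj Ga x y].
  case/imsetP=> x Vx ->; have [y [nx ny Vy xy]] := nb _ Vx; exists x, y; split=> //.
    apply/setP=> z; rewrite !inE /e nx; apply/idP/idP.
      by case/andP=> _ /eqP h; have := set11 z; rewrite -in_set2 -h !inE eqxx.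
    case/orP=> /eqP->; first by rewrite Vx nx eqxx.
    by rewrite Vy ny setUC eqxx.
  by have := set11 y; rewrite -nx inE.
have -> : #|vert Ga| %/ 2 = #|e @: vert Ga|.
  rewrite (@card_fibers _ _ (vert Ga) e 2) ?mulnK // => j /fib[x [y [_ xy -> _]]].
  by rewrite cards2 xy.
apply: (giso_copies ord0) => // [x y Vx Vy axy|j /fib[x [y [Vx xy -> axy]]]].
  have [z [nx nz _ _]] := nb _ Vx.
  have : y \in nbr Ga x by rewrite inE.
  by rewrite nx inE => /eqP->; rewrite /e nx nz setUC.
exists (fun z => if z == x then ord0 else ord_max).
have yx : (y == x) = false by apply: negbTE; rewrite eq_sym.
split=> /=.
- by move=> u w; rewrite !inE => /orP[]/eqP-> /orP[]/eqP->; rewrite ?eqxx ?yx.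
- rewrite imsetU !imset_set1 eqxx yx; apply/setP=> i; rewrite !inE.
  by case: i => [[|[|//]] ?]; rewrite -!val_eqE.
- move=> u w; rewrite !inE => /orP[]/eqP-> /orP[]/eqP->;
  by rewrite ?eqxx ?yx ?irr ?orbT ?axy //= sy axy.
Qed.

Definition bip_graph n (R : rel 'I_n) : graph ('I_n + 'I_n)%type :=
  Graph setT (fun u v => match u, v with
                         | inl i, inr j | inr j, inl i => R i j
                         | _, _ => false
                         end).

Lemma giso_bip (T : finType) (Ga : graph T) (X Y : {set T}) n (fx fy : T -> 'I_n)
    (R : rel 'I_n) :
    symmetric (adj Ga) -> [disjoint X & Y] ->
    {in X &, injective fx} -> fx @: X = setT ->
    {in Y &, injective fy} -> fy @: Y = setT ->
    {in X &, forall x y, ~~ adj Ga x y} -> {in Y &, forall x y, ~~ adj Ga x y} ->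
    {in X & Y, forall x y, adj Ga x y = R (fx x) (fy y)} ->
  giso (induced Ga (X :|: Y)) (bip_graph R).
Proof.
move=> sy dXY ix mx iy my nX nY aR.
have XY x : x \in Y -> (x \in X) = false.
  exact: (disjointFl dXY).
exists (fun x => if x \in X then inl (fx x) else inr (fy x)); split=> /=.
- move=> u w /setUP[] hu /setUP[] hw; rewrite ?hu ?hw ?(XY _ hu) ?(XY _ hw) //.
    by case=> /ix; apply.
  by case=> /iy; apply.
- apply/setP=> -[] i; rewrite [RHS]in_setT; apply/imsetP.
    have : i \in fx @: X by rewrite mx inE.
    by case/imsetP=> x Xx ->; exists x; rewrite ?inE Xx.
  have : i \in fy @: Y by rewrite my inE.
  by case/imsetP=> y Yy ->; exists y; rewrite ?inE ?(XY _ Yy) ?Yy ?orbT.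
- move=> u w Uu Uw; rewrite Uu Uw /=; case/setUP: Uu => hu; case/setUP: Uw => hw;
  rewrite ?hu ?hw ?(XY _ hu) ?(XY _ hw) //.
  + by apply/esym/negbTE/nX.
  + by rewrite -aR.
  + by rewrite -aR // sy.
  + by apply/esym/negbTE/nY.
Qed.

Lemma giso_bip_full (T : finType) (Ga : graph T) (X Y : {set T}) n :
    symmetric (adj Ga) -> [disjoint X & Y] -> #|X| = n.+1 -> #|Y| = n.+1 ->
    {in X &, forall x y, ~~ adj Ga x y} -> {in Y &, forall x y, ~~ adj Ga x y} ->
    {in X & Y, forall x y, adj Ga x y} ->
  giso (induced Ga (X :|: Y)) (Kbip n.+1 n.+1).
Proof.
move=> sy d /set_bij_ord[fx [ix mx]] /set_bij_ord[fy [iy my]] nX nY a.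
apply: (@giso_trans _ _ _ _ (bip_graph (fun i j : 'I_n.+1 => true))).
  exact: (giso_bip sy d ix mx iy my nX nY).
by exists id; split; [|rewrite imset_id|case=> i [] j].
Qed.

(** Each y in Y is numbered through its unique non-neighbour [m y] in X, which turns non-adjacency
    into equality of numbers. *)
Lemma giso_bip_minus (T : finType) (Ga : graph T) (X Y : {set T}) n :
    symmetric (adj Ga) -> [disjoint X & Y] -> #|X| = n.+1 -> #|Y| = n.+1 ->
    {in X &, forall x y, ~~ adj Ga x y} -> {in Y &, forall x y, ~~ adj Ga x y} ->
    {in X, forall x, #|[set y in Y | ~~ adj Ga x y]| = 1} ->
    {in Y, forall y, #|[set x in X | ~~ adj Ga x y]| = 1} ->
  giso (induced Ga (X :|: Y)) (bip_graph (fun i j : 'I_n.+1 => i != j)).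
Proof.
move=> sy d cX cY nX nY hX hY; have [fx [ix mx]] := set_bij_ord cX.
have [x0 Xx0] : exists x, x \in X by apply/card_gt0P; rewrite cX.
pose m y := odflt x0 [pick x in X | ~~ adj Ga x y].
have mP y : y \in Y -> [/\ m y \in X, ~~ adj Ga (m y) y &
    forall x, x \in X -> ~~ adj Ga x y -> x = m y].
  move=> Yy; have [x e] := cards1P_ex (hY _ Yy).
  have inX z : (z \in X) && ~~ adj Ga z y = (z == x).
    by move/setP: e => /(_ z); rewrite !inE.
  rewrite /m; case: pickP => [z|/(_ x)]; last by rewrite inX eqxx.
  move=> h; have := h; rewrite inX => /eqP->.
  have /andP[-> ->] : (x \in X) && ~~ adj Ga x y by rewrite inX.
  by split=> // w Xw nw; apply/eqP; rewrite -inX Xw.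
apply: (@giso_bip _ _ _ _ _ fx (fx \o m)) => //.
- move=> y z Yy Yz /= /ix; have [Xy ny _] := mP _ Yy; have [Xz nz _] := mP _ Yz.
  move=> /(_ Xy Xz) e; rewrite -e in nz.
  have [w ew] := cards1P_ex (hX _ Xy).
  have : y \in [set w] by rewrite -ew inE Yy.
  have : z \in [set w] by rewrite -ew inE Yz.
  by rewrite !inE => /eqP-> /eqP->.
- apply/setP=> i; rewrite [RHS]inE; apply/imsetP.
  have : i \in fx @: X by rewrite mx inE.
  case/imsetP=> x Xx ->; have [y ey] := cards1P_ex (hX _ Xx).
  have : y \in [set y in Y | ~~ adj Ga x y] by rewrite ey inE.
  rewrite inE => /andP[Yy ny]; exists y => //=; congr fx.
  by have [_ _] := mP _ Yy; apply.
- move=> x y Xx Yy /=; have [Xm nm um] := mP _ Yy.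
  rewrite (inj_in_eq ix) //; apply/idP/idP.
    by apply: contraTneq => ->.
  by apply: contraNT => h; apply/eqP; apply: um.
Qed.

(** In the hexagon the two sides are the even and the odd vertices, and the deleted matching pairs
    antipodes: [inl i] sits at 2i, so [inr i] must sit at 2i + 3. *)
Lemma bip3_giso_C6 : giso (bip_graph (fun i j : 'I_3 => i != j)) (cycle_graph 6).
Proof.
exists (fun u : 'I_3 + 'I_3 => match u with inl i => inord (2 * i) | inr j => inord ((2 * j + 3) %% 6) end).
split.
- move=> [[[|[|[|//]]] ?]|[[|[|[|//]]] ?]] [[[|[|[|//]]] ?]|[[|[|[|//]]] ?]] _ _
    /(congr1 val) /=; rewrite ?inordK //= => _; by [congr inl; apply: val_inj|congr inr; apply: val_inj].
- apply/setP=> i; rewrite [RHS]inE; apply/imsetP.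
  case: i => [[|[|[|[|[|[|//]]]]]] hi].
  + by exists (inl ord0) => //; apply: val_inj; rewrite /= inordK.
  + by exists (inr ord_max) => //; apply: val_inj; rewrite /= inordK.
  + by exists (inl (inord 1)) => //; apply: val_inj; rewrite /= !inordK.
  + by exists (inr ord0) => //; apply: val_inj; rewrite /= inordK.
  + by exists (inl ord_max) => //; apply: val_inj; rewrite /= inordK.
  + by exists (inr (inord 1)) => //; apply: val_inj; rewrite /= !inordK.
- move=> [[[|[|[|//]]] ?]|[[|[|[|//]]] ?]] [[[|[|[|//]]] ?]|[[|[|[|//]]] ?]] _ _;
  by rewrite /= -!val_eqE /= !inordK.
Qed.

(** * The setting and its parameters *)

Lemma mem_setactP (T : finType) (g : {perm T}) (B : {set T}) x :
  (g x \in 'P^*%act B g) = (x \in B).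
Proof. by rewrite (mem_imset _ _ (act_inj 'P%act g)). Qed.

Lemma mem_setactPV (T : finType) (g : {perm T}) (B : {set T}) x :
  (x \in 'P^*%act B g) = ((g^-1)%g x \in B).
Proof. by rewrite -{1}(permKV g x) mem_setactP. Qed.

Lemma nbrsP (T : finType) (Ga : graph T) (C : {set T}) x :
  reflect (exists2 y, y \in C & adj Ga y x) (x \in nbrs Ga C).
Proof.
by apply: (iffP bigcupP) => -[y Cy h]; exists y; rewrite // ?inE // in h *.
Qed.

Lemma quot_simple (T : finType) (Ga : graph T) (P : {set {set T}}) :
  symmetric (adj Ga) -> simple_graph (quot Ga P).
Proof.
move=> sy; split=> /=.
- move=> B C; apply/idP/idP=> /and4P[h1 h2 h3 /existsP[x /andP[Bx /existsP[y /andP[Cy h]]]]];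
  rewrite h2 h1 eq_sym h3 /=; apply/existsP; exists y; rewrite Cy; apply/existsP;
  by exists x; rewrite Bx sy.
- by move=> B; rewrite eqxx !andbF.
- by move=> B C /and4P[].
Qed.

Lemma quot_adjP (T : finType) (Ga : graph T) (P : {set {set T}}) B C :
  reflect [/\ B \in P, C \in P, B != C & exists x y, [/\ x \in B, y \in C & adj Ga x y]]
          (adj (quot Ga P) B C).
Proof.
apply: (iffP and4P) => -[h1 h2 h3 h4]; split=> //.
  by case/existsP: h4 => x /andP[Bx /existsP[y /andP[Cy h]]]; exists x, y.
case: h4 => x [y [Bx Cy h]]; apply/existsP; exists x; rewrite Bx /=.
by apply/existsP; exists y; rewrite Cy.
Qed.

(** In the setting below these are the three points of B incident with C in [Dbar]. *)
Definition miss (T : finType) (Ga : graph T) (B C : {set T}) :=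
  [set x in B | x \notin nbrs Ga C].

Definition hit (T : finType) (Ga : graph T) (B C : {set T}) :=
  [set x in B | x \in nbrs Ga C].

Section Setting.
Variables (T : finType) (Ga : graph T) (G : {group {perm T}}).
Variables (P : {set {set T}}) (v k b : nat).
Hypothesis st : setting Ga G P v k b.

Local Notation V := (vert Ga).
Local Notation GaP := (quot Ga P).
Local Notation "B ^^ g" := ('P^*%act B g) (at level 30).
Local Notation stab B := ('N_G(B | 'P)%G).
Local Notation N B := (nbr GaP B).

Lemma st_adjC : symmetric (adj Ga). Proof. by case: (st_simple st). Qed.
Lemma st_irr : irreflexive (adj Ga). Proof. by case: (st_simple st). Qed.

Lemma adj_vert x y : adj Ga x y -> x \in V /\ y \in V.
Proof.
case: (st_simple st) => sy _ h a; split; first exact: h a.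
by rewrite sy in a; exact: h a.
Qed.

Lemma adjG g x y : g \in G -> adj Ga (g x) (g y) = adj Ga x y.
Proof.
move/(subsetP (st_aut st)); rewrite inE => /andP[_ /forallP/(_ x)/forallP/(_ y)].
by move/eqP.
Qed.

Lemma vertG g x : g \in G -> (g x \in V) = (x \in V).
Proof. by move/(subsetP (st_aut st)); rewrite inE => /andP[/perm_closed->]. Qed.

Lemma st_simpleP : simple_graph GaP.
Proof. exact: quot_simple st_adjC. Qed.

Lemma blockG g B : g \in G -> (B ^^ g \in P) = (B \in P).
Proof. by move=> Gg; case: (st_partition st) => _ aP; rewrite (acts_act aP). Qed.

Lemma block_uniq x B C : B \in P -> C \in P -> x \in B -> x \in C -> B = C.
Proof.
case: (st_partition st) => /and3P[_ ti _] _ PB PC Bx Cx.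
by rewrite -(def_pblock ti PB Bx) (def_pblock ti PC Cx).
Qed.

Lemma block_vert x B : B \in P -> x \in B -> x \in V.
Proof.
case: (st_partition st) => /and3P[/eqP<- _ _] _ PB Bx.
by apply/bigcupP; exists B.
Qed.

Lemma block_of x : x \in V -> exists2 B, B \in P & x \in B.
Proof.
by case: (st_partition st) => /and3P[/eqP<- _ _] _ /bigcupP[B]; exists B.
Qed.

Lemma block_image g x B C : g \in G -> B \in P -> C \in P -> x \in B -> g x \in C ->
  B ^^ g = C.
Proof.
move=> Gg PB PC Bx Cgx; apply: (@block_uniq (g x)) => //; first by rewrite blockG.
by rewrite mem_setactP.
Qed.

Lemma st_trans : [/\ vertex_trans Ga 'P G, arc_trans Ga 'P G & exists x, exists y, adj Ga x y].
Proof. exact: (arc_transitive1_elim (st_simple st) (st_symmetric st)). Qed.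

Lemma card_block B : B \in P -> #|B| = v. Proof. exact: (st_v st). Qed.

Lemma st_v_ge4 : 4 <= v.
Proof. by have := st_k_ge1 st; rewrite (st_kv st); lia. Qed.

Lemma quot_adjG g B C : g \in G -> adj GaP (B ^^ g) (C ^^ g) = adj GaP B C.
Proof.
have one h B1 C1 : h \in G -> adj GaP B1 C1 -> adj GaP (B1 ^^ h) (C1 ^^ h).
  move=> Gh /quot_adjP[PB PC ne [x [y [Bx Cy a]]]]; apply/quot_adjP.
  rewrite !blockG // (inj_eq (act_inj _ h)); split=> //.
  by exists (h x), (h y); rewrite !mem_setactP adjG.
move=> Gg; apply/idP/idP; last exact: one.
by move/(one g^-1%g); rewrite groupV => /(_ Gg); rewrite !actK.
Qed.

Lemma nbrsG g C x : g \in G -> (g x \in nbrs Ga (C ^^ g)) = (x \in nbrs Ga C).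
Proof.
move=> Gg; apply/nbrsP/nbrsP=> -[y Cy a].
  rewrite mem_setactPV in Cy; exists ((g^-1)%g y) => //.
  by rewrite -(adjG _ _ Gg) permKV.
by exists (g y); rewrite ?mem_setactP ?adjG.
Qed.

Lemma st_P0 : exists B, B \in P.
Proof.
have [_ _ [x [y /adj_vert[Vx _]]]] := st_trans.
by have [B] := block_of Vx; exists B.
Qed.

Lemma card_N B : B \in P -> #|N B| = b. Proof. exact: (st_b st). Qed.

Lemma mem_N B C : (C \in N B) = adj GaP B C. Proof. by rewrite inE. Qed.

Lemma N_block B C : C \in N B -> B \in P /\ C \in P.
Proof. by rewrite mem_N => /quot_adjP[]. Qed.

Lemma N_sym B C : (C \in N B) = (B \in N C).
Proof. by rewrite !mem_N; case: st_simpleP. Qed.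

(** The content is that no edge lies inside a block. Some edge joins two distinct blocks because the
    quotient has valency at least 2, and arc-transitivity moves it onto any given edge. *)
Lemma edge_blocks x y B C : adj Ga x y -> B \in P -> C \in P -> x \in B -> y \in C ->
  C \in N B.
Proof.
move=> a PB PC Bx Cy; have [D PD] := st_P0.
have /card_gt0P[E] : 0 < #|N D| by rewrite card_N // (leq_trans _ (st_b_ge2 st)).
rewrite mem_N => /quot_adjP[_ PE ne [u [w [Du Ew a']]]].
have [_ ta _] := st_trans; have [g Gg [gu gw]] := ta _ _ _ _ a' a.
have eB : D ^^ g = B by apply: (block_image Gg PD PB Du); rewrite -gu in Bx.
have eC : E ^^ g = C by apply: (block_image Gg PE PC Ew); rewrite -gw in Cy.
rewrite mem_N -eB -eC quot_adjG //; apply/quot_adjP; split=> //.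
by exists u, w.
Qed.

Lemma flag_N x B C : B \in P -> C \in P -> x \in B -> x \in nbrs Ga C -> C \in N B.
Proof.
by move=> PB PC Bx /nbrsP[y Cy a]; rewrite st_adjC in a; exact: edge_blocks a PB PC Bx Cy.
Qed.

(** A flag (x, B, C) extends to an arc from some y in C to x, so transitivity on flags follows from
    transitivity on arcs. *)
Lemma flag_trans x B C x' B' C' :
    B \in P -> C \in P -> x \in B -> x \in nbrs Ga C ->
    B' \in P -> C' \in P -> x' \in B' -> x' \in nbrs Ga C' ->
  exists2 g, g \in G & [/\ g x = x', B ^^ g = B' & C ^^ g = C'].
Proof.
move=> PB PC Bx /nbrsP[y Cy a] PB' PC' Bx' /nbrsP[y' Cy' a'].
have [_ ta _] := st_trans; have [g Gg [gy gx]] := ta _ _ _ _ a a'.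
rewrite /= in gy gx; exists g => //; split=> //.
  by apply: (block_image Gg PB PB' Bx); rewrite -gx in Bx'.
by apply: (block_image Gg PC PC' Cy); rewrite -gy in Cy'.
Qed.

Lemma N_flag B C : C \in N B -> exists2 x, x \in B & x \in nbrs Ga C.
Proof.
rewrite mem_N => /quot_adjP[_ _ _ [x [y [Bx Cy a]]]]; exists x => //.
by apply/nbrsP; exists y; rewrite // st_adjC.
Qed.

Lemma quot_arc_trans : arc_trans GaP 'P^* G.
Proof.
move=> B C B' C'; rewrite -!mem_N => h h'.
have [PB PC] := N_block h; have [PB' PC'] := N_block h'.
have [x Bx Cx] := N_flag h; have [x' Bx' Cx'] := N_flag h'.
have [g Gg [_ eB eC]] := flag_trans PB PC Bx Cx PB' PC' Bx' Cx'.
by exists g.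
Qed.

Lemma vert_trans_block x y B C : B \in P -> C \in P -> x \in B -> y \in C ->
  exists2 g, g \in G & g x = y /\ B ^^ g = C.
Proof.
move=> PB PC Bx Cy; have [tv _ _] := st_trans.
have [g Gg gx] := tv _ _ (block_vert PB Bx) (block_vert PC Cy).
by exists g => //; split=> //; apply: (block_image Gg PB PC Bx); rewrite -gx in Cy.
Qed.

Lemma block_nonempty B : B \in P -> exists x, x \in B.
Proof. by move=> PB; apply/card_gt0P; rewrite card_block //; have := st_v_ge4; lia. Qed.

Lemma quot_vertex_trans : vertex_trans GaP 'P^* G.
Proof.
move=> B C /= PB PC; have [x Bx] := block_nonempty PB; have [y Cy] := block_nonempty PC.
by have [g Gg [_ e]] := vert_trans_block PB PC Bx Cy; exists g.
Qed.

Lemma stabP B g : reflect (g \in G /\ B ^^ g = B) (g \in 'N_G(B | 'P)%g).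
Proof.
rewrite -astab1_set inE; apply: (iffP andP) => -[Gg h]; split=> //; first exact/astab1P.
exact/astab1P.
Qed.

Lemma acts_stab_block B : [acts stab B, on B | 'P].
Proof. exact: subsetIr. Qed.

Lemma acts_stab_N B : [acts stab B, on N B | 'P^*].
Proof.
apply/subsetP=> g /stabP[Gg e]; apply/astabsP=> C; rewrite !mem_N.
by rewrite -{1}e quot_adjG.
Qed.

Lemma arc2_trans_stab B : arc2_trans GaP 'P^* G -> trans2_on 'P^* (stab B) (N B).
Proof.
move=> tr C D C' D' hC hD hC' hD' ne ne'; rewrite !mem_N in hC hD hC' hD'.
have [sy _ _] := st_simpleP.
have [||g Gg [eC eB eD]] := tr C B D C' B D'.
- by rewrite sy hC hD.
- by rewrite sy hC' hD'.
by exists g => //; apply/stabP.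
Qed.

(** Vertex-transitivity of the quotient aligns the midpoints of two 2-arcs; the stabiliser of the
    common midpoint then matches their ends. *)
Lemma stab_arc_transitive2 : (forall B, B \in P -> trans2_on 'P^* (stab B) (N B)) ->
  arc_transitive 'P^* G GaP 2.
Proof.
move=> tr; have [B PB] := st_P0.
have : 1 < #|N B| by rewrite card_N // (st_b_ge2 st).
case/card_gt1P=> C [D [hC hD ne]]; rewrite mem_N in hC; rewrite mem_N in hD.
have [sy _ _] := st_simpleP.
apply: (arc_transitive2_intro st_simpleP _ _ (x0 := C) (y0 := B) (z0 := D)).
- by move=> X Y g Gg; rewrite quot_adjG.
- by move=> X g Gg /=; rewrite blockG.
- by rewrite sy hC hD.
- exact: quot_vertex_trans.
move=> X Y Z X' Y' Z' /and3P[a1 a2 n1] /and3P[a1' a2' n1'].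
have [PY PZ] : Y \in P /\ Y' \in P by case/quot_adjP: a2; case/quot_adjP: a2'.
have [g Gg eY] := quot_vertex_trans PY PZ.
have [||||||h /stabP[Gh eh] [hX hZ]] := tr _ PZ (X ^^ g) (Z ^^ g) X' Z'.
- by rewrite mem_N -eY quot_adjG // sy.
- by rewrite mem_N -eY quot_adjG.
- by rewrite mem_N sy.
- by rewrite mem_N.
- by rewrite (inj_eq (act_inj _ g)).
- by [].
by exists (g * h)%g; rewrite ?groupM // !actM hX hZ eY eh.
Qed.

Lemma blocks_atE x B : B \in P -> x \in B ->
  blocks_at Ga P x = [set C in N B | x \in nbrs Ga C].
Proof.
move=> PB Bx; apply/setP=> C; rewrite in_set [RHS]in_set; apply/andP/andP.
  case=> PC /set0Pn[y]; rewrite !inE => /andP[a Cy].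
  have xC : x \in nbrs Ga C by apply/nbrsP; exists y; rewrite // st_adjC.
  by rewrite -mem_N; split=> //; exact: (flag_N PB PC Bx xC).
case=> hC /nbrsP[y Cy a]; have [_ PC] := N_block hC; split=> //.
by apply/set0Pn; exists y; rewrite !inE st_adjC a.
Qed.

Lemma card_hit B C : C \in N B -> #|hit Ga B C| = k.
Proof.
move=> h; rewrite -(st_k st (B := B) (C := C)) -?mem_N //.
Qed.

Lemma card_miss B C : C \in N B -> #|miss Ga B C| = 3.
Proof.
move=> h; have [PB _] := N_block h; rewrite /miss card_compl_in card_block //.
by rewrite card_hit // (st_kv st); have := st_v_ge4; lia.
Qed.

Lemma missG g B C : g \in G -> miss Ga (B ^^ g) (C ^^ g) = (miss Ga B C) ^^ g.
Proof.
move=> Gg; apply/setP=> x; rewrite -(permKV g x); move: ((g^-1)%g x) => y.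
by rewrite mem_setactP !in_set mem_setactP nbrsG.
Qed.

Lemma r_exists : exists r, [/\ r_is Ga P r, 0 < r & r <= b].
Proof.
have [B PB] := st_P0; have [x Bx] := block_nonempty PB.
exists #|blocks_at Ga P x|; split.
- move=> y Vy; have [C PC Cy] := block_of Vy.
  rewrite (blocks_atE PB Bx) (blocks_atE PC Cy).
  have [g Gg [gx eB]] := vert_trans_block PB PC Bx Cy.
  rewrite -[RHS](card_setact 'P^*%act _ g); congr #|pred_of_set _|.
  apply/setP=> D; rewrite -[D in RHS](actKV 'P^*%act g) (mem_imset _ _ (act_inj _ g)) ![in RHS]inE in_set.
  congr (_ && _); first by rewrite mem_N -eB -{1}(actKV 'P^*%act g D) quot_adjG.
  by rewrite -gx -{1}(actKV 'P^*%act g D) nbrsG.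
- rewrite (blocks_atE PB Bx).
  have /card_gt0P[D hD] : 0 < #|N B| by rewrite card_N // (leq_trans _ (st_b_ge2 st)).
  have [y By Dy] := N_flag hD; have [_ PD] := N_block hD.
  have [g Gg [gy eB]] := vert_trans_block PB PB By Bx.
  apply/card_gt0P; exists (D ^^ g); rewrite in_set mem_N -{1}eB quot_adjG // -mem_N hD /=.
  by rewrite -gy nbrsG.
by rewrite (blocks_atE PB Bx) -(card_N PB) subset_leq_card //; apply/subsetP=> C; rewrite in_set => /andP[].
Qed.

Section Counting.
Variable r : nat.
Hypothesis hr : r_is Ga P r.

Lemma card_missed x B : B \in P -> x \in B ->
  #|[set C in N B | x \notin nbrs Ga C]| = b - r.
Proof.
move=> PB Bx; rewrite card_compl_in card_N // -(blocks_atE PB Bx).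
by rewrite hr // (block_vert PB Bx).
Qed.

Lemma count_flags : v * (b - r) = 3 * b.
Proof.
have [B PB] := st_P0.
have := double_count B (N B) (fun x C => x \notin nbrs Ga C).
under eq_bigr => x Bx do rewrite card_missed //.
under [X in _ = X]eq_bigr => C hC do rewrite (card_miss hC).
by rewrite !sum_nat_const card_block // card_N // [b * 3]mulnC.
Qed.

(** Inclusion and exclusion for two triples in B: their union has 6 - mu points and its complement
    is the set counted by lambda. The form avoids truncated subtraction. *)
Lemma lambda_mu B C D : C \in N B -> D \in N B ->
  #|nbrs Ga C :&: nbrs Ga D :&: B| + 6 = v + #|miss Ga B C :&: miss Ga B D|.
Proof.
move=> hC hD; have [PB _] := N_block hC.
have -> : nbrs Ga C :&: nbrs Ga D :&: B = B :\: (miss Ga B C :|: miss Ga B D).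
  apply/setP=> x; rewrite 2!inE [in RHS]inE [in RHS]inE !in_set -/(nbrs _ _).
  by case: (x \in B); rewrite ?andbF ?andbT //= negb_or !negbK.
have sub : miss Ga B C :|: miss Ga B D \subset B.
  by apply/subsetP=> x; rewrite in_setU !in_set => /orP[]/andP[].
have := cardsID (miss Ga B C :|: miss Ga B D) B; rewrite (setIidPr sub) (card_block PB).
have := cardsUI (miss Ga B C) (miss Ga B D); rewrite !card_miss //; lia.
Qed.

(** For a fixed C, count the pairs (x, D) with x on both C and D and D different from C. *)
Lemma count_pairs m B : B \in P ->
  (forall C D, C \in N B -> D \in N B -> C != D -> #|miss Ga B C :&: miss Ga B D| = m) ->
  3 * (b - r).-1 = b.-1 * m.
Proof.
move=> PB hm; have /card_gt0P[C hC] : 0 < #|N B|.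
  by rewrite card_N // (leq_trans _ (st_b_ge2 st)).
have := double_count (miss Ga B C) (N B :\ C) (fun x D => x \notin nbrs Ga D).
have -> : \sum_(x in miss Ga B C) #|[set D in N B :\ C | x \notin nbrs Ga D]| =
          \sum_(x in miss Ga B C) (b - r).-1.
  apply: eq_bigr => x; rewrite in_set => /andP[Bx nx].
  have := cardsD1 C [set D in N B | x \notin nbrs Ga D].
  rewrite (card_missed PB Bx) in_set hC nx add1n => -> /=.
  by congr #|pred_of_set _|; apply/setP=> D; rewrite in_set !in_setD1 [in RHS]in_set andbA.
have -> : \sum_(D in N B :\ C) #|[set x in miss Ga B C | x \notin nbrs Ga D]| =
          \sum_(D in N B :\ C) m.
  apply: eq_bigr => D; rewrite in_setD1 => /andP[ne hD].
  rewrite -(hm C D) // 1?eq_sym //; congr #|pred_of_set _|; apply/setP=> x.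
  rewrite in_setI !in_set; by case: (x \in B).
rewrite !sum_nat_const card_miss // => ->; congr (_ * _).
by rewrite -(card_N PB) (cardsD1 C (N B)) hC.
Qed.

(** The triples through x pairwise share only x, so what remains of them are disjoint pairs in B
    minus x. *)
Lemma pencil_bound B : B \in P ->
  (forall C D, C \in N B -> D \in N B -> C != D -> #|miss Ga B C :&: miss Ga B D| <= 1) ->
  2 * (b - r) < v.
Proof.
move=> PB hm; have [x Bx] := block_nonempty PB.
pose L := [set C in N B | x \notin nbrs Ga C].
have := double_count (B :\ x) L (fun y C => y \notin nbrs Ga C).
have -> : \sum_(C in L) #|[set y in B :\ x | y \notin nbrs Ga C]| = \sum_(C in L) 2.
  apply: eq_bigr => C; rewrite in_set => /andP[hC nx].
  apply: succn_inj; rewrite -(card_miss hC) (cardsD1 x (miss Ga B C)) in_set Bx nx add1n.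
  by congr _.+1; congr #|pred_of_set _|; apply/setP=> y; rewrite !in_set -andbA.
rewrite sum_nat_const card_missed // => e.
rewrite -(card_block PB) (cardsD1 x B) Bx add1n ltnS mulnC -e -sum1_card.
apply: leq_sum => y; rewrite in_setD1 => /andP[yx By].
rewrite leqNgt; apply/negP=> /card_gt1P[C [D []]]; rewrite !in_set.
move=> /andP[/andP[hC xC] yC] /andP[/andP[hD xD] yD] ne.
rewrite -mem_N in hC; rewrite -mem_N in hD.
have := hm C D hC hD ne; rewrite leqNgt => /negP; apply; apply/card_gt1P.
by exists x, y; split; rewrite 1?eq_sym // !in_set ?Bx ?By ?xC ?xD ?yC ?yD.
Qed.

End Counting.

Lemma arc2_params : arc2_trans GaP 'P^* G -> exists r l,
  params Ga P v b r l /\ [\/ [/\ v = 4, b = 4, r = 1 & l = 0],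
     [/\ v = 7, b = 7, r = 4 & l = 2], [/\ v = 6, b = 4, r = 2 & l = 1]
   | [/\ v = 3 * b, r = b - 1 & l = 3 * b - 6]].
Proof.
move=> tr; have [r [hr r0 rb]] := r_exists; have [B PB] := st_P0.
have : 1 < #|N B| by rewrite card_N // (st_b_ge2 st).
case/card_gt1P=> C [D [hC hD ne]]; pose m := #|miss Ga B C :&: miss Ga B D|.
have [sy _ _] := st_simpleP.
have hm B' C' D' : C' \in N B' -> D' \in N B' -> C' != D' ->
    #|miss Ga B' C' :&: miss Ga B' D'| = m.
  move=> hC' hD' ne'; rewrite !mem_N in hC hD hC' hD'.
  have [||g Gg [<- <- <-]] := tr C B D C' B' D'.
  - by rewrite sy hC hD.
  - by rewrite sy hC' hD'.
  rewrite !missG // -imsetI ?card_imset //; first exact: act_inj.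
  by move=> x y _ _; exact: act_inj.
exists r, (v + m - 6); split.
  split; [exact: (st_v st) | exact: (st_b st) | by [] |].
  move=> B' C' D' PB' hC' hD' ne'; rewrite -(hm B' C' D') //.
  by rewrite -(lambda_mu hC' hD') addnK.
have e1 := count_flags hr.
have e2 := count_pairs hr PB (fun C' D' hC' hD' ne' => hm B C' D' hC' hD' ne').
have e3 : m <= 1 -> 2 * (b - r) < v.
  by move=> m1; apply: (pencil_bound hr PB) => C' D' *; rewrite hm.
have m3 : m <= 3 by rewrite -(card_miss hC) subset_leq_card // subsetIl.
have b2 := st_b_ge2 st; have v4 := st_v_ge4.
move: e1 e2 e3; move: (b - r) (subnK rb) => s sb.
have s0 : 0 < s -> s.-1.+1 = s by case: s {sb}.
case: m m3 {hm} => [|[|[|[|//]]]] _ e1 e2 e3.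
(* mu = 0: 3(s - 1) = 0, and s = 0 would give b = 0; hence s = 1 and v = 3b. *)
- have s1 : s = 1 by case: s e1 e2 {sb s0 e3} => [|[|s]]; lia.
  by constructor 4; split; subst s; lia.
(* mu = 1: b = 3s - 2, so v s = 9s - 6 and s divides 6. The bound 2s < v removes s = 6, and b >= 2
   removes s = 1. *)
- have bs : b + 2 = 3 * s by case: s e1 e2 {sb s0 e3} => [|s] /=; lia.
  have s3 : s <= 3 by have := e3 isT; nia.
  have : (s == 2) || (s == 3) by case: s bs s3 {sb e1 e2 e3 s0} => [|[|[|[|]]]]; lia.
  by case/orP=> /eqP es; [constructor 3|constructor 2]; subst s; split; lia.
(* mu = 2: 2 v s = 6b = 9s - 3 gives v <= 4, while v >= 4 because k >= 1. Then s = 3 and b = 4. *)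
- have bs : 2 * b + 1 = 3 * s by case: s e1 e2 {sb s0 e3} => [|s] /=; lia.
  have v5 : v <= 4 by nia.
  by constructor 1; split; nia.
(* mu = 3: s = b, that is r = 0, although every vertex has a neighbour. *)
- by exfalso; case: s e1 e2 sb {s0 e3} => [|s] /=; lia.
Qed.

End Setting.

(** * The Fano plane *)

(** Only lines are asked to meet. That two points have a common line follows by counting in
    [fano_join], and this makes the record self-dual. *)
Record fano (T S : finType) (X : {set T}) (L : {set S}) (inc : T -> S -> bool) : Prop := {
  fano_points : #|X| = 7;
  fano_lines : #|L| = 7;
  fano_pencil : {in X, forall x, #|[set l in L | inc x l]| = 3};
  fano_row : {in L, forall l, #|[set x in X | inc x l]| = 3};
  fano_meet : {in L &, forall l m, l != m ->
                 #|[set x in X | inc x l && inc x m]| = 1} }.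

Section FanoPlane.
Variables (T S : finType) (X : {set T}) (L : {set S}) (inc : T -> S -> bool).
Hypothesis F : fano X L inc.

Lemma fano_meet_uniq x y l m : x \in X -> y \in X -> l \in L -> m \in L ->
  inc x l -> inc y l -> inc x m -> inc y m -> x != y -> l = m.
Proof.
move=> Xx Xy Ll Lm xl yl xm ym ne; apply/eqP; apply: contraT => lm.
have [z e] := cards1P_ex (fano_meet F Ll Lm lm).
have : x \in [set z] by rewrite -e inE Xx xl.
have : y \in [set z] by rewrite -e inE Xy yl.
by rewrite !inE => /eqP yz /eqP xz; rewrite xz yz eqxx in ne.
Qed.

Lemma fano_meet_ex l m : l \in L -> m \in L -> l != m ->
  exists x, [/\ x \in X, inc x l & inc x m].
Proof.
move=> Ll Lm lm; have [z e] := cards1P_ex (fano_meet F Ll Lm lm).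
have : z \in [set z] by rewrite inE.
by rewrite -e inE => /andP[Xz /andP[zl zm]]; exists z.
Qed.

Lemma fano_join_le x y : x \in X -> y \in X -> x != y ->
  #|[set l in L | inc x l && inc y l]| <= 1.
Proof.
move=> Xx Xy ne; rewrite leqNgt; apply/negP=> /card_gt1P[l [m []]].
rewrite !inE => /and3P[Ll xl yl] /and3P[Lm xm ym] /eqP; apply.
exact: fano_meet_uniq xl yl xm ym ne.
Qed.

(** The three lines through x carry two further points each, six incidences in all, and each of the
    six points other than x takes at most one; so each takes exactly one. *)
Lemma fano_join x y : x \in X -> y \in X -> x != y ->
  #|[set l in L | inc x l && inc y l]| = 1.
Proof.
move=> Xx Xy ne; apply/eqP; rewrite eqn_leq fano_join_le //=.
pose Lx := [set l in L | inc x l].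
have := double_count (X :\ x) Lx inc.
have -> : \sum_(l in Lx) #|[set z in X :\ x | inc z l]| = \sum_(l in Lx) 2.
  apply: eq_bigr => l; rewrite inE => /andP[Ll xl]; apply: succn_inj.
  rewrite -(fano_row F Ll) (cardsD1 x [set z in X | _]) inE Xx xl add1n.
  by congr _.+1; congr #|pred_of_set _|; apply/setP=> z; rewrite !inE andbA.
rewrite sum_nat_const (fano_pencil F Xx) (bigD1 y) /=; last by rewrite !inE eq_sym ne.
have -> : [set l in Lx | inc y l] = [set l in L | inc x l && inc y l].
  by apply/setP=> l; rewrite !inE andbA.
have le : \sum_(z in X :\ x | z != y) #|[set l in Lx | inc z l]|
          <= \sum_(z in X :\ x | z != y) 1.
  apply: leq_sum => z; rewrite !inE => /andP[/andP[zx Xz] _].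
  apply: leq_trans (fano_join_le Xx Xz _); last by rewrite eq_sym.
  by apply/subset_leq_card/subsetP=> l; rewrite !inE andbA.
(* At most five of the six incidences come from points other than y, so y takes one. *)
have : \sum_(z in X :\ x | z != y) 1 = 5.
  rewrite sum1dep_card; have := cardsD1 y (X :\ x); have := cardsD1 x X.
  rewrite (fano_points F) Xx !inE eq_sym ne Xy !add1n => -[<-] [e].
  by apply: etrans (esym e); congr #|pred_of_set _|; apply/setP=> z; rewrite !inE andbC.
lia.
Qed.

Lemma fano_dual : fano L X (fun l x => inc x l).
Proof.
split; rewrite ?(fano_points F) ?(fano_lines F) //; first exact: (fano_row F).
  exact: (fano_pencil F).
by move=> x y Xx Xy ne; exact: fano_join.
Qed.

Lemma fano_join_ex x y : x \in X -> y \in X -> x != y ->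
  exists l, [/\ l \in L, inc x l & inc y l].
Proof.
move=> Xx Xy ne; have [l e] := cards1P_ex (fano_join Xx Xy ne).
have : l \in [set l] by rewrite inE.
by rewrite -e inE => /andP[Ll /andP[xl yl]]; exists l.
Qed.

Lemma fano_third x y l : x \in X -> y \in X -> l \in L -> x != y -> inc x l -> inc y l ->
  exists z, [/\ z \in X, x != z, y != z & [set w in X | inc w l] = [set x; y; z]].
Proof.
move=> Xx Xy Ll ne xl yl; have c3 := fano_row F Ll; set A := [set w in X | inc w l] in c3 *.
have Ax : x \in A by rewrite inE Xx.
have Ay : y \in A by rewrite inE Xy.
have := c3; rewrite (cardsD1 x) Ax (cardsD1 y) !inE eq_sym ne Xy yl !add1n => -[].
case/cards1P_ex=> z e; exists z.
have : z \in A :\ x :\ y by rewrite e inE.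
rewrite !inE => /and4P[zy zx Xz zl]; split=> //; rewrite 1?eq_sym //.
by rewrite -(setD1K Ax) -(setD1K (a := y) (A := A :\ x)) ?e ?setUA // !inE eq_sym ne Xy.
Qed.

Definition noncollinear x y z :=
  x != y /\ forall l, l \in L -> inc x l -> inc y l -> ~~ inc z l.

End FanoPlane.

(** * The space F_2^3 as Boolean triples, with its finite facts decided by evaluation *)

Definition V3 : finType := (bool * bool * bool)%type.

Definition add3 (u w : V3) : V3 :=
  (u.1.1 (+) w.1.1, u.1.2 (+) w.1.2, u.2 (+) w.2).

Definition zero3 : V3 := (false, false, false).

Definition all_V3 : seq V3 :=
  [:: (false, false, false); (false, false, true); (false, true, false);
      (false, true, true); (true, false, false); (true, false, true);
      (true, true, false); (true, true, true)].

Lemma V3_allP (p : V3 -> bool) : all p all_V3 -> forall u, p u.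
Proof. by move/and5P=> [h1 h2 h3 h4 /and5P[h5 h6 h7 h8 _]] [[[] []] []]. Qed.

Lemma V3_hasP (p : V3 -> bool) : has p all_V3 -> exists u, p u.
Proof. by case/hasP=> u _; exists u. Qed.

(** Equality written with exclusive or on bits, so that the checks passed to [vm_compute] use
    Boolean operations only. *)
Definition eq3 (u w : V3) : bool :=
  ~~ [|| u.1.1 (+) w.1.1, u.1.2 (+) w.1.2 | u.2 (+) w.2].

Lemma eq3E (u w : V3) : (u == w) = eq3 u w.
Proof. by case: u w => [[[] []] []] [[[] []] []]. Qed.

Lemma add3C : commutative add3.
Proof. by case=> [[[] []] []] [[[] []] []]. Qed.
Lemma add3A : associative add3.
Proof. by case=> [[[] []] []] [[[] []] []] [[[] []] []]. Qed.
Lemma add30 : right_id zero3 add3.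
Proof. by case=> [[[] []] []]. Qed.
Lemma add03 : left_id zero3 add3.
Proof. by case=> [[[] []] []]. Qed.
Lemma add33 u : add3 u u = zero3.
Proof. by case: u => [[[] []] []]. Qed.
Lemma add3K u w : add3 u (add3 u w) = w.
Proof. by rewrite add3A add33 add03. Qed.
Lemma add3_eq0 u w : (add3 u w == zero3) = (u == w).
Proof. by case: u w => [[[] []] []] [[[] []] []]. Qed.

Definition e1 : V3 := (true, false, false).
Definition e2 : V3 := (false, true, false).
Definition e3 : V3 := (false, false, true).

(** The linear map that sends the basis [e1], [e2], [e3] to a, b, c. *)
Definition lin3 (a b c w : V3) : V3 :=
  add3 (if w.1.1 then a else zero3)
       (add3 (if w.1.2 then b else zero3) (if w.2 then c else zero3)).

(** Linear independence over F_2: each of the seven non-trivial relations among a, b, c is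
    excluded. *)
Definition frame3 (a b c : V3) : bool :=
  ~~ [|| eq3 a zero3, eq3 b zero3, eq3 a b, eq3 c zero3, eq3 c a, eq3 c b | eq3 c (add3 a b)].

Lemma additive_lin3 (t : V3 -> V3) : {morph t : u w / add3 u w} ->
  forall w, t w = lin3 (t e1) (t e2) (t e3) w.
Proof.
move=> tM; have t0 : t zero3 = zero3.
  by apply/eqP; rewrite -(add33 zero3) tM add33.
have h (s : bool) u : t (if s then u else zero3) = if s then t u else zero3 by case: s.
move=> w; have {1}-> : w = lin3 e1 e2 e3 w by case: w => [[[] []] []].
by rewrite /lin3 !tM !h.
Qed.

Lemma lin3_additive a b c : {morph lin3 a b c : u w / add3 u w}.
Proof.
move=> [[u1 u2] u3] [[w1 w2] w3]; rewrite /lin3 /=.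
have h (s t : bool) x : (if s (+) t then x else zero3) =
    add3 (if s then x else zero3) (if t then x else zero3).
  by case: s; case: t; rewrite /= ?add33 ?add30 ?add03.
rewrite !h !add3A; congr (add3 _ _); rewrite -!add3A; congr (add3 _ _).
by rewrite add3C -!add3A; congr (add3 _ _); rewrite add3C -add3A; congr (add3 _ _); rewrite add3C.
Qed.

Lemma frame3_lin_inj a b c : frame3 a b c -> injective (lin3 a b c).
Proof.
move=> fr u w /eqP; rewrite -add3_eq0 -lin3_additive => h; apply/eqP.
rewrite -add3_eq0; move: (add3 u w) h => {u w} w; rewrite !eq3E; move: fr.
move=> fr h; move: (conj fr h) => /andP; apply/implyP.
apply: (V3_allP (p := fun w => frame3 a b c && eq3 (lin3 a b c w) zero3 ==> eq3 w zero3)).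
move: a {fr h}; apply: V3_allP; move: b; apply: V3_allP.
by move: c; apply: V3_allP; vm_compute.
Qed.

(** The plane spanned by a and b has index 2, so two vectors outside it differ by a vector inside
    it. *)
Lemma frame3_compl a b c w : frame3 a b c -> frame3 a b w ->
  [|| add3 c w == zero3, add3 c w == a, add3 c w == b | add3 c w == add3 a b].
Proof.
rewrite !eq3E => f1 f2; move: (conj f1 f2) => /andP; apply/implyP.
move: a {f1 f2}; apply: V3_allP; move: b; apply: V3_allP; move: c; apply: V3_allP.
by move: w; apply: V3_allP; vm_compute.
Qed.

Lemma frame3_swap a b c : frame3 a b c -> frame3 b a c.
Proof.
apply/implyP; move: a; apply: V3_allP; move: b; apply: V3_allP.
by move: c; apply: V3_allP; vm_compute.
Qed.

Lemma frame3_sum a b c : frame3 a b c -> frame3 (add3 a b) a c.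
Proof.
apply/implyP; move: a; apply: V3_allP; move: b; apply: V3_allP.
by move: c; apply: V3_allP; vm_compute.
Qed.

Lemma frame3_ex a b : a != zero3 -> b != zero3 -> a != b -> exists c, frame3 a b c.
Proof.
rewrite !eq3E => h1 h2 h3; apply: V3_hasP.
move: h1; apply/implyP; move: h2; apply/implyP; move: h3; apply/implyP.
by move: a; apply: V3_allP; move: b; apply: V3_allP; vm_compute.
Qed.

(* A linear map exchanging two vectors, or else its square, is a transvection. *)
Lemma swap_transvection a b c u w :
  frame3 a b c -> ~~ eq3 u zero3 -> ~~ eq3 w zero3 -> ~~ eq3 u w ->
  eq3 (lin3 a b c u) w -> eq3 (lin3 a b c w) u ->
  exists p q x, frame3 p q x /\
   let t := lin3 a b c in
   ([&& eq3 (t p) p, eq3 (t q) q & eq3 (t x) (add3 x p)] ||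
    [&& eq3 (t (t p)) p, eq3 (t (t q)) q & eq3 (t (t x)) (add3 x p)]).
Proof.
move=> h1 h2 h3 h4 h5 h6.
pose t := lin3 a b c.
(* Nested conditionals stop at the first test that fails, whereas [vm_compute] would evaluate both
   arguments of [&&] and run the inner searches every time. *)
pose found := has (fun p => if eq3 p zero3 then false else
   if eq3 (t (t p)) p then has (fun q => if eq3 q p then false else
   if eq3 (t (t q)) q then has (fun x =>
     if if eq3 (t x) (add3 x p) then if eq3 (t p) p then eq3 (t q) q else false else false
     then frame3 p q x else
     if eq3 (t (t x)) (add3 x p) then frame3 p q x else false)
    all_V3 else false) all_V3 else false) all_V3.
have : if eq3 u w then true else if eq3 u zero3 then true else
       if eq3 w zero3 then true else if eq3 (lin3 a b c u) w then
       if eq3 (lin3 a b c w) u then if frame3 a b c then found else true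
       else true else true.
  rewrite {}/found {}/t; clear.
  move: a; apply: V3_allP; move: b; apply: V3_allP; move: c; apply: V3_allP.
  by move: u; apply: V3_allP; move: w; apply: V3_allP; vm_compute.
rewrite (negPf h4) (negPf h2) (negPf h3) h5 h6 h1 => /V3_hasP[p].
case: ifP => // _; case: ifP => // tp /V3_hasP[q]; case: ifP => // _; case: ifP => // tq.
case/V3_hasP=> x.
case tx: (eq3 (t x) (add3 x p)); case tp': (eq3 (t p) p);
case tq': (eq3 (t q) q); case tx': (eq3 (t (t x)) (add3 x p)) => // fr;
by exists p, q, x; split=> //=; rewrite -/t ?tx ?tp' ?tq' ?tp ?tq ?tx'.
Qed.

Section Coordinates.
Variables (T S : finType) (X : {set T}) (L : {set S}) (inc : T -> S -> bool).
Hypothesis F : fano X L inc.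

Record fano_coord (vec : T -> V3) (pt : V3 -> T) : Prop := {
  vec_neq0 : {in X, forall x, vec x != zero3};
  pt_in : forall w, w != zero3 -> pt w \in X;
  ptK : forall w, w != zero3 -> vec (pt w) = w;
  vecK : {in X, forall x, pt (vec x) = x};
  vec_line : forall l x y z, l \in L -> [set w in X | inc w l] = [set x; y; z] ->
    x != y -> x != z -> y != z -> vec z = add3 (vec x) (vec y) }.

(* Three non-concurrent lines are the coordinate hyperplanes: a line distinct
   from l has exactly one of its three points on l. *)
Lemma fano_coordinates : exists vec pt, fano_coord vec pt.
Proof.
have [l1 [l2 [L1 L2 l12]]] : exists l m, [/\ l \in L, m \in L & l != m].
  have : 1 < #|L| by rewrite (fano_lines F).
  by case/card_gt1P=> l [m [? ? ?]]; exists l, m.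
have [p [Xp p1 p2]] := fano_meet_ex F L1 L2 l12.
have [l3 L3 p3] : exists2 l, l \in L & ~~ inc p l.
  have : [set l in L | ~~ inc p l] != set0.
    by rewrite -card_gt0 card_compl_in (fano_pencil F Xp) (fano_lines F).
  by case/set0Pn=> l; rewrite inE => /andP[]; exists l.
pose vec x : V3 := (~~ inc x l1, ~~ inc x l2, ~~ inc x l3).
have line1 l m x y z : l \in L -> m \in L -> [set w in X | inc w l] = [set x; y; z] ->
    x != y -> x != z -> y != z -> ~~ inc z m = ~~ inc x m (+) ~~ inc y m.
  move=> Ll Lm e xy xz yz.
  have inl w : w \in [set x; y; z] -> (w \in X) * inc w l.
    by rewrite -e inE => /andP[-> ->].
  have [sx sy sz] : [/\ x \in [set x; y; z], y \in [set x; y; z] & z \in [set x; y; z]].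
    by rewrite !inE !eqxx !orbT.
  have [Xx xl] := inl x sx; have [Xy yl] := inl y sy; have [Xz zl] := inl z sz.
  have [<-|lm] := eqVneq l m; first by rewrite xl yl zl.
  have [w ew] := cards1P_ex (fano_meet F Ll Lm lm).
  have h u : u \in [set x; y; z] -> inc u m = (u == w).
    move=> hu; have [Xu ul] := inl _ hu; have := in_set1 u w.
    by rewrite -ew inE Xu ul.
  have : w \in [set x; y; z].
    have : w \in [set w] by rewrite inE.
    by rewrite -ew inE => /and3P[Xw wl _]; rewrite -e inE Xw.
  rewrite !h // !inE; case/orP=> [/orP[]|] /eqP ->.
  - by rewrite eqxx [y == x]eq_sym (negPf xy) [z == x]eq_sym (negPf xz).
  - by rewrite eqxx (negPf xy) [z == y]eq_sym (negPf yz).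
  - by rewrite eqxx (negPf xz) (negPf yz).
have vl l x y z : l \in L -> [set w in X | inc w l] = [set x; y; z] ->
    x != y -> x != z -> y != z -> vec z = add3 (vec x) (vec y).
  move=> Ll e xy xz yz; rewrite /vec /add3 /=.
  by rewrite -(line1 l l1 x y z) // -(line1 l l2 x y z) // -(line1 l l3 x y z).
have v0 : {in X, forall x, vec x != zero3}.
  move=> x Xx; apply/eqP=> -[] /negbFE x1 /negbFE x2 /negbFE x3.
  have [e|ne] := eqVneq x p; first by rewrite -e x3 in p3.
  by have := fano_meet_uniq F Xx Xp L1 L2 x1 p1 x2 p2 ne => e; rewrite e eqxx in l12.
(* If x and y had the same vector, the third point of their line would have the zero vector. *)
have vi : {in X &, injective vec}.
  move=> x y Xx Xy e; apply/eqP; apply: contraT => ne.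
  have [l [Ll xl yl]] := fano_join_ex F Xx Xy ne.
  have [z [Xz xz yz ez]] := fano_third F Xx Xy Ll ne xl yl.
  by have := v0 _ Xz; rewrite (vl l x y z) // e add33 eqxx.
pose pt w := odflt p [pick x in X | vec x == w].
(* Seven distinct non-zero vectors are all of them. *)
have im : vec @: X = [set~ zero3].
  apply/eqP; rewrite eqEcard cardsC1 (card_in_imset vi) (fano_points F).
  rewrite !card_prod card_bool andbT; apply/subsetP=> _ /imsetP[x Xx ->].
  by rewrite !inE v0.
have ptP w : w != zero3 -> pt w \in X /\ vec (pt w) = w.
  move=> w0; rewrite /pt; case: pickP => [x /andP[Xx /eqP] //|h].
  have : w \in vec @: X by rewrite im !inE.
  by case/imsetP=> x Xx e; have := h x; rewrite Xx e eqxx.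
exists vec, pt; split=> //.
- by move=> w /ptP[].
- by move=> w /ptP[].
- by move=> x Xx; have [X' e] := ptP _ (v0 _ Xx); apply: vi.
Qed.

Variables (vec : T -> V3) (pt : V3 -> T).
Hypothesis C : fano_coord vec pt.

Lemma vec_inj : {in X &, injective vec}.
Proof. by move=> x y Xx Xy e; rewrite -(vecK C Xx) e (vecK C Xy). Qed.

Lemma vec_collinear x y z l : l \in L -> x \in X -> y \in X -> z \in X ->
  inc x l -> inc y l -> x != y -> inc z l =
  [|| vec z == vec x, vec z == vec y | vec z == add3 (vec x) (vec y)].
Proof.
move=> Ll Xx Xy Xz xl yl ne; have [w [Xw xw yw e]] := fano_third F Xx Xy Ll ne xl yl.
rewrite -(vec_line C Ll e) // !(inj_in_eq vec_inj) //.
by have := in_set (fun w => (w \in X) && inc w l) z; rewrite -/([set w in X | inc w l]) e Xz /= => <-; rewrite !inE orbA.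
Qed.

Lemma noncollinear_vec x y z : x \in X -> y \in X -> z \in X ->
  noncollinear L inc x y z <-> frame3 (vec x) (vec y) (vec z).
Proof.
move=> Xx Xy Xz; rewrite /frame3 -!eq3E !(negPf (vec_neq0 C _)) //= (inj_in_eq vec_inj) //.
split=> [[ne h]|].
  rewrite (negPf ne) /=; have [l [Ll xl yl]] := fano_join_ex F Xx Xy ne.
  by have := h l Ll xl yl; rewrite (vec_collinear Ll Xx Xy Xz xl yl ne).
case/norP=> ne h; split=> // l Ll xl yl.
by rewrite (vec_collinear Ll Xx Xy Xz xl yl ne).
Qed.

Variables (aT : finGroupType) (to : {action aT &-> T}) (to' : {action aT &-> S}).
Variable H : {group aT}.
Hypothesis aX : [acts H, on X | to].
Hypothesis aL : [acts H, on L | to'].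
Hypothesis incH : forall h x l, h \in H -> x \in X -> l \in L ->
  inc (to x h) (to' l h) = inc x l.

(** The action on points transported to vectors; the zero vector stands for no point and is fixed by
    convention. *)
Definition vact (h : aT) (w : V3) : V3 :=
  if w == zero3 then zero3 else vec (to (pt w) h).

Lemma vactE h x : x \in X -> vact h (vec x) = vec (to x h).
Proof. by move=> Xx; rewrite /vact (negPf (vec_neq0 C Xx)) (vecK C Xx). Qed.

Lemma to_in h x : h \in H -> x \in X -> to x h \in X.
Proof. by move=> Hh Xx; rewrite (acts_act aX). Qed.

Lemma vact_eq0 h w : h \in H -> (vact h w == zero3) = (w == zero3).
Proof.
move=> Hh; rewrite /vact; case: (eqVneq w zero3) => [//|w0].
by apply/negbTE/(vec_neq0 C)/to_in => //; exact: (pt_in C).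
Qed.

(** For distinct non-zero u and w the points of u, w and u + w form a line, and h maps lines to
    lines. *)
Lemma vact_additive h : h \in H -> {morph vact h : u w / add3 u w}.
Proof.
move=> Hh u w; have v0 : vact h zero3 = zero3 by rewrite /vact eqxx.
have [->|u0] := eqVneq u zero3; first by rewrite add03 v0 add03.
have [->|w0] := eqVneq w zero3; first by rewrite add30 v0 add30.
have [->|uw] := eqVneq u w; first by rewrite !add33.
have s0 : add3 u w != zero3 by rewrite add3_eq0.
have [Xu Xw] := (pt_in C u0, pt_in C w0).
have ne : pt u != pt w.
  by apply: contra uw => /eqP e; rewrite -(ptK C u0) -(ptK C w0) e.
have [l [Ll xl yl]] := fano_join_ex F Xu Xw ne.
have [z [Xz uz wz e]] := fano_third F Xu Xw Ll ne xl yl.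
have ez : vec z = add3 u w by rewrite (vec_line C Ll e) // !(ptK C).
have nt a c : a != c -> to a h != to c h by rewrite (inj_eq (act_inj to h)).
have e' : [set x in X | inc x (to' l h)] = [set to (pt u) h; to (pt w) h; to z h].
  apply/setP=> x; rewrite -[x](actKV to h); move: (to x h^-1%g) => y.
  have : (y \in X) && inc y l = (y \in [set pt u; pt w; z]) by rewrite -e inE.
  rewrite !inE !(inj_eq (act_inj to h)) (acts_act aX) // => <-.
  by case: (boolP (y \in X)) => //= Xy; rewrite incH.
rewrite -ez vactE // (vec_line C _ e') ?nt ?(acts_act aL) //.
by rewrite -!vactE // !(ptK C).
Qed.

Lemma vactM h1 h2 w : h1 \in H -> h2 \in H -> vact (h1 * h2)%g w = vact h2 (vact h1 w).
Proof.
move=> H1 H2; have [->|w0] := eqVneq w zero3; first by rewrite /vact eqxx.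
have Xw := pt_in C w0.
by rewrite -(ptK C w0) !vactE ?to_in // actM.
Qed.

Lemma vact1 w : vact 1%g w = w.
Proof.
rewrite /vact; case: (eqVneq w zero3) => [//|w0].
by rewrite act1 (ptK C).
Qed.

Lemma vactK h w : h \in H -> vact h (vact h^-1%g w) = w.
Proof. by move=> Hh; rewrite -vactM ?groupV // mulVg vact1. Qed.

Lemma vact_inj h : h \in H -> injective (vact h).
Proof.
by move=> Hh u w /(congr1 (vact h^-1%g)); rewrite -!vactM ?groupV // mulgV !vact1.
Qed.

Lemma vact_frame h a b c : h \in H -> frame3 a b c ->
  frame3 (vact h a) (vact h b) (vact h c).
Proof.
move=> Hh; rewrite /frame3 -!eq3E !vact_eq0 // -vact_additive //.
by rewrite !(inj_eq (vact_inj Hh)).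
Qed.

Hypothesis tr2 : trans2_on to H X.

Lemma vact_trans2 u w u' w' : u != zero3 -> w != zero3 -> u' != zero3 -> w' != zero3 ->
  u != w -> u' != w' -> exists2 h, h \in H & vact h u = u' /\ vact h w = w'.
Proof.
move=> u0 w0 u0' w0' uw uw'.
have d a c : a != zero3 -> c != zero3 -> a != c -> pt a != pt c.
  by move=> a0 c0; apply: contra => /eqP e; rewrite -(ptK C a0) -(ptK C c0) e.
have [|h Hh [hu hw]] := tr2 (pt_in C u0) (pt_in C w0) (pt_in C u0') (pt_in C w0') (d _ _ u0 w0 uw).
  exact: d.
exists h => //; rewrite -(ptK C u0) -(ptK C w0) !vactE ?(pt_in C) //.
by rewrite hu hw !(ptK C).
Qed.

Lemma frame3_neq a b c : frame3 a b c -> [/\ a != zero3, b != zero3 & a != b].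
Proof. by rewrite /frame3 -!eq3E => /norP[-> /norP[-> /norP[->]]]. Qed.

(** The map sought is the transvection with centre p that fixes the plane of p and q. One
    transvection suffices, since conjugation by an element that takes its pair (a, b) to (p, q)
    gives this one; it comes from an element exchanging [e1] and [e2]. *)
Lemma vact_transvection p q : p != zero3 -> q != zero3 -> p != q ->
  exists2 t, t \in H & [/\ vact t p = p, vact t q = q &
    forall x, frame3 p q x -> vact t x = add3 x p].
Proof.
suff [t Ht [a [b [x [fr ta tb tx]]]]] : exists2 t, t \in H & exists a b x,
    [/\ frame3 a b x, vact t a = a, vact t b = b & vact t x = add3 x a].
  move=> p0 q0 pq; have [a0 b0 ab] := frame3_neq fr.
  have [h Hh [ha hb]] := vact_trans2 a0 b0 p0 q0 ab pq.
  have hp : vact h^-1%g p = a by apply: (vact_inj Hh); rewrite vactK.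
  have hq : vact h^-1%g q = b by apply: (vact_inj Hh); rewrite vactK.
  exists (h^-1 * t * h)%g; first by rewrite !groupM ?groupV.
  rewrite !vactM ?groupM ?groupV // hp hq ta tb ha hb; split=> // y fy.
  have := vact_frame (h := h^-1%g) (eq_ind_r _ Hh (groupV H h)) fy; rewrite hp hq => fy'.
  rewrite !vactM ?groupM ?groupV //.
  have -> : vact t (vact h^-1%g y) = add3 (vact h^-1%g y) a.
    move: (vact h^-1%g y) fy' => z fz; rewrite -[z](add3K x) vact_additive // tx.
    (* Both x and z lie outside the plane of a and b, so their sum lies in it, and t fixes that
       plane pointwise. *)
    have -> : vact t (add3 x z) = add3 x z.
      have := frame3_compl fr fz.
      by case/or4P=> /eqP ->; rewrite ?vact_additive // ?ta ?tb // /vact eqxx.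
    by rewrite -!add3A [add3 a _]add3C !add3A.
  by rewrite vact_additive // vactK // ha.
have [h Hh [h1 h2]] := @vact_trans2 e1 e2 e2 e1 isT isT isT isT isT isT.
pose t := lin3 (vact h e1) (vact h e2) (vact h e3).
have tE w : vact h w = t w by exact: (additive_lin3 (vact_additive Hh)).
have fr : frame3 (vact h e1) (vact h e2) (vact h e3) by exact: vact_frame.
have [|||||a [b [x [fab]]]] := @swap_transvection _ _ _ e1 e2 fr.
- by [].
- by [].
- by [].
- by rewrite -/(t e1) -tE h1.
- by rewrite -/(t e2) -tE h2.
cbv zeta; rewrite -/t -!tE -!eq3E => /orP[] /and3P[/eqP ta /eqP tb /eqP tx].
  by exists h => //; exists a, b, x.
exists (h * h)%g; first exact: groupM.
by exists a, b, x; rewrite !vactM.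
Qed.

(** 2-transitivity handles the first two vectors. The image of c then differs from c' by a vector of
    the plane of a' and b'; if it is not zero, the transvection with that vector as centre removes
    it. *)
Lemma vact_frame_trans a b c a' b' c' : frame3 a b c -> frame3 a' b' c' ->
  exists2 h, h \in H & [/\ vact h a = a', vact h b = b' & vact h c = c'].
Proof.
move=> fr fr'; have [a0 b0 ab] := frame3_neq fr; have [a0' b0' ab'] := frame3_neq fr'.
have [h Hh [ha hb]] := vact_trans2 a0 b0 a0' b0' ab ab'.
have := vact_frame Hh fr; rewrite ha hb => fr''.
(* Here p is the difference to be removed and q completes it to a basis of the plane of a' and b',
   so that both a' and b' stay fixed. *)
have tra p q : p != zero3 -> q != zero3 -> p != q ->
    [|| a' == p, a' == q | a' == add3 p q] -> [|| b' == p, b' == q | b' == add3 p q] ->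
    frame3 p q (vact h c) -> vact h c = add3 c' p ->
    exists2 h0, h0 \in H & [/\ vact h0 a = a', vact h0 b = b' & vact h0 c = c'].
  move=> p0 q0 pq pa pb fp e; have [t Ht [tp tq tx]] := vact_transvection p0 q0 pq.
  exists (h * t)%g; first exact: groupM.
  rewrite !vactM // ha hb (tx _ fp) e -add3A add33 add30; split=> //.
    by case/or3P: pa => /eqP->; rewrite ?vact_additive // ?tp ?tq.
  by case/or3P: pb => /eqP->; rewrite ?vact_additive // ?tp ?tq.
have hc p : add3 c' (vact h c) = p -> vact h c = add3 c' p.
  by move<-; rewrite add3K.
move: (frame3_compl fr' fr''); case/or4P=> /eqP /hc e.
- by exists h => //; rewrite ha hb e add30.
- apply: (tra a' b') => //; rewrite ?eqxx ?orbT //.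
- apply: (tra b' a') => //; rewrite ?eqxx ?orbT // 1?eq_sym //.
  exact: frame3_swap.
- apply: (tra (add3 a' b') a') => //; rewrite ?add3_eq0 //.
  + by apply: contra b0' => /eqP h1; rewrite -(add3K a' b') h1 add33.
  + by rewrite eqxx orbT.
  + by rewrite [add3 a' b']add3C -add3A add33 add30 eqxx !orbT.
  exact: frame3_sum.
Qed.

End Coordinates.

(** * Collineation groups that are 2-transitive on points *)

Section FanoAction.
Variables (T S : finType) (X : {set T}) (L : {set S}) (inc : T -> S -> bool).
Hypothesis F : fano X L inc.
Variables (aT : finGroupType) (to : {action aT &-> T}) (to' : {action aT &-> S}).
Variable H : {group aT}.
Hypothesis aX : [acts H, on X | to].
Hypothesis aL : [acts H, on L | to'].
Hypothesis incH : forall h x l, h \in H -> x \in X -> l \in L ->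
  inc (to x h) (to' l h) = inc x l.
Hypothesis tr2 : trans2_on to H X.

Lemma fano_frame_trans x y z x' y' z' : x \in X -> y \in X -> z \in X ->
  x' \in X -> y' \in X -> z' \in X ->
  noncollinear L inc x y z -> noncollinear L inc x' y' z' ->
  exists2 h, h \in H & [/\ to x h = x', to y h = y' & to z h = z'].
Proof.
move=> Xx Xy Xz Xx' Xy' Xz'; have [vec [pt C]] := fano_coordinates F.
move/(noncollinear_vec F C Xx Xy Xz) => fr /(noncollinear_vec F C Xx' Xy' Xz') fr'.
have [h Hh []] := vact_frame_trans F C aX aL incH tr2 fr fr'.
rewrite !(vactE C) // => e1 e2 e3; exists h => //.
by split; apply: (vec_inj C) => //; rewrite (acts_act aX).
Qed.

Lemma fano_other l p : l \in L -> exists q, [/\ q \in X, inc q l & p != q].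
Proof.
move=> Ll; have c3 := fano_row F Ll.
have : 0 < #|[set x in X | inc x l] :\ p|.
  by move: c3; rewrite (cardsD1 p); case: (p \in _); [rewrite add1n => -[->]|rewrite add0n => ->].
case/card_gt0P=> q; rewrite !inE => /and3P[qp Xq ql]; exists q.
by rewrite eq_sym.
Qed.

(** Two lines are recovered from a triangle made of their common point p and a further point on
    each, and the group is transitive on triangles. *)
Lemma fano_lines_trans2 : trans2_on to' H L.
Proof.
have fr l m : l \in L -> m \in L -> l != m -> exists p q s, [/\ [/\ p \in X, q \in X & s \in X],
    [/\ inc p l, inc q l, inc p m & inc s m], p != s & noncollinear L inc p q s].
  move=> Ll Lm lm; have [p [Xp pl pm]] := fano_meet_ex F Ll Lm lm.
  have [q [Xq ql pq]] := fano_other p Ll; have [s [Xs sm ps]] := fano_other p Lm.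
  exists p, q, s; split=> //; split=> // n Ln pn qn.
  have -> : n = l by exact: (fano_meet_uniq F Xp Xq Ln Ll pn qn pl ql pq).
  by apply: contra lm => sl; apply/eqP; exact: (fano_meet_uniq F Xp Xs Ll Lm pl sl pm sm ps).
move=> l m l' m' Ll Lm Ll' Lm' lm lm'.
have [p [q [s [[Xp Xq Xs] [pl ql pm sm] ps nc]]]] := fr _ _ Ll Lm lm.
have [p' [q' [s' [[Xp' Xq' Xs'] [pl' ql' pm' sm'] ps' nc']]]] := fr _ _ Ll' Lm' lm'.
have [h Hh [hp hq hs]] := fano_frame_trans Xp Xq Xs Xp' Xq' Xs' nc nc'.
have Ll2 : to' l h \in L by rewrite (acts_act aL).
have Lm2 : to' m h \in L by rewrite (acts_act aL).
exists h => //; split.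
  apply: (fano_meet_uniq F Xp' Xq' Ll2 Ll' _ _ pl' ql' nc'.1).
    by rewrite -hp incH.
  by rewrite -hq incH.
apply: (fano_meet_uniq F Xp' Xs' Lm2 Lm' _ _ pm' sm' ps').
  by rewrite -hp incH.
by rewrite -hs incH.
Qed.

(** The stabiliser of a line l is 2-transitive on the four points off l. Complete a, b to a triangle
    by a point q of l off the line ab, and likewise a', b' by q'. The image of l passes through q'
    and avoids a' and b'; of the three lines through q' one contains a' and another contains b', so
    the image is the remaining one, which is l. *)
Lemma fano_affine_trans2 l a b a' b' : l \in L ->
    a \in X -> b \in X -> a' \in X -> b' \in X ->
    ~~ inc a l -> ~~ inc b l -> ~~ inc a' l -> ~~ inc b' l -> a != b -> a' != b' ->
  exists2 h, h \in H & [/\ to' l h = l, to a h = a' & to b h = b'].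
Proof.
move=> Ll Xa Xb Xa' Xb' al bl al' bl' ab ab'.
have fr u w : u \in X -> w \in X -> ~~ inc u l -> u != w ->
    exists q, [/\ q \in X, inc q l & noncollinear L inc u w q].
  move=> Xu Xw ul uw; have [m [Lm um wm]] := fano_join_ex F Xu Xw uw.
  have lm : l != m by apply: contra ul => /eqP->.
  have [c [Xc cl cm]] := fano_meet_ex F Ll Lm lm.
  have [q [Xq ql cq]] := fano_other c Ll; exists q; split=> //; split=> // n Ln un wn.
  have -> : n = m by exact: (fano_meet_uniq F Xu Xw Ln Lm un wn um wm uw).
  by apply: contra lm => qm; apply/eqP; exact: (fano_meet_uniq F Xc Xq Ll Lm cl ql cm qm cq).
have [q [Xq ql nc]] := fr _ _ Xa Xb al ab; have [q' [Xq' ql' nc']] := fr _ _ Xa' Xb' al' ab'.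
have [h Hh [ha hb hq]] := fano_frame_trans Xa Xb Xq Xa' Xb' Xq' nc nc'.
exists h => //; split=> //.
have qa : q' != a' by apply: contra al' => /eqP<-.
have qb : q' != b' by apply: contra bl' => /eqP<-.
have [m [Lm qm am]] := fano_join_ex F Xq' Xa' qa.
have [n [Ln qn bn]] := fano_join_ex F Xq' Xb' qb.
have mn : m != n.
  by apply/eqP=> e; have := nc'.2 m Lm am; rewrite {1}e => /(_ bn); rewrite qm.
have c3 := fano_pencil F Xq'.
have : #|[set k in L | inc q' k] :\ m :\ n| = 1.
  have nm : n != m by rewrite eq_sym.
  by move: c3; rewrite (cardsD1 m) inE Lm qm (cardsD1 n) !inE nm Ln qn !add1n => -[].
case/cards1P_ex=> k e.
have inm j : j \in L -> inc q' j -> ~~ inc a' j -> ~~ inc b' j -> j = k.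
  move=> Lj qj aj bj; apply/eqP; rewrite -in_set1 -e !inE Lj qj !andbT.
  by apply/andP; split; [apply: contra bj => /eqP-> | apply: contra aj => /eqP->].
apply: (etrans _ (esym (inm l Ll ql' al' bl'))); apply: inm.
- by rewrite (acts_act aL).
- by rewrite -hq incH.
- by rewrite -ha incH.
- by rewrite -hb incH.
Qed.

End FanoAction.

(** * Row vectors over F_2, PG(2,2) and PSL(3,2) *)

Section PSL32.
Import GRing.Theory.
Local Open Scope ring_scope.

Definition bit3 (w : V3) (i : 'I_3) : bool := nth false [:: w.1.1; w.1.2; w.2] i.

Definition iota3 (w : V3) : 'rV['F_2]_3 := \row_i (bit3 w i)%:R.

Lemma F2E (x : 'F_2) : x = (x != 0)%:R.
Proof. by apply/val_inj; case: x => [[|[|//]] ?]. Qed.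

Lemma iota3D u w : iota3 (add3 u w) = iota3 u + iota3 w.
Proof.
apply/rowP=> i; rewrite !mxE.
have -> : bit3 (add3 u w) i = bit3 u i (+) bit3 w i by case: i => [[|[|[|//]]] ?].
by case: (bit3 u i); case: (bit3 w i); apply/val_inj.
Qed.

Lemma iota3_0 : iota3 zero3 = 0.
Proof. by apply/rowP=> i; rewrite !mxE; case: i => [[|[|[|//]]] ?]. Qed.

Lemma iota3_inj : injective iota3.
Proof.
move=> u w /rowP e.
have b i : bit3 u i = bit3 w i.
  by have := e i; rewrite !mxE; case: (bit3 u i); case: (bit3 w i) => // /(congr1 val).
case: u w b {e} => [[a c] d] [[a' c'] d'] b.
have := b (inord 0); have := b (inord 1); have := b (inord 2).
by rewrite /bit3 !inordK //= => -> -> ->.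
Qed.

Lemma iota3_surj (v : 'rV['F_2]_3) : exists w, v = iota3 w.
Proof.
exists (v 0 (inord 0) != 0, v 0 (inord 1) != 0, v 0 (inord 2) != 0).
apply/rowP=> i; rewrite mxE [LHS]F2E; congr (_%:R); congr nat_of_bool.
by case: i => [[|[|[|//]]] hi] /=; congr (v 0 _ != 0); apply/val_inj; rewrite /= inordK.
Qed.

Lemma iota3_eq0 w : (iota3 w == 0) = (w == zero3).
Proof. by rewrite -iota3_0 (inj_eq iota3_inj). Qed.

Lemma iota3_lin (k : 'M['F_2]_3) a b c w :
  row (inord 0) k = iota3 a -> row (inord 1) k = iota3 b -> row (inord 2) k = iota3 c ->
  iota3 w *m k = iota3 (lin3 a b c w).
Proof.
move=> ha hb hc; rewrite mulmx_sum_row !big_ord_recl big_ord0 addr0.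
have sc (s : bool) u : (s%:R : 'F_2) *: iota3 u = iota3 (if s then u else zero3).
  by case: s; rewrite ?scale1r // scale0r iota3_0.
have -> : ord0 = inord 0 :> 'I_3 by apply/val_inj; rewrite /= inordK.
have -> : lift (inord 0) ord0 = inord 1 :> 'I_3 by apply/val_inj; rewrite /= !inordK.
have -> : lift (inord 0) (lift ord0 ord0) = inord 2 :> 'I_3.
  by apply/val_inj; rewrite /= /bump /= !inordK.
rewrite ha hb hc !mxE !sc /lin3 !iota3D.
by rewrite /bit3 !inordK.
Qed.

(** The second alternative absorbs indices out of range; at 0, 1 and 2 it is refuted by
    computation. *)
Lemma row_of_basis (k : 'M['F_2]_3) i :
  row (inord i) k = iota3 (nth e1 [:: e1; e2; e3] i) *m k \/ ~~ (i < 3)%N.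
Proof.
case: (ltnP i 3) => hi; [left|by right].
rewrite rowE; congr (_ *m _); apply/rowP=> j; rewrite !mxE eqxx /=.
by case: i hi => [|[|[|//]]] _; case: j => [[|[|[|//]]] hj]; rewrite -val_eqE /= inordK.
Qed.

(** Over F_2 a non-zero determinant equals 1, so every invertible matrix lies in SL. *)
Lemma frame_SL a b c : frame3 a b c ->
  exists2 k, k \in SL_group 'F_2 2 & forall w, iota3 w *m GLval k = iota3 (lin3 a b c w).
Proof.
move=> fr; pose M : 'M['F_2]_3 := \matrix_(i < 3) iota3 (nth a [:: a; b; c] i).
have ME w : iota3 w *m M = iota3 (lin3 a b c w).
  by apply: iota3_lin; rewrite rowK inordK.
have fM : row_free M.
  apply: inj_row_free => v; have [w ->] := iota3_surj v.
  rewrite ME -iota3_0 => /iota3_inj e; congr iota3.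
  by apply: (frame3_lin_inj fr); rewrite e /lin3 /= !add30.
have uM : M \is a GRing.unit by rewrite -row_free_unit in fM *.
exists (FinRing.Unit uM) => //; rewrite inE /= [\det _]F2E.
have : M \in unitmx by [].
by rewrite unitmxE unitfE => ->.
Qed.

(** A line through the origin over F_2 has a single non-zero vector, so projective points correspond
    to non-zero vectors. *)
Definition proj_pt (w : V3) : {set 'rV['F_2]_3} := [set 0; iota3 w].

Lemma proj_pt_inj u w : u != zero3 -> w != zero3 -> proj_pt u = proj_pt w -> u = w.
Proof.
move=> u0 w0 /setP/(_ (iota3 u)); rewrite !inE eqxx orbT !iota3_eq0 (negPf u0) /=.
by move/esym/eqP/iota3_inj.
Qed.

Lemma subspaces_points : subspaces 'F_2 2 1 = proj_pt @: [set~ zero3].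
Proof.
have span w : [set u | (u <= iota3 w)%MS] = proj_pt w.
  apply/setP=> u; rewrite !inE; apply/sub_rVP/idP.
    case=> a ->; rewrite [a]F2E; case: (a != 0); rewrite ?scale1r ?eqxx ?orbT //.
    by rewrite scale0r eqxx.
  by case/orP=> /eqP->; [exists 0; rewrite scale0r | exists 1; rewrite scale1r].
have rf w : row_free (iota3 w) = (w != zero3).
  by rewrite /row_free rank_rV iota3_eq0; case: (w == zero3).
apply/setP=> A; apply/imsetP/imsetP=> [[B]|[w]].
  rewrite inE; have [w ->] := iota3_surj B; rewrite rf => w0 ->.
  by exists w; rewrite ?inE // span.
by rewrite !inE => w0 ->; exists (iota3 w); rewrite ?inE ?rf ?span.
Qed.

Lemma proj_pt_imset (T S : finType) (X : {set T}) (L : {set S}) inc vec pt :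
  fano_coord X L inc vec pt -> [set proj_pt (vec x) | x in X] = subspaces 'F_2 2 1.
Proof.
move=> C; rewrite subspaces_points; suff -> : [set~ zero3] = vec @: X by exact: imset_comp.
apply/setP=> w; rewrite !inE; apply/idP/imsetP=> [w0|[x Xx ->]].
  by exists (pt w); rewrite ?(pt_in C) ?(ptK C).
exact: (vec_neq0 C).
Qed.

Lemma GLact_pt w (k : {'GL_3['F_2]}) u : iota3 w *m GLval k = iota3 u ->
  ((GL_action 'F_2 2)^*)%act (proj_pt w) k = proj_pt u.
Proof.
move=> e; rewrite /= setactE imsetU !imset_set1 /= /GLact mul0mx.
by rewrite e.
Qed.

Lemma GLact_neq0 w (k : {'GL_3['F_2]}) u : iota3 w *m GLval k = iota3 u ->
  (u == zero3) = (w == zero3).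
Proof.
move=> e; rewrite -!iota3_eq0 -e; apply/eqP/eqP=> [h|->]; last by rewrite mul0mx.
have uk : GLval k \in unitmx by exact: GL_unitmx.
by rewrite -[iota3 w](mulmxK uk) h mul0mx.
Qed.

Lemma acts_GL_points (K : {group {'GL_3['F_2]}}) :
  [acts K, on subspaces 'F_2 2 1 | (GL_action 'F_2 2)^*].
Proof.
apply/subsetP=> k _; have one (h : {'GL_3['F_2]}) A : A \in subspaces 'F_2 2 1 ->
    ((GL_action 'F_2 2)^*)%act A h \in subspaces 'F_2 2 1.
  rewrite subspaces_points => /imsetP[w]; rewrite !inE => w0 ->.
  have [u e] := iota3_surj (iota3 w *m GLval h).
  by rewrite (GLact_pt e); apply: imset_f; rewrite !inE (GLact_neq0 e).
apply/astabsP=> A; apply/idP/idP; last exact: one.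
by move/(one k^-1%g); rewrite actK.
Qed.

Section Points.
Variables (aT : finGroupType) (T : finType) (to : {action aT &-> T}).
Variables (H : {group aT}) (X : {set T}).
Hypothesis aX : [acts H, on X | to].

(** Two distinct non-zero vectors over F_2 are independent, hence extend to a frame, and SL is
    transitive on frames; the isomorphism brings the matrix back to H. *)
Lemma PSL32_trans2 : is_PSL32 to H X -> trans2_on to H X.
Proof.
move/perm_isomorphic_elim=> /(_ aX (acts_GL_points _)) [f [injf imf _ KH]].
move=> x y x' y' Xx Xy Xx' Xy' xy xy'.
have pt z : z \in X -> exists2 w, w != zero3 & f z = proj_pt w.
  move=> Xz; have : f z \in subspaces 'F_2 2 1 by rewrite -imf imset_f.
  by rewrite subspaces_points => /imsetP[w]; rewrite !inE; exists w.
have ne z1 z2 w1 w2 : z1 \in X -> z2 \in X -> z1 != z2 -> f z1 = proj_pt w1 ->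
    f z2 = proj_pt w2 -> w1 != w2.
  move=> X1 X2 ne h1 h2; apply: contra ne => /eqP e; apply/eqP/injf => //.
  by rewrite h1 h2 e.
have [[u u0 eu] [w w0 ew]] := (pt _ Xx, pt _ Xy).
have [[u' u0' eu'] [w' w0' ew']] := (pt _ Xx', pt _ Xy').
have [c fr] := frame3_ex u0 w0 (ne _ _ _ _ Xx Xy xy eu ew).
have [c' fr'] := frame3_ex u0' w0' (ne _ _ _ _ Xx' Xy' xy' eu' ew').
have [k1 K1 h1] := frame_SL fr; have [k2 K2 h2] := frame_SL fr'.
have [h Hh l] := KH (k1^-1 * k2)%g (groupM (groupVr K1) K2).
have l1 a b d : lin3 a b d e1 = a by rewrite /lin3 /= !add30.
have l2 a b d : lin3 a b d e2 = b by rewrite /lin3 /= add30 add03.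
have key a b d a' b' d' e : (forall w, iota3 w *m GLval k1 = iota3 (lin3 a b d w)) ->
    (forall w, iota3 w *m GLval k2 = iota3 (lin3 a' b' d' w)) ->
    iota3 (lin3 a b d e) *m GLval (k1^-1 * k2)%g = iota3 (lin3 a' b' d' e).
  move=> g1 g2; rewrite -g1 GL_MxE mulmxA -[_ *m GLval k1 *m _]mulmxA -GL_MxE mulgV.
  by rewrite GL_1E mulmx1 g2.
exists h => //; split; apply: injf; rewrite ?(acts_act aX) // l //.
  by rewrite eu eu'; apply: GLact_pt; rewrite -{1}(l1 u w c) (key _ _ _ _ _ _ _ h1 h2) l1.
by rewrite ew ew'; apply: GLact_pt; rewrite -{1}(l2 u w c) (key _ _ _ _ _ _ _ h1 h2) l2.
Qed.

Variables (S : finType) (to' : {action aT &-> S}) (L : {set S}) (inc : T -> S -> bool).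
Hypothesis F : fano X L inc.
Hypothesis aL : [acts H, on L | to'].
Hypothesis incH : forall h x l, h \in H -> x \in X -> l \in L ->
  inc (to x h) (to' l h) = inc x l.

(** An element of H acts additively on the coordinates, hence as a matrix. Conversely a matrix sends
    the basis to a frame, and transitivity of H on frames yields an element with the same effect. *)
Lemma fano_PSL32 : trans2_on to H X -> is_PSL32 to H X.
Proof.
move=> tr2; have [vec [pt C]] := fano_coordinates F.
have like h (k : {'GL_3['F_2]}) : h \in H ->
    (forall w, iota3 w *m GLval k = iota3 (vact vec pt to h w)) ->
    acts_like to X (GL_action 'F_2 2)^* (fun x => proj_pt (vec x)) h k.
  by move=> Hh e x Xx; apply/esym/GLact_pt; rewrite e (vactE C).
apply: (perm_isomorphic_intro aX (acts_GL_points _) (f := fun x => proj_pt (vec x))).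
- move=> x y Xx Xy /proj_pt_inj e; apply: (vec_inj C) => //.
  by apply: e; exact: (vec_neq0 C).
- exact: (proj_pt_imset C).
- move=> h Hh; have add := vact_additive F C aX aL incH Hh.
  have fr := vact_frame F C aX aL incH Hh (isT : frame3 e1 e2 e3).
  have [k Kk e] := frame_SL fr; exists k => //; apply: like => // w.
  by rewrite e -(additive_lin3 add).
move=> k Kk.
have [a ea] := iota3_surj (iota3 e1 *m GLval k).
have [b eb] := iota3_surj (iota3 e2 *m GLval k).
have [c ec] := iota3_surj (iota3 e3 *m GLval k).
have kE w : iota3 w *m GLval k = iota3 (lin3 a b c w).
  apply: iota3_lin.
  - by have [->|] := row_of_basis (GLval k) 0.
  - by have [->|] := row_of_basis (GLval k) 1.
  - by have [->|] := row_of_basis (GLval k) 2.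
have fr : frame3 a b c.
  (* An invertible matrix kills no non-zero vector; applied to the seven non-zero vectors this
     excludes the seven relations of [frame3]. *)
  have nz w : (lin3 a b c w == zero3) = (w == zero3) by exact: (GLact_neq0 (kE w)).
  have n1 := nz e1; have n2 := nz e2; have n3 := nz e3.
  have n4 := nz (add3 e1 e2); have n5 := nz (add3 e3 e1).
  have n6 := nz (add3 e3 e2); have n7 := nz (add3 e3 (add3 e1 e2)).
  move: n1 n2 n3 n4 n5 n6 n7; clear; rewrite !eq3E; move/negbT=> n1 /negbT n2 /negbT n3.
  move=> /negbT n4 /negbT n5 /negbT n6 /negbT n7.
  move: n1; apply/implyP; move: n2; apply/implyP; move: n3; apply/implyP.
  move: n4; apply/implyP; move: n5; apply/implyP; move: n6; apply/implyP.
  move: n7; apply/implyP; move: a; apply: V3_allP; move: b; apply: V3_allP.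
  by move: c; apply: V3_allP; vm_compute.
have [h Hh [h1 h2 h3]] := vact_frame_trans F C aX aL incH tr2 (isT : frame3 e1 e2 e3) fr.
exists h => //; apply: like => // w.
by rewrite kE (additive_lin3 (vact_additive F C aX aL incH Hh)) h1 h2 h3.
Qed.

End Points.

(** A line together with zero is the span of the vectors of any two of its points, because the third
    vector is their sum; conversely a plane of F_2^3 is spanned by two vectors, and their points
    have a join. *)
Lemma fano_PG2 (T S : finType) (X : {set T}) (L : {set S}) (inc : T -> S -> bool) :
  fano X L inc -> incidence_iso (Incidence X L inc) (PG2 'F_2).
Proof.
move=> F; have [vec [pt C]] := fano_coordinates F.
pose g l : {set 'rV['F_2]_3} := 0 |: [set iota3 (vec x) | x in [set x in X | inc x l]].
have gin l x : x \in X -> (iota3 (vec x) \in g l) = inc x l.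
  move=> Xx; rewrite !inE iota3_eq0 (negPf (vec_neq0 C Xx)) /=; apply/imsetP/idP.
    case=> y; rewrite inE => /andP[Xy yl] /iota3_inj /(vec_inj C) -> //.
  by move=> xl; exists x; rewrite ?inE ?Xx.
pose row2 (u w : V3) : 'M['F_2]_(2, 3) := \matrix_(i < 2) iota3 (nth u [:: u; w] i).
have mul2 u w (v : 'rV['F_2]_2) : v *m row2 u w = v 0 0 *: iota3 u + v 0 1 *: iota3 w.
  rewrite mulmx_sum_row !big_ord_recl big_ord0 addr0 !rowK /=.
  by congr (_ + v 0 _ *: _); apply/val_inj.
have gE l x y : l \in L -> x \in X -> y \in X -> x != y -> inc x l -> inc y l ->
    g l = [set v | (v <= row2 (vec x) (vec y))%MS].
  move=> Ll Xx Xy xy xl yl; have [z [Xz xz yz e]] := fano_third F Xx Xy Ll xy xl yl.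
  apply/setP=> v; rewrite /g e [RHS]inE; apply/idP/submxP.
    have ex (s t : bool) : exists D : 'rV['F_2]_2,
        iota3 (add3 (if s then vec x else zero3) (if t then vec y else zero3)) =
        D *m row2 (vec x) (vec y).
      exists (\row_i (nth false [:: s; t] i)%:R); rewrite mul2 !mxE /= iota3D.
      by case: s; case: t; rewrite ?iota3_0 ?scale1r ?scale0r.
    rewrite 2!inE => /orP[/eqP->|/imsetP[u]].
      by have := ex false false; rewrite add33 iota3_0.
    rewrite !inE => /orP[/orP[]|] /eqP-> ->.
    - by have := ex true false; rewrite add30.
    - by have := ex false true; rewrite add03.
    - by rewrite (vec_line C Ll e) //; exact: (ex true true).
  case=> D ->; rewrite mul2 [D 0 0]F2E [D 0 1]F2E.
  have inz u : u \in [set x; y; z] -> iota3 (vec u) \in 0 |: [set iota3 (vec x) | x in [set x; y; z]].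
    by move=> hu; apply/setU1P; right; apply/imsetP; exists u.
  case: (D 0 0 != 0); case: (D 0 1 != 0); rewrite ?scale1r ?scale0r ?add0r ?addr0.
  - by rewrite -iota3D -(vec_line C Ll e) // inz // !inE eqxx !orbT.
  - by rewrite inz // !inE eqxx.
  - by rewrite inz // !inE eqxx !orbT.
  - by rewrite !inE eqxx.
have two l : l \in L -> exists x y, [/\ x \in X, y \in X, x != y, inc x l & inc y l].
  move=> Ll; have : (1 < #|[set x in X | inc x l]|)%N by rewrite (fano_row F Ll).
  by case/card_gt1P=> x [y []]; rewrite !inE => /andP[Xx xl] /andP[Xy yl]; exists x, y.
exists (fun x => proj_pt (vec x)), g; split; last first.
- move=> x l /= Xx Ll; rewrite -gin // /proj_pt subUset !sub1set.
  by rewrite !inE eqxx.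
- split=> /=.
    move=> l m Ll Lm e; have [x [y [Xx Xy xy xl yl]]] := two _ Ll.
    apply: (fano_meet_uniq F Xx Xy Ll Lm xl yl _ _ xy); by rewrite -gin // -e gin.
  apply/setP=> A; apply/imsetP/imsetP=> [[l Ll ->]|[B]].
    have [x [y [Xx Xy xy xl yl]]] := two _ Ll.
    exists (row2 (vec x) (vec y)); last exact: gE.
    rewrite inE; apply: inj_row_free => v; rewrite mul2 => h; apply/rowP=> i.
    move: h; rewrite [v 0 0]F2E [v 0 1]F2E !mxE.
    have -> : v 0 i = if i == 0 then v 0 0 else v 0 1.
      by case: i => [[|[|//]] ?] /=; congr (v 0 _); apply/val_inj.
    have vx := vec_neq0 C Xx; have vy := vec_neq0 C Xy.
    case e1': (v 0 0 != 0); case e2': (v 0 1 != 0); rewrite ?scale1r ?scale0r ?add0r ?addr0.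
    + move/eqP; rewrite -iota3D iota3_eq0 add3_eq0 (inj_in_eq (vec_inj C)) //.
      by rewrite (negPf xy).
    + by move/eqP; rewrite iota3_eq0 (negPf vx).
    + by move/eqP; rewrite iota3_eq0 (negPf vy).
    + by move/negbFE/eqP: e1' => ->; move/negbFE/eqP: e2' => -> _; case: ifP.
  rewrite inE => fB ->; have [u eu] := iota3_surj (row 0 B); have [w ew] := iota3_surj (row 1 B).
  have eB : B = row2 u w.
    apply/row_matrixP=> i; rewrite rowK; case: i => [[|[|//]] hi] /=.
      by rewrite -eu; congr row; apply/val_inj.
    by rewrite -ew; congr row; apply/val_inj.
  have inj0 v : v *m B = 0 -> v = 0 by move/row_free_inj: fB => inj h; apply: inj; rewrite h mul0mx.
  have nz (s t : bool) : s || t -> add3 (if s then u else zero3) (if t then w else zero3) != zero3.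
    move=> st; apply/eqP=> e.
    have : (\row_(i < 2) ((nth false [:: s; t] i)%:R : 'F_2)) *m B = 0.
      rewrite eB mul2 !mxE /= -iota3_0 -e iota3D.
      by case: (s); case: (t); rewrite ?iota3_0 ?scale1r ?scale0r.
    move/inj0/rowP => z; have := z 0; have := z 1; rewrite !mxE /=.
    by case: (s) st; case: (t) => // _ /(congr1 val) // _ /(congr1 val).
  have u0 : u != zero3 by have := nz true false isT; rewrite add30.
  have w0 : w != zero3 by have := nz false true isT; rewrite add03.
  have uw : u != w by have := nz true true isT; rewrite add3_eq0.
  have ne : pt u != pt w by apply: contra uw => /eqP e; rewrite -(ptK C u0) -(ptK C w0) e.
  have [l [Ll ul wl]] := fano_join_ex F (pt_in C u0) (pt_in C w0) ne.
  by exists l => //; rewrite (gE _ _ _ Ll (pt_in C u0) (pt_in C w0)) // !(ptK C) // eB.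
split=> /=.
- move=> x y Xx Xy /proj_pt_inj e; apply: (vec_inj C) => //.
  by apply: e; exact: (vec_neq0 C).
- exact: (proj_pt_imset C).
Qed.

End PSL32.

(** * Two-arc transitivity of the quotient *)

Section Quotient2ArcTransitive.
Variables (T : finType) (Ga : graph T) (G : {group {perm T}}).
Variables (P : {set {set T}}) (v k b : nat).
Hypothesis st : setting Ga G P v k b.

Local Notation V := (vert Ga).
Local Notation GaP := (quot Ga P).
Local Notation "B ^^ g" := ('P^*%act B g) (at level 30).
Local Notation stab B := ('N_G(B | 'P)%G).
Local Notation N B := (nbr GaP B).

Lemma params_vb v' b' r l : params Ga P v' b' r l -> v = v' /\ b = b'.
Proof.
case=> hv hb _ _; have [B PB] := st_P0 st.
by rewrite -(card_block st PB) -(card_N st PB) hv // hb.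
Qed.

Lemma hitG g B C x : g \in G -> (g x \in hit Ga (B ^^ g) (C ^^ g)) = (x \in hit Ga B C).
Proof. by move=> Gg; rewrite !in_set mem_setactP (nbrsG st). Qed.

Lemma in_hit B C x : x \in hit Ga B C = (x \in B) && (x \in nbrs Ga C).
Proof. by rewrite in_set. Qed.

Lemma in_miss B C x : x \in miss Ga B C = (x \in B) && (x \notin nbrs Ga C).
Proof. by rewrite in_set. Qed.

Lemma stabN B C g : g \in 'N_G(B | 'P)%g -> C \in N B -> C ^^ g \in N B.
Proof. by move=> Sg hC; rewrite (acts_act (acts_stab_N st B)). Qed.

Lemma N_irr B C : C \in N B -> B != C.
Proof. by rewrite mem_N => /quot_adjP[]. Qed.

Lemma disjoint_hit B C : C \in N B -> [disjoint hit Ga B C & hit Ga C B].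
Proof.
move=> hC; rewrite -setI_eq0; apply/eqP/setP=> x; rewrite in_setI !in_hit in_set0.
apply/negP=> /andP[/andP[Bx _] /andP[Cx _]]; have [PB PC] := N_block hC.
by have := N_irr hC; rewrite (block_uniq st PB PC Bx Cx) eqxx.
Qed.

Lemma indep_hit B C : C \in N B -> {in hit Ga B C &, forall x y, ~~ adj Ga x y}.
Proof.
move=> hC x y; rewrite !in_hit => /andP[Bx _] /andP[By _]; apply/negP=> a.
have [PB _] := N_block hC.
by have := N_irr (edge_blocks st a PB PB Bx By); rewrite eqxx.
Qed.

(** * Blocks whose vertices correspond one to one to the neighbouring blocks *)

Section Matching.
Hypothesis k1 : k = 1.
Hypothesis r1 : r_is Ga P 1.

Lemma matching_hit B C : C \in N B -> exists x, hit Ga B C = [set x].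
Proof. by move/(card_hit st); rewrite k1 => /cards1P_ex. Qed.

Lemma matching_block B x : B \in P -> x \in B ->
  exists C, [/\ C \in N B, x \in hit Ga B C & forall D, D \in N B -> x \in hit Ga B D -> D = C].
Proof.
move=> PB Bx; have := r1 (block_vert st PB Bx); rewrite (blocks_atE st PB Bx).
case/cards1P_ex=> C /setP e.
have h D : (D \in N B) && (x \in nbrs Ga D) = (D == C) by rewrite -in_set1 -e [RHS]in_set.
exists C; have /andP[hC xC] : (C \in N B) && (x \in nbrs Ga C) by rewrite h.
split=> // [|D hD xD]; first by rewrite in_hit Bx.
by apply/eqP; rewrite -h hD; move: xD; rewrite in_hit => /andP[_ ->].
Qed.

(** With k = r = 1 each vertex of B meets one neighbouring block and each such block meets one
    vertex of B. This equivariant bijection carries 2-transitivity both ways. *)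
Lemma matching_trans2 B : B \in P ->
  trans2_on 'P (stab B) B <-> trans2_on 'P^* (stab B) (N B).
Proof.
move=> PB; split=> tr.
  move=> C D C' D' hC hD hC' hD' ne ne'.
  have ex X : X \in N B -> exists2 x, x \in B & x \in hit Ga B X.
    move=> hX; have [x ex] := matching_hit hX; exists x; last by rewrite ex inE.
    by have := set11 x; rewrite -ex in_hit => /andP[].
  have uq x X Y : x \in B -> X \in N B -> Y \in N B -> x \in hit Ga B X ->
      x \in hit Ga B Y -> X = Y.
    move=> Bx hX hY xX xY; have [Z [_ _ u]] := matching_block PB Bx.
    by rewrite (u X) // (u Y).
  have [[x Bx xC] [y By yD]] := (ex _ hC, ex _ hD).
  have [[x' Bx' xC'] [y' By' yD']] := (ex _ hC', ex _ hD').
  have xy : x != y by apply: contra ne => /eqP e; apply/eqP/(uq x) => //; rewrite e.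
  have xy' : x' != y' by apply: contra ne' => /eqP e; apply/eqP/(uq x') => //; rewrite e.
  have [g Sg [gx gy]] := tr _ _ _ _ Bx By Bx' By' xy xy'; exists g => //.
  have /stabP[Gg eB] := Sg; rewrite /= in gx gy; split.
    apply: (uq x') => //; first exact: stabN.
    by rewrite -gx -{1}eB hitG.
  apply: (uq y') => //; first exact: stabN.
  by rewrite -gy -{1}eB hitG.
move=> x y x' y' Bx By Bx' By' ne ne'.
have uq C u w : C \in N B -> u \in hit Ga B C -> w \in hit Ga B C -> u = w.
  by move=> hC; have [z ->] := matching_hit hC; rewrite !inE => /eqP-> /eqP->.
have [C [hC xC _]] := matching_block PB Bx; have [D [hD yD _]] := matching_block PB By.
have [C' [hC' xC' _]] := matching_block PB Bx'; have [D' [hD' yD' _]] := matching_block PB By'.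
have CD : C != D by apply: contra ne => /eqP e; apply/eqP/(uq C) => //; rewrite e.
have CD' : C' != D' by apply: contra ne' => /eqP e; apply/eqP/(uq C') => //; rewrite e.
have [g Sg [gC gD]] := tr _ _ _ _ hC hD hC' hD' CD CD'; exists g => //.
have /stabP[Gg eB] := Sg; split.
  by apply: (uq C') => //; rewrite -gC -eB hitG.
by apply: (uq D') => //; rewrite -gD -eB hitG.
Qed.

(** All neighbours of x lie in the only block C that x meets, and a single vertex of C has
    neighbours in B. *)
Lemma matching_regular : regular Ga 1.
Proof.
move=> x Vx; have [B PB Bx] := block_of st Vx.
have [C [hC xC uC]] := matching_block PB Bx; have [_ PC] := N_block hC.
have hB : B \in N C by rewrite -(N_sym st).
have [y ey] := matching_hit hB.
suff -> : nbr Ga x = [set y] by rewrite cards1.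
have sub z : adj Ga x z -> z = y.
  move=> a; have [_ Vz] := adj_vert st a; have [D PD Dz] := block_of st Vz.
  have hD := edge_blocks st a PB PD Bx Dz.
  have xD : x \in hit Ga B D.
    by rewrite in_hit Bx; apply/nbrsP; exists z; rewrite // (st_adjC st).
  have eD := uC _ hD xD; apply/eqP; rewrite -in_set1 -ey in_hit -eD Dz.
  by apply/nbrsP; exists x.
apply/setP=> z; rewrite !inE; apply/idP/eqP=> [/sub //|->].
move: xC; rewrite in_hit => /andP[_ /nbrsP[w Cw a]].
by rewrite (st_adjC st) in a; rewrite -(sub _ a).
Qed.

End Matching.

Section FanoCase.
Hypothesis hp : params Ga P 7 7 4 2.

(** Pencils have 7 - 4 = 3 elements, and two lines share mu = lambda + 6 - v = 2 + 6 - 7 = 1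
    point. *)
Lemma fano_block B : B \in P -> fano B (N B) (fun x C => x \notin nbrs Ga C).
Proof.
move=> PB; have [ev eb] := params_vb hp; case: hp => _ _ hr hl; split.
- by rewrite (card_block st PB).
- by rewrite (card_N st PB).
- by move=> x Bx; rewrite (card_missed st hr PB Bx) eb.
- by move=> C hC; exact: (card_miss st hC).
move=> C D hC hD ne; have := lambda_mu st hC hD.
rewrite (hl B C D PB hC hD ne) ev.
rewrite (_ : [set x in B | _] = miss Ga B C :&: miss Ga B D); first by lia.
by apply/setP=> x; rewrite in_setI !in_set; case: (x \in B).
Qed.

Lemma fano_block_act B g x C : g \in stab B -> x \in B -> C \in N B ->
  (('P%act x g) \notin nbrs Ga (C ^^ g)) = (x \notin nbrs Ga C).
Proof. by case/stabP=> Gg _ _ _; rewrite (nbrsG st). Qed.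

Lemma fano_trans2 B : B \in P ->
  trans2_on 'P (stab B) B <-> trans2_on 'P^* (stab B) (N B).
Proof.
move=> PB; have F := fano_block PB; split.
  apply: (fano_lines_trans2 F (acts_stab_block G B) (acts_stab_N st B)).
  exact: fano_block_act.
apply: (fano_lines_trans2 (fano_dual F) (acts_stab_N st B) (acts_stab_block G B)).
by move=> g C x Sg hC Bx; exact (fano_block_act Sg Bx hC).
Qed.

Lemma fano_block_PSL B : B \in P -> trans2_on 'P (stab B) B ->
  is_PSL32 'P (stab B) B.
Proof.
move=> PB; apply: (fano_PSL32 (acts_stab_block G B) (fano_block PB) (acts_stab_N st B)).
exact: fano_block_act.
Qed.

Lemma fano_block_PSL_dual B : B \in P -> trans2_on 'P^* (stab B) (N B) ->
  is_PSL32 'P^* (stab B) (N B).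
Proof.
move=> PB; apply: (fano_PSL32 (acts_stab_N st B) (fano_dual (fano_block PB)) (acts_stab_block G B)).
by move=> g C x Sg hC Bx; exact (fano_block_act Sg Bx hC).
Qed.

End FanoCase.

Section ThreeArc.
Variable a : nat.
Hypothesis a3 : 3 <= a.
Hypothesis hp : params Ga P (3 * a) a (a - 1) (3 * a - 6).

(** The number of neighbouring blocks missed by a vertex is b - r = a - (a - 1) = 1. *)
Lemma miss_uniq B x : B \in P -> x \in B ->
  exists C, [/\ C \in N B, x \in miss Ga B C & forall D, D \in N B -> x \in miss Ga B D -> D = C].
Proof.
move=> PB Bx; have [ev eb] := params_vb hp; case: hp => _ _ hr _.
have := card_missed st hr PB Bx; rewrite eb subKn; last by lia.
case/cards1P_ex=> C /setP e.
have h D : (D \in N B) && (x \notin nbrs Ga D) = (D == C) by rewrite -in_set1 -e [RHS]in_set.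
exists C; have /andP[hC xC] : (C \in N B) && (x \notin nbrs Ga C) by rewrite h.
split=> // [|D hD]; first by rewrite in_miss Bx.
by rewrite in_miss => /andP[_ xD]; apply/eqP; rewrite -h hD.
Qed.

Lemma miss_hit B x C D : C \in N B -> D \in N B -> x \in miss Ga B C -> D != C ->
  x \in nbrs Ga D.
Proof.
move=> hC hD; rewrite in_miss => /andP[Bx xC]; have [PB _] := N_block hC.
have [E [_ _ u]] := miss_uniq PB Bx; apply: contraNT => xD.
have eD : D = E by apply: u => //; rewrite in_miss Bx.
by apply/eqP; rewrite eD; apply/esym/u => //; rewrite in_miss Bx.
Qed.

Lemma miss_inj B x C D : C \in N B -> D \in N B -> x \in miss Ga B C -> x \in miss Ga B D -> C = D.
Proof.
move=> hC hD xC xD; have [PB _] := N_block hC.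
have Bx : x \in B by move: xC; rewrite in_miss => /andP[].
have [E [_ _ u]] := miss_uniq PB Bx.
exact: (etrans (u C hC xC) (esym (u D hD xD))).
Qed.

Lemma miss_ex B C : C \in N B -> exists x, x \in miss Ga B C.
Proof. by move=> hC; apply/card_gt0P; rewrite (card_miss st hC). Qed.

(** An ordered pair (C, D) of neighbours is coded by a flag: a vertex x of B that misses C meets D,
    and x determines C. Transitivity on flags then gives transitivity on pairs. *)
Lemma three_arc_trans2 B : B \in P -> trans2_on 'P^* (stab B) (N B).
Proof.
move=> PB C D C' D' hC hD hC' hD' ne ne'.
have [[x xC] [x' xC']] := (miss_ex hC, miss_ex hC').
have [Bx Bx'] : x \in B /\ x' \in B.
  by move: xC xC'; rewrite !in_miss => /andP[-> _] /andP[-> _].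
have xD : x \in nbrs Ga D by apply: (miss_hit hC hD xC); rewrite eq_sym.
have xD' : x' \in nbrs Ga D' by apply: (miss_hit hC' hD' xC'); rewrite eq_sym.
have [[_ PD] [_ PD']] := (N_block hD, N_block hD').
have [g Gg [gx gB gD]] := flag_trans st PB PD Bx xD PB PD' Bx' xD'.
have Sg : g \in 'N_G(B | 'P)%g by apply/stabP.
exists g => //; split=> //; apply: (@miss_inj B x') => //; first exact: stabN.
by rewrite -gx -{1}gB (missG st) // mem_setactP.
Qed.

End ThreeArc.

(** Arc-transitivity of the quotient moves C to C', and the other of the two neighbours has only one
    place left. *)
Lemma cycle_trans2 B : b = 2 -> B \in P -> trans2_on 'P^* (stab B) (N B).
Proof.
move=> b2 PB C D C' D' hC hD hC' hD' ne ne'.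
have [] := quot_arc_trans st (x := B) (y := C) (x' := B) (y' := C'); rewrite -?mem_N //.
move=> g Gg [gB gC]; have Sg : g \in 'N_G(B | 'P)%g by apply/stabP.
exists g => //; split=> //; have hg := stabN Sg hD.
have eN : N B = [set C'; D'].
  apply/esym/eqP; rewrite eqEcard (card_N st PB) b2 cards2 ne' andbT.
  by apply/subsetP=> X; rewrite in_set2 => /orP[] /eqP->.
move: hg; rewrite eN in_set2 => /orP[/eqP e|/eqP //].
by move: ne; rewrite -(inj_eq (act_inj 'P^*%act g)) gC e eqxx.
Qed.

Lemma cases_arc_transitive2 :
  [\/ case_a Ga G P, case_b Ga P, case_c Ga G P
    | (exists a : nat, case_d Ga P a) \/ case_e Ga G P] ->
  arc_transitive 'P^* G GaP 2.
Proof.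
move=> h; apply: (stab_arc_transitive2 st) => B PB; case: h.
- case=> hp A4; have [ev eb] := params_vb hp; case: (hp) => _ _ hr _.
  have k1 : k = 1 by rewrite (st_kv st) ev.
  apply/(matching_trans2 k1 hr PB).
  exact: (A4_or_S4_trans2 (acts_stab_block G B) (A4 B PB)).
- by case=> hp _; have [ev eb] := params_vb hp; exact: cycle_trans2.
- case=> hp psl; apply/(fano_trans2 hp PB).
  exact: (PSL32_trans2 (acts_stab_block G B) (psl B PB)).
- case=> [[a [a3 hp]]|[hp A4]]; first exact: (three_arc_trans2 a3 hp).
  exact: (A4_or_S4_trans2 (acts_stab_N st B) (A4 B PB)).
Qed.

Lemma case_a_more : case_a Ga G P -> more_a Ga G P.
Proof.
case=> hp A4; have [ev eb] := params_vb hp; case: (hp) => _ _ hr _.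
have k1 : k = 1 by rewrite (st_kv st) ev.
split.
  move=> B PB; apply: (A4_or_S4_intro (acts_stab_N st B)); first by rewrite (card_N st PB).
  apply/(matching_trans2 k1 hr PB).
  exact: (A4_or_S4_trans2 (acts_stab_block G B) (A4 B PB)).
apply: (regular1_giso (st_simple st) (matching_regular k1 hr)).
have [B PB] := st_P0 st; have [x Bx] := block_nonempty st PB.
by apply/set0Pn; exists x; exact: (block_vert st PB Bx).
Qed.

(** The family v = 3b splits into (b) for b = 2 and (d) for b >= 3. The hypothesis supplies the
    cycle in the first case and is discharged by [quot_giso_cycle]. *)
Lemma arc_transitive2_cases : arc_transitive 'P^* G GaP 2 ->
  (b = 2 -> v = 6 -> giso GaP (cycle_graph (#|V| %/ 6))) ->
  [\/ case_a Ga G P, case_b Ga P, case_c Ga G P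
    | (exists a : nat, case_d Ga P a) \/ case_e Ga G P].
Proof.
move=> /(arc_transitive2_elim (st_simpleP st))[_ tr] cyc.
have tr2 B : trans2_on 'P^* (stab B) (N B) by exact: (arc2_trans_stab st tr).
have [r [l [hp]]] := arc2_params st tr; case=> -[].
- move=> ev eb er el; rewrite ev eb er el in hp; constructor 1; split=> // B PB.
  have k1 : k = 1 by rewrite (st_kv st) ev.
  apply: (A4_or_S4_intro (acts_stab_block G B)); first by rewrite (card_block st PB).
  by apply/(matching_trans2 k1 _ PB) => //; case: hp.
- move=> ev eb er el; rewrite ev eb er el in hp; constructor 3; split=> // B PB.
  by apply: (fano_block_PSL hp PB); apply/(fano_trans2 hp PB).
- move=> ev eb er el; rewrite ev eb er el in hp; constructor 4; right; split=> // B PB.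
  by apply: (A4_or_S4_intro (acts_stab_N st B)) => //; rewrite (card_N st PB).
move=> ev er el; have b2 := st_b_ge2 st; rewrite ev er el in hp.
have [e|ne] := eqVneq b 2.
  by constructor 2; rewrite e in hp; split=> //; apply: cyc => //; rewrite ev e.
by constructor 4; left; exists b; split=> //; lia.
Qed.

End Quotient2ArcTransitive.

(** * Case (b) *)

Lemma mem_porbitS (T : finType) (s : {perm T}) x y :
  (s x \in porbit s y) = (x \in porbit s y).
Proof. by rewrite -!eq_porbit_mem -(porbit_perm s 1 x) expg1. Qed.

Section CycleCase.
Variables (T : finType) (Ga : graph T) (G : {group {perm T}}).
Variables (P : {set {set T}}) (v k b : nat).
Hypothesis st : setting Ga G P v k b.

Local Notation V := (vert Ga).
Local Notation GaP := (quot Ga P).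
Local Notation "B ^^ g" := ('P^*%act B g) (at level 30).
Local Notation N B := (nbr GaP B).

Lemma N_act g B C : g \in G -> (C ^^ g \in N (B ^^ g)) = (C \in N B).
Proof. by move=> Gg; rewrite !mem_N (quot_adjG st). Qed.

Lemma card_vert : #|V| = #|P| * v.
Proof.
case: (st_partition st) => pt _.
by rewrite -(card_uniform_partition (n := v) _ pt) // => B PB; exact: (card_block st PB).
Qed.

Section TwoValent.
Hypothesis b2 : b = 2.

Lemma N_two B C D : C \in N B -> D \in N B -> C != D -> N B = [set C; D].
Proof.
move=> hC hD ne; have [PB _] := N_block hC.
apply/esym/eqP; rewrite eqEcard (card_N st PB) b2 cards2 ne andbT.
by apply/subsetP=> X; rewrite in_set2 => /orP[] /eqP->.
Qed.

(* The rotation g is the product of two reflections a (reversing the edge BC)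
   and t (fixing C and exchanging its neighbours). *)
Lemma rotation : exists a t B, let g := (a * t)%g in
  [/\ [/\ a \in G, t \in G & B \in P], [/\ B ^^ a = B ^^ g & B ^^ g ^^ a = B],
      [/\ B ^^ g ^^ t = B ^^ g, B ^^ t = B ^^ g ^^ g & B ^^ g ^^ g ^^ t = B],
      B != B ^^ g ^^ g
    & N (B ^^ g) = [set B; B ^^ g ^^ g]].
Proof.
have [C PC] := st_P0 st.
have : 1 < #|N C| by rewrite (card_N st PC) b2.
case/card_gt1P=> B [D [hB hD ne]].
have hC : C \in N B by rewrite (N_sym st).
have hC' : C \in N D by rewrite (N_sym st).
have [PB _] := N_block hC.
have qa := quot_arc_trans st.
have [||a Ga' [aB aC]] := qa B C C B; rewrite -?mem_N //.
have [||t Gt [tB tC]] := qa B C D C; rewrite -?mem_N //.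
have tD : D ^^ t = B.
  have : D ^^ t \in N C by rewrite -{1}tC N_act.
  rewrite (N_two hB hD ne) in_set2 => /orP[/eqP //|/eqP e].
  by move: ne; rewrite -(inj_eq (act_inj 'P^*%act t)) tB e eqxx.
have eg : B ^^ (a * t)%g = C by rewrite actM aB tC.
have eg2 : C ^^ (a * t)%g = D by rewrite actM aC tB.
exists a, t, B; rewrite /= eg eg2; split=> //.
exact: N_two.
Qed.

Section Rotation.
Variables (g : {perm T}) (B : {set T}).
Hypothesis Gg : g \in G.
Hypothesis PB : B \in P.
Hypothesis NC : N (B ^^ g) = [set B; B ^^ g ^^ g].

Local Notation s := (actperm 'P^*%act g).

Lemma rotE X : s X = X ^^ g. Proof. by rewrite actpermE. Qed.

(** Applying g or its inverse shifts the known neighbourhood of the block B^g one step along the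
    orbit. *)
Lemma rot_N X : X \in porbit s B -> N X = [set (s^-1)%g X; s X].
Proof.
have up Y : N Y = [set (s^-1)%g Y; s Y] -> N (s Y) = [set (s^-1)%g (s Y); s (s Y)].
  move=> e; apply/setP=> Z; rewrite permK -[Z](permKV s); move: ((s^-1)%g Z) => W.
  rewrite rotE rotE N_act // e !in_set2 -(inj_eq (@perm_inj _ s)) permKV.
  by rewrite -(inj_eq (@perm_inj _ s) W) !rotE.
have down Y : N Y = [set (s^-1)%g Y; s Y] ->
    N ((s^-1)%g Y) = [set (s^-1)%g ((s^-1)%g Y); s ((s^-1)%g Y)].
  move=> e; apply/setP=> Z; rewrite permKV -(N_act _ _ Gg) -!rotE permKV e !in_set2.
  by rewrite (inj_eq (@perm_inj _ s)) -[Z == _](inj_eq (@perm_inj _ s)) permKV.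
have base : N B = [set (s^-1)%g B; s B].
  have e : N (s B) = [set (s^-1)%g (s B); s (s B)] by rewrite permK !rotE.
  by have := down _ e; rewrite permK.
case/porbitP=> i ->; elim: i => [|i IH]; first by rewrite perm1.
by rewrite expgSr permM; apply: up.
Qed.

(** The orbit is closed under adjacency by [rot_N], and the quotient is connected. *)
Lemma rot_orbit : porbit s B = P.
Proof.
have sP X : (s X \in P) = (X \in P) by rewrite rotE (blockG st).
apply/setP=> X; apply/idP/idP.
  case/porbitP=> i ->; elim: i => [|i IH]; first by rewrite perm1.
  by rewrite expgSr permM sP.
move=> PX; have := st_connected st PB PX.
have cl : closed (adj GaP) (porbit s B).
  apply: intro_closed.
    by have [sy _ _] := st_simpleP st; exact: sym_connect_sym.
  move=> Y Z; rewrite -mem_N => h hY; rewrite (rot_N hY) in_set2 in h.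
  case/orP: h => /eqP->.
    by rewrite -mem_porbitS permKV.
  by rewrite mem_porbitS.
by move/(closed_connect cl) => <-; rewrite porbit_id.
Qed.

Lemma rot_giso : giso GaP (cycle_graph #|P|).
Proof.
set n := #|P|; have n0 : 0 < n by apply/card_gt0P; exists B.
pose tr := traject s B n.
have en : n = #|porbit s B| by rewrite rot_orbit.
have mtr X : (X \in tr) = (X \in P) by rewrite /tr -rot_orbit en porbit_traject.
have utr : uniq tr by rewrite /tr en; exact: uniq_traject_porbit.
have stt : size tr = n by exact: size_traject.
pose c i := iter i s B.
have cn : c n = B by rewrite /c en iter_porbit.
have ctr i : i < n -> nth B tr i = c i by move=> h; rewrite nth_traject.
case: n n0 @tr en mtr utr stt cn ctr => // n _ tr en mtr utr stt cn ctr.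
have cP i : c i \in P.
  rewrite -rot_orbit; elim: i => [|i IH]; first exact: porbit_id.
  by rewrite /= mem_porbitS.
pose f X : 'I_n.+1 := inord (index X tr).
have fc i : i < n.+1 -> f (c i) = i :> nat.
  move=> h; rewrite /f inordK -?ctr // ?index_uniq ?stt //.
have fP X : X \in P -> X = c (f X).
  move=> PX; have := PX; rewrite -mtr => h.
  have lt : index X tr < n.+1 by rewrite -stt index_mem.
  by rewrite /f inordK // -ctr // nth_index.
have nxt X : X \in P -> s X = c (ordS (f X)).
  move=> PX; rewrite {1}(fP _ PX) -[s _]/(c (f X).+1) /=.
  (* The last index wraps to 0, because n is the length of the orbit and so the n-th iterate returns
     to B. *)
  have := ltn_ord (f X); rewrite leq_eqVlt ltnS => /orP[/eqP e|lt].
    have -> : (f X).+1 %% n.+1 = 0 by rewrite e modnn.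
    exact: (etrans (congr1 c e) cn).
  by rewrite modn_small.
have adjE X Y : X \in P -> Y \in P -> adj GaP X Y = (s X == Y) || (s Y == X).
  move=> PX PY; rewrite -mem_N rot_N ?rot_orbit // in_set2 orbC eq_sym; congr (_ || _).
  by rewrite -[Y == _](inj_eq (@perm_inj _ s)) permKV.
have injc i j : i < n.+1 -> j < n.+1 -> (c i == c j) = (i == j).
  move=> hi hj; apply/eqP/eqP=> [e|-> //].
  by rewrite -(fc i) // e fc.
exists f; split=> /=.
- by move=> X Y PX PY e; rewrite (fP X PX) e -fP.
- apply/setP=> i; rewrite [RHS]inE; apply/imsetP; exists (c i) => //.
  by apply: ord_inj; rewrite fc.
move=> X Y PX PY; rewrite -[RHS]/(adj GaP X Y) adjE //.
have sE Z W : Z \in P -> W \in P -> (s Z == W) = (ordS (f Z) == f W).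
  by move=> PZ PW; rewrite nxt // {1}(fP W PW) injc.
rewrite -!sE //; case: eqP => //= e; apply/esym/negbTE.
have eXY : X = Y by rewrite (fP X PX) (fP Y PY) e.
have [_ irr _] := st_simpleP st; have := irr X.
by rewrite adjE // -eXY => ->.
Qed.

End Rotation.

Lemma quot_giso_cycle : giso GaP (cycle_graph #|P|).
Proof.
have [a [t [B /= [[Ga' Gt PB] _ _ _ NC]]]] := rotation.
by apply: (rot_giso _ PB NC); exact: groupM.
Qed.

End TwoValent.

End CycleCase.

Section CycleCaseMore.
Variables (T : finType) (Ga : graph T) (G : {group {perm T}}).
Variables (P : {set {set T}}) (v k b : nat).
Hypothesis st : setting Ga G P v k b.
Hypothesis b2 : b = 2.

Local Notation V := (vert Ga).
Local Notation GaP := (quot Ga P).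
Local Notation "B ^^ g" := ('P^*%act B g) (at level 30).
Local Notation N B := (nbr GaP B).
Local Notation K := ('C_G(P | 'P^*))%g.

(** With valency 2, an element fixing a block and one of its neighbours fixes the other neighbour;
    repeat along the orbit. *)
Lemma fixes_edge_trivial g B h :
    g \in G -> B \in P -> N (B ^^ g) = [set B; B ^^ g ^^ g] ->
    h \in G -> B ^^ h = B -> B ^^ g ^^ h = B ^^ g -> h \in K.
Proof.
move=> Gg PB NC Gh hB hC; pose s := actperm 'P^*%act g.
have rn := rot_N st Gg NC; have ro := rot_orbit st Gg PB NC.
rewrite inE Gh; apply/astabP=> X; rewrite -ro => /porbitP[i ->].
suff [] : ((s ^+ i)%g B ^^ h = (s ^+ i)%g B) /\ (s ((s ^+ i)%g B) ^^ h = s ((s ^+ i)%g B)) by [].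
elim: i => [|i [IH1 IH2]]; first by rewrite perm1 rotE.
rewrite expgSr permM; split=> //.
have Os : s ((s ^+ i)%g B) \in porbit s B by rewrite mem_porbitS mem_porbit.
set Y := (s ^+ i)%g B in IH1 IH2 Os *.
have eN := rn _ Os; rewrite permK in eN.
have sY : s (s Y) \in N (s Y) by rewrite eN in_set2 eqxx orbT.
have : s (s Y) ^^ h \in N (s Y) by rewrite -[X in N X]IH2 (N_act st).
rewrite eN in_set2 => /orP[/eqP e|/eqP //].
have eY : s (s Y) = Y by apply: (act_inj 'P^*%act h); rewrite e.
by rewrite e eY.
Qed.

(** Orbit and stabiliser twice: #|P| blocks, then two neighbours of B; what fixes an edge of the
    quotient at both ends is the kernel. *)
Lemma card_quot_group : #|G / K|%g = (2 * #|P|)%N.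
Proof.
have [a [t [B]]] := rotation st b2; set g := (a * t)%g.
case=> [[Ga' Gt PB] _ _ _ NC]; have Gg : g \in G by exact: groupM.
have nK : (G \subset 'N(K))%g.
  rewrite normsI ?normG // (subset_trans _ (astab_norm _ _)) //.
  by case: (st_partition st).
rewrite card_quotient // -divgS ?subsetIl //.
have hC : B ^^ g \in N B by rewrite (N_sym st) NC in_set2 eqxx.
have oP : orbit 'P^* G B = P.
  apply/setP=> X; apply/orbitP/idP=> [[h Gh <-]|PX]; first by rewrite (blockG st).
  by have [h Gh e] := quot_vertex_trans st PB PX; exists h.
have oN : orbit 'P^* 'C_G[B | 'P^*]%g (B ^^ g) = N B.
  apply/setP=> X; apply/orbitP/idP=> [[h /setIP[Gh /astab1P hB] <-]|hX].
    by rewrite -[X in N X]hB (N_act st).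
  have [] := quot_arc_trans st (x := B) (y := B ^^ g) (x' := B) (y' := X); rewrite -?mem_N //.
  by move=> h Gh [hB hC']; exists h => //; rewrite inE Gh; apply/astab1P.
have eK : ('C_('C_G[B | 'P^*])[B ^^ g | 'P^*] = K)%g.
  apply/setP=> h; apply/idP/idP.
    case/setIP=> /setIP[Gh /astab1P hB] /astab1P hC'.
    exact: (fixes_edge_trivial Gg PB NC).
  case/setIP=> Gh /astabP hP; rewrite !inE Gh /= !sub1set !inE hP //= eqxx.
  by rewrite hP ?eqxx // (blockG st).
have := card_orbit_stab 'P^*%act G B; rewrite oP => <-.
have := card_orbit_stab 'P^*%act 'C_G[B | 'P^*]%G (B ^^ g); rewrite oN eK => <-.
rewrite (card_N st PB) b2 mulnA mulnK ?cardG_gt0 //; exact: mulnC.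
Qed.

(** The two reflections a and t become distinct involutions that generate G modulo the kernel, and a
    group generated by two distinct involutions is dihedral. *)
Lemma quot_group_dihedral : ((G / K) \isog 'D_(2 * #|P|)%N)%g.
Proof.
rewrite -card_quot_group.
have [a [t [B]]] := rotation st b2; set g := (a * t)%g.
case=> [[Ga' Gt PB] [aB aC] [tC tB tD] nBD NC]; have Gg : g \in G by exact: groupM.
have nK : (G \subset 'N(K))%g.
  rewrite normsI ?normG // (subset_trans _ (astab_norm _ _)) //.
  by case: (st_partition st).
have hC : B ^^ g \in N B by rewrite (N_sym st) NC in_set2 eqxx.
have nBC := N_irr hC.
have fixK := fixes_edge_trivial Gg PB NC.
have inK h X : h \in K -> X \in P -> X ^^ h = X by case/setIP=> _ /astabP; apply.
pose x := coset K a; pose y := coset K t.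
have nN h : h \in G -> h \in 'N(K)%g by move=> Gh; rewrite (subsetP nK).
have PC : B ^^ g \in P by rewrite (blockG st).
have ox : #[x]%g = 2.
  apply: nt_prime_order => //.
    rewrite /x -morphX ?nN //; apply: coset_id.
    apply: fixK; [exact: groupX|by rewrite expgS expg1 actM aB aC|].
    by rewrite expgS expg1 [LHS]actM aC aB.
  apply/eqP=> /coset_idr - /(_ (nN _ Ga')) /inK - /(_ _ PB) e.
  by move: nBC; rewrite -aB e eqxx.
have oy : #[y]%g = 2.
  apply: nt_prime_order => //.
    rewrite /y -morphX ?nN //; apply: coset_id.
    apply: fixK; [exact: groupX|by rewrite expgS expg1 actM tB tD|].
    by rewrite expgS expg1 [LHS]actM !tC.
  apply/eqP=> /coset_idr - /(_ (nN _ Gt)) /inK - /(_ _ PB) e.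
  by move: nBD; rewrite -tB e eqxx.
have xy : x != y.
  apply/eqP=> /(rcoset_kercosetP (nN _ Ga') (nN _ Gt)) /rcosetP[h Kh e].
  have hB : B ^^ a = B ^^ t by rewrite e actM (inK h).
  have : B ^^ g ^^ g \in N (B ^^ g) by rewrite NC in_set2 eqxx orbT.
  by move/N_irr; rewrite -tB -hB aB eqxx.
(* Up to a power of the rotation g, an element of G fixes B; it then sends the block B^g either to
   itself or to the other neighbour of B. *)
have gen : (<<[set x; y]>> = G / K)%g.
  have sx : (x \in <<[set x; y]>>)%g by rewrite mem_gen ?inE ?eqxx.
  have sy : (y \in <<[set x; y]>>)%g by rewrite mem_gen ?inE ?eqxx ?orbT.
  apply/eqP; rewrite eqEsubset gen_subG; apply/andP; split.
    by apply/subsetP=> u; rewrite in_set2 => /orP[] /eqP->; rewrite mem_quotient.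
  apply/subsetP=> u /morphimP[h _ Gh ->{u}].
  have qg : coset K g = (x * y)%g by rewrite morphM ?nN.
  have ro := rot_orbit st Gg PB NC.
  have : B ^^ h \in porbit (actperm 'P^*%act g) B by rewrite ro (blockG st).
  case/porbitP=> i; rewrite -morphX ?inE // actpermE => hi.
  have Ggi : (g ^- i)%g \in G by rewrite groupV groupX.
  pose h' := (h * g ^- i)%g; have Gh' : h' \in G by exact: groupM.
  have eh : h = (h' * g ^+ i)%g by rewrite mulgKV.
  have qi : (coset K (g ^+ i) \in <<[set x; y]>>)%g.
    by rewrite (morphX (coset_morphism K) _ (nN _ Gg)); apply: groupX; rewrite /= qg groupM.
  suff qh : (coset K h' \in <<[set x; y]>>)%g.
    by rewrite eh (morphM (coset_morphism K)) ?nN ?groupX //= groupM.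
  have hB : B ^^ h' = B by rewrite actM hi actK.
  have : B ^^ g ^^ h' \in N B by rewrite -[X in N X]hB (N_act st).
  have rn := rot_N st Gg NC (porbit_id _ _); rewrite rn in_set2 => /orP[] /eqP e.
    have e' : B ^^ g ^^ h' = B ^^ (g^-1)%g by rewrite e -morphV ?inE // actpermE.
    (* This reflection fixes B and exchanges its two neighbours, so h' agrees with it modulo K. *)
    pose w := (a * g^-1)%g; have Gw : w \in G by rewrite groupM ?groupV.
    have Kw : (h' * w^-1)%g \in K.
      apply: fixK; first by rewrite groupM ?groupV.
        rewrite actM hB; apply: (act_inj 'P^*%act w).
        by rewrite actKV actM aB actK.
      rewrite actM e'; apply: (act_inj 'P^*%act w).
      by rewrite actKV actM aC.
    have -> : coset K h' = coset K w.
      by apply/rcoset_kercosetP; rewrite ?nN // mem_rcoset.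
    have -> : coset K w = (x * (x * y)^-1)%g.
      by rewrite (morphM (coset_morphism K)) ?nN ?groupV // (morphV (coset_morphism K)) ?nN //= qg.
    by rewrite groupM // groupV groupM.
  rewrite coset_id // fixK // e; exact: rotE.
have := involutions_gen_dihedral ox oy xy; cbv zeta.
by rewrite gen.
Qed.

Section Components.
Hypothesis hp : params Ga P 6 2 1 0.

Let v6 : v = 6. Proof. by have [] := params_vb st hp. Qed.
Let k3 : k = 3. Proof. by rewrite (st_kv st) v6. Qed.

(** As r = 1, this is the edge of the quotient formed by the block of x and the one block it meets.
    Its fibres are the vertex sets of the graphs between adjacent blocks, with 3 + 3 vertices. *)
Definition edge_of x := pblock P x |: blocks_at Ga P x.

Lemma hit_block x B C D : C \in N B -> D \in N B -> x \in hit Ga B C -> x \in hit Ga B D -> C = D.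
Proof.
case: hp => _ _ hr _ hC hD xC xD; have [PB _] := N_block hC.
have Bx : x \in B by move: xC; rewrite in_hit => /andP[].
have [E [_ _ u]] := matching_block st hr PB Bx.
exact: (etrans (u C hC xC) (esym (u D hD xD))).
Qed.

Lemma edge_ofE x B C : C \in N B -> x \in hit Ga B C -> edge_of x = [set B; C].
Proof.
move=> hC xC; have [PB PC] := N_block hC.
have := xC; rewrite in_hit => /andP[Bx xn].
have [/and3P[_ ti _] _] := st_partition st.
rewrite /edge_of (def_pblock ti PB Bx) (blocks_atE st PB Bx); congr (_ |: _).
apply/setP=> D; rewrite in_set in_set1; apply/andP/eqP=> [[hD xD]|-> //].
by apply: (hit_block hD hC (x := x)); rewrite // in_hit Bx.
Qed.

Lemma vert_hit x : x \in V -> exists B C, C \in N B /\ x \in hit Ga B C.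
Proof.
move=> Vx; have [B PB Bx] := block_of st Vx; case: hp => _ _ hr _.
by have [C [hC xC _]] := matching_block st hr PB Bx; exists B, C.
Qed.

Lemma edge_fiber B C : C \in N B ->
  [set x in V | edge_of x == [set B; C]] = hit Ga B C :|: hit Ga C B.
Proof.
move=> hC; have hB : B \in N C by rewrite -(N_sym st).
have [PB PC] := N_block hC.
apply/setP=> x; rewrite in_setU inE; apply/andP/orP.
  case=> Vx /eqP; have [D [E [hE xE]]] := vert_hit Vx; rewrite (edge_ofE hE xE) => e.
  have nBC := N_irr hC; have nDE := N_irr hE.
  have : D \in [set B; C] by rewrite -e in_set2 eqxx.
  have : E \in [set B; C] by rewrite -e in_set2 eqxx orbT.
  rewrite !in_set2 => /orP[] /eqP eE /orP[] /eqP eD; subst D E.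
  - by rewrite eqxx in nDE.
  - by right.
  - by left.
  - by rewrite eqxx in nDE.
case=> h.
  split; last by rewrite (edge_ofE hC h).
  by move: h; rewrite in_hit => /andP[Bx _]; exact: (block_vert st PB Bx).
split; last by rewrite (edge_ofE hB h) setUC.
by move: h; rewrite in_hit => /andP[Cx _]; exact: (block_vert st PC Cx).
Qed.

Lemma adj_hit x y B C : C \in N B -> x \in hit Ga B C -> adj Ga x y -> y \in hit Ga C B.
Proof.
move=> hC xC a; have [PB _] := N_block hC; have := xC; rewrite in_hit => /andP[Bx _].
have [_ Vy] := adj_vert st a; have [D PD Dy] := block_of st Vy.
have hD := edge_blocks st a PB PD Bx Dy.
have <- : D = C.
  apply: (hit_block hD hC (x := x)) => //; rewrite in_hit Bx.
  by apply/nbrsP; exists y; rewrite // (st_adjC st).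
by rewrite in_hit Dy; apply/nbrsP; exists x.
Qed.

Lemma st_regular : exists2 d, regular Ga d & 0 < d.
Proof.
have [tv _ [x0 [y0 a0]]] := st_trans st; have [Vx0 _] := adj_vert st a0.
exists #|nbr Ga x0|; last by apply/card_gt0P; exists y0; rewrite inE.
move=> x Vx; have [g Gg gx] := tv _ _ Vx0 Vx; have {}gx : g x0 = x by [].
rewrite -[RHS](card_imset _ (@perm_inj _ g)); congr #|pred_of_set _|.
apply/setP=> y; rewrite inE -gx -(permKV g y) (adjG st) //.
by rewrite (mem_imset _ _ (@perm_inj _ g)) inE.
Qed.

(** Each fibre of [edge_of] carries a bipartite graph on 3 + 3 vertices, regular of degree d. For d
    = 1 the whole graph is a matching, for d = 2 each fibre is a hexagon, for d = 3 a complete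
    bipartite graph. *)
Lemma cycle_case_graph : let n := #|V| %/ 6 in
  [\/ giso Ga (copies (3 * n) (Kgraph 2)), giso Ga (copies n (cycle_graph 6))
    | giso Ga (copies n (Kbip 3 3))].
Proof.
have [d hd d0] := st_regular.
have V0 : V != set0.
  have [B PB] := st_P0 st; have [x Bx] := block_nonempty st PB.
  by apply/set0Pn; exists x; exact: (block_vert st PB Bx).
have cV : #|V| = #|P| * 6 by rewrite (card_vert st) v6.
have eJ j : j \in edge_of @: V -> exists B C, C \in N B /\ j = [set B; C].
  case/imsetP=> x Vx ->; have [B [C [hC xC]]] := vert_hit Vx.
  by exists B, C; rewrite (edge_ofE hC xC).
have cE : #|V| %/ 6 = #|edge_of @: V|.
  rewrite (@card_fibers _ _ V edge_of 6) ?mulnK // => j /eJ[B [C [hC ->]]].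
  have hB : B \in N C by rewrite -(N_sym st).
  rewrite edge_fiber // cardsU disjoint_setI0 ?(disjoint_hit st) // cards0 subn0.
  by rewrite (card_hit st hC) (card_hit st hB) k3.
have ae : {in V &, forall x y, adj Ga x y -> edge_of x = edge_of y}.
  move=> x y Vx Vy a; have [B [C [hC xC]]] := vert_hit Vx.
  have hB : B \in N C by rewrite -(N_sym st).
  by rewrite (edge_ofE hC xC) (edge_ofE hB (adj_hit hC xC a)) setUC.
have nb x B C : C \in N B -> x \in hit Ga B C ->
    [set y in hit Ga C B | adj Ga x y] = nbr Ga x.
  move=> hC xC; apply/setP=> y; rewrite in_set [in RHS]in_set.
  by apply/andP/idP=> [[]//|a]; split=> //; exact: (adj_hit hC xC a).
have vh x B C : C \in N B -> x \in hit Ga B C -> x \in V.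
  by move=> hC; rewrite in_hit => /andP[Bx _]; have [PB _] := N_block hC; exact: (block_vert st PB Bx).
have d3 : d <= 3.
  case/set0Pn: V0 => x Vx; have [B [C [hC xC]]] := vert_hit Vx.
  have hB : B \in N C by rewrite -(N_sym st).
  rewrite -(hd x Vx) -(nb _ _ _ hC xC) -k3 -(card_hit st hB) subset_leq_card //.
  by apply/subsetP=> y; rewrite in_set => /andP[].
have non x B C : C \in N B -> x \in hit Ga B C -> #|[set y in hit Ga C B | ~~ adj Ga x y]| = 3 - d.
  move=> hC xC; have hB : B \in N C by rewrite -(N_sym st).
  by rewrite card_compl_in (nb _ _ _ hC xC) (hd x (vh _ _ _ hC xC)) (card_hit st hB) k3.
case: d d3 d0 hd non => [|[|[|[|//]]]] // _ _ hd non /=.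
- constructor 1; have := regular1_giso (st_simple st) hd V0.
  by rewrite (_ : #|V| %/ 2 = 3 * (#|V| %/ 6)) // cV mulnK // (mulnA _ 3 2) mulnK // mulnC.
- constructor 2; rewrite cE; apply: giso_copies => // [|j /eJ[B [C [hC ->]]]].
    exact: (Ordinal (isT : 0 < 6)).
  have hB : B \in N C by rewrite -(N_sym st).
  rewrite edge_fiber //; apply: giso_trans bip3_giso_C6; apply: giso_bip_minus.
  + exact: (st_adjC st).
  + exact: (disjoint_hit st).
  + by rewrite (card_hit st hC) k3.
  + by rewrite (card_hit st hB) k3.
  + exact: (indep_hit st).
  + exact: (indep_hit st).
  + by move=> x xC; rewrite (non _ _ _ hC xC).
  + move=> y yB; rewrite -[RHS](non y _ _ hB yB); congr #|pred_of_set _|.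
    by apply/setP=> z; rewrite !in_set (st_adjC st).
constructor 3; rewrite cE; apply: giso_copies => // [|j /eJ[B [C [hC ->]]]].
  exact: (inl ord0).
have hB : B \in N C by rewrite -(N_sym st).
rewrite edge_fiber //; apply: giso_bip_full.
- exact: (st_adjC st).
- exact: (disjoint_hit st).
- by rewrite (card_hit st hC) k3.
- by rewrite (card_hit st hB) k3.
- exact: (indep_hit st).
- exact: (indep_hit st).
move=> x y xC yB; apply: contraT => na.
have := non _ _ _ hC xC; rewrite subnn => /eqP; rewrite cards_eq0 => /eqP/setP/(_ y).
by rewrite in_set yB na in_set0.
Qed.

Lemma case_b_more : more_b Ga G P.
Proof.
rewrite /more_b; split; first exact: cycle_case_graph.
have -> : #|V| %/ 6 = #|P| by rewrite (card_vert st) v6 mulnK.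
exact: quot_group_dihedral.
Qed.

End Components.

End CycleCaseMore.

(** * Case (c) *)

(** Only neighbours in [vert] are counted, since [is_giso] constrains nothing outside the vertex
    sets. *)
Definition degree_in (T : finType) (Ga : graph T) x := #|[set y in vert Ga | adj Ga x y]|.

Lemma is_giso_degree (T S : finType) (Ga : graph T) (Si : graph S) f x :
  is_giso Ga Si f -> x \in vert Ga -> degree_in Si (f x) = degree_in Ga x.
Proof.
move=> [inj im ad] Vx; rewrite /degree_in -[RHS](card_in_imset (f := f)); last first.
  by move=> y z; rewrite !inE => /andP[Vy _] /andP[Vz _]; exact: inj.
congr #|pred_of_set _|; apply/setP=> z; rewrite in_set; apply/andP/imsetP.
  case; rewrite -im => /imsetP[y Vy ->]; rewrite ad // => a.
  by exists y => //; rewrite inE Vy.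
case=> y; rewrite inE => /andP[Vy a] ->; split; last by rewrite ad.
by rewrite -im; exact: imset_f.
Qed.

Lemma degree_nK2 n (p : 'I_n * 'I_2) : degree_in (copies n (Kgraph 2)) p = 1.
Proof.
rewrite /degree_in; apply/eqP/cards1P; exists (p.1, rev_ord p.2).
apply/setP=> -[i j]; rewrite !inE /= xpair_eqE eq_sym; congr (_ && _).
by case: p => [i0 [[|[|//]] ?]]; case: j => [[|[|//]] ?]; rewrite -!val_eqE.
Qed.

Lemma degree_Kbip n u : degree_in (Kbip n n) u = n.
Proof.
rewrite /degree_in -[RHS]card_ord -cardsT; case: u => i.
  rewrite -(card_imset _ (@inr_inj 'I_n 'I_n)); congr #|pred_of_set _|.
  apply/setP=> -[] j; rewrite !inE; last by rewrite imset_f.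
  by apply/esym/imsetP=> -[].
rewrite -(card_imset _ (@inl_inj 'I_n 'I_n)); congr #|pred_of_set _|.
apply/setP=> -[] j; rewrite !inE; first by rewrite imset_f.
by apply/esym/imsetP=> -[].
Qed.

Lemma degree_del_matching n m (M : graph ('I_n + 'I_n)%type) u :
  spanning_sub M (Kbip n n) -> giso M (copies m (Kgraph 2)) ->
  degree_in (del_edges (Kbip n n) M) u = n - 1.
Proof.
move=> [vM sM] [f isof].
have Vu : u \in vert M by rewrite vM inE.
have dM := is_giso_degree isof Vu; rewrite degree_nK2 in dM.
have := card_compl_in [set y | adj (Kbip n n) u y] (adj M u).
rewrite (_ : #|[set y | adj (Kbip n n) u y]| = n); last first.
  by rewrite -[RHS](degree_Kbip u); congr #|pred_of_set _|; apply/setP=> y; rewrite !inE.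
rewrite [in X in _ - X](_ : [set x in _ | _] = [set y in vert M | adj M u y]); last first.
  apply/setP=> y; rewrite in_set [in RHS]in_set vM !in_set.
  by case: (boolP (adj M u y)) => [/sM ->|]; rewrite ?andbF.
rewrite -[#|[set y in vert M | _]|]/(degree_in M u) -dM => <-.
by congr #|pred_of_set _|; apply/setP=> y; rewrite !inE.
Qed.

Lemma K44_minus (T : finType) (Si : graph T) :
  giso Si (bip_graph (fun i j : 'I_4 => i != j)) -> iso_K44_minus_4K2 Si.
Proof.
move=> iso; pose R (i j : 'I_4) := i == j; exists (bip_graph R); split.
- by split=> // -[] i [] j.
- have c4 : #|vert (bip_graph R)| %/ 2 = 4 by rewrite cardsT card_sum card_ord.
  suff : giso (bip_graph R) (copies (#|vert (bip_graph R)| %/ 2) (Kgraph 2)) by rewrite c4.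
  apply: regular1_giso.
  + split=> [[i|i] [j|j]|[]|x y _] //; exact: in_setT.
  + move=> [i|i] _; apply/eqP/cards1P.
      by exists (inr i); apply/setP=> -[] j; rewrite !inE //= /R eq_sym.
    by exists (inl i); apply/setP=> -[] j; rewrite !inE.
  + by apply/set0Pn; exists (inl ord0); exact: in_setT.
apply: (giso_trans iso); exists id; split=> //; first by rewrite imset_id.
by move=> [] i [] j.
Qed.

Section FanoCaseMore.
Variables (T : finType) (Ga : graph T) (G : {group {perm T}}).
Variables (P : {set {set T}}) (v k b : nat).
Hypothesis st : setting Ga G P v k b.
Hypothesis hp : params Ga P 7 7 4 2.

Local Notation V := (vert Ga).
Local Notation GaP := (quot Ga P).
Local Notation "B ^^ g" := ('P^*%act B g) (at level 30).
Local Notation stab B := ('N_G(B | 'P)%G).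
Local Notation N B := (nbr GaP B).

Hypothesis tr2 : forall B, B \in P -> trans2_on 'P (stab B) B.

Let v7 : v = 7. Proof. by have [] := params_vb st hp. Qed.
Let k4 : k = 4. Proof. by rewrite (st_kv st) v7. Qed.

Let tr2N B : B \in P -> trans2_on 'P^* (stab B) (N B).
Proof. by move=> PB; apply/(fano_trans2 st hp PB); exact: tr2. Qed.

(** An element of the kernel fixes every block, so x and its image in B lie on the same lines; two
    lines through x have no other common point. *)
Lemma fano_faithful : [faithful G, on P | 'P^*].
Proof.
apply/subsetP=> g /setIP[Gg /astabP gP]; rewrite inE; apply/eqP/permP=> x; rewrite perm1.
have [Vx|nVx] := boolP (x \in V); last first.
  have := subsetP (st_aut st) _ Gg; rewrite inE => /andP[pg _].
  exact: (out_perm pg nVx).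
have [B PB Bx] := block_of st Vx; have F := fano_block st hp PB.
apply/eqP; apply: contraT => ne.
have gB : g x \in B by rewrite -[B](gP B PB) mem_setactP.
have : 1 < #|[set C in N B | x \notin nbrs Ga C]| by rewrite (fano_pencil F Bx).
case/card_gt1P=> C [D []]; rewrite in_set => /andP[hC xC]; rewrite in_set => /andP[hD xD] /eqP CD.
have [[_ PC] [_ PD]] := (N_block hC, N_block hD).
have mv E : E \in P -> x \notin nbrs Ga E -> g x \notin nbrs Ga E.
  by move=> PE; rewrite -{2}(gP E PE) (nbrsG st).
case: CD; apply: (fano_meet_uniq F gB Bx hC hD); rewrite ?mv //.
Qed.

Lemma flag_degree : exists d, [/\ 0 < d, d <= 4 & forall B C x, C \in N B -> x \in hit Ga B C ->
  #|[set y in C | adj Ga x y]| = d].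
Proof.
have [B PB] := st_P0 st.
have /card_gt0P[C hC] : 0 < #|N B| by rewrite (card_N st PB) (leq_trans _ (st_b_ge2 st)).
have [x Bx xC] := N_flag st hC; have [_ PC] := N_block hC.
exists #|[set y in C | adj Ga x y]|; split.
- case/nbrsP: xC => y Cy a; apply/card_gt0P; exists y.
  by rewrite inE Cy (st_adjC st).
- have hB : B \in N C by rewrite -(N_sym st).
  rewrite -k4 -(card_hit st hB) subset_leq_card //; apply/subsetP=> y.
  by rewrite !inE => /andP[-> a]; apply/nbrsP; exists x.
move=> B' C' x' hC'; rewrite in_hit => /andP[Bx' xC']; have [PB' PC'] := N_block hC'.
have [g Gg [gx gB gC]] := flag_trans st PB PC Bx xC PB' PC' Bx' xC'.
rewrite -[RHS](card_imset _ (@perm_inj _ g)); congr #|pred_of_set _|.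
apply/setP=> y; rewrite inE -gC -gx -(permKV g y) mem_setactP (adjG st) //.
by rewrite (mem_imset _ _ (@perm_inj _ g)) inE.
Qed.

Section Degree.
Variable d : nat.
Hypothesis hd : forall B C x, C \in N B -> x \in hit Ga B C ->
  #|[set y in C | adj Ga x y]| = d.

(** The four points of B that meet C are the points off a line, and the stabiliser of that line is
    2-transitive on them. So any two of them have the same number c of common neighbours in C.
    Counting paths of length 2 from x through C gives 3 c = d (d - 1), impossible for d = 2. *)
Lemma degree_neq2 : d <> 2.
Proof.
move=> d2; have [B PB] := st_P0 st.
have /card_gt0P[C hC] : 0 < #|N B| by rewrite (card_N st PB) (leq_trans _ (st_b_ge2 st)).
have hB : B \in N C by rewrite -(N_sym st).
have : 1 < #|hit Ga B C| by rewrite (card_hit st hC) k4.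
case/card_gt1P=> x [x1 [xC x1C ne1]].
pose c := #|[set y in C | adj Ga x y && adj Ga x1 y]|.
have F := fano_block st hp PB.
have cP z : z \in hit Ga B C :\ x -> #|[set y in [set y in C | adj Ga x y] | adj Ga z y]| = c.
  rewrite in_setD1 => /andP[zx zC]; rewrite eq_sym in zx.
  have /andP[Bx nx] : (x \in B) && (x \in nbrs Ga C) by rewrite -in_hit.
  have /andP[Bx1 nx1] : (x1 \in B) && (x1 \in nbrs Ga C) by rewrite -in_hit.
  have /andP[Bz nz] : (z \in B) && (z \in nbrs Ga C) by rewrite -in_hit.
  have [||||h Sh [hC' hx hz]] := fano_affine_trans2 F (acts_stab_block G B) (acts_stab_N st B)
    (@fano_block_act _ _ _ _ _ _ _ st B) (tr2 PB) hC Bx Bx1 Bx Bz _ _ _ _ ne1 zx;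
    rewrite ?negbK //.
  have /stabP[Gh _] := Sh; have {}hx : h x = x by []. have {}hz : h x1 = z by [].
  rewrite /c -[RHS](card_imset _ (@perm_inj _ h)); congr #|pred_of_set _|.
  apply/setP=> y; rewrite -(permKV h y); move: ((h^-1)%g y) => w.
  rewrite (mem_imset _ _ (@perm_inj _ h)) !in_set.
  have -> : (h w \in C) = (w \in C) by rewrite -{1}hC' mem_setactP.
  have -> : adj Ga x (h w) = adj Ga x w by rewrite -{1}hx (adjG st).
  have -> : adj Ga z (h w) = adj Ga x1 w by rewrite -hz (adjG st).
  by rewrite andbA.
have := double_count (hit Ga B C :\ x) [set y in C | adj Ga x y] (adj Ga).
rewrite (eq_bigr _ cP) sum_nat_const.
have -> : #|hit Ga B C :\ x| = 3.
  by have := cardsD1 x (hit Ga B C); rewrite xC (card_hit st hC) k4 => -[].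
have -> : \sum_(y in [set y in C | adj Ga x y]) #|[set z in hit Ga B C :\ x | adj Ga z y]| =
          \sum_(y in [set y in C | adj Ga x y]) 1.
  apply: eq_bigr => y; rewrite in_set => /andP[Cy a].
  have yB : y \in hit Ga C B.
    by rewrite in_hit Cy; apply/nbrsP; exists x => //; move: xC; rewrite in_hit => /andP[].
  have := cardsD1 x [set z in B | adj Ga y z]; rewrite (hd hB yB) d2.
  rewrite in_set (st_adjC st) a; have -> : x \in B by move: xC; rewrite in_hit => /andP[].
  rewrite add1n => -[->]; congr #|pred_of_set _|; apply/setP=> z.
  rewrite in_set !in_setD1 in_hit in_set (st_adjC st) -andbA; congr (_ && _).
  rewrite -andbA; congr (_ && _); apply/andP/idP=> [[]//|a']; split=> //.
  by apply/nbrsP; exists y.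
rewrite sum_nat_const (hd hC xC) d2; lia.
Qed.

Lemma between_hit B C : between Ga B C = induced Ga (hit Ga B C :|: hit Ga C B).
Proof.
rewrite /between; congr (induced _ (_ :|: _)); apply/setP=> x; by rewrite in_setI in_hit.
Qed.

Lemma hit_adj B C x : C \in N B -> x \in hit Ga B C ->
  [set y in hit Ga C B | adj Ga x y] = [set y in C | adj Ga x y].
Proof.
move=> hC; rewrite in_hit => /andP[Bx _]; apply/setP=> y; rewrite !in_set -andbA.
congr (_ && _); apply/andP/idP=> [[]//|a]; split=> //.
by apply/nbrsP; exists x.
Qed.

Lemma between_degree B C x : C \in N B -> x \in hit Ga B C -> degree_in (between Ga B C) x = d.
Proof.
move=> hC xC; rewrite -(hd hC xC) -(hit_adj hC xC) between_hit /degree_in.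
congr #|pred_of_set _|; apply/setP=> y; rewrite 3!in_set /= !in_setU xC /=.
have [yC|] := boolP (y \in hit Ga B C); last by rewrite andbA andbb.
by rewrite (negPf (indep_hit st hC xC yC)) !andbF.
Qed.

Lemma between_regular B C : C \in N B -> simple_graph (between Ga B C) /\ regular (between Ga B C) d.
Proof.
move=> hC; have hB : B \in N C by rewrite -(N_sym st).
rewrite between_hit; split.
  split=> [x y|x|x y] /=; last by case/and3P.
    by rewrite (st_adjC st) andbCA.
  by rewrite (st_irr st) !andbF.
have half X Y x : Y \in N X -> x \in hit Ga X Y -> #|[set y | [&& x \in hit Ga X Y :|: hit Ga Y X,
    y \in hit Ga X Y :|: hit Ga Y X & adj Ga x y]]| = d.
  move=> hY xY; rewrite -(between_degree hY xY) between_hit /degree_in /=.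
  move: (hit Ga X Y :|: hit Ga Y X) => A; congr #|pred_of_set _|.
  by apply/setP=> y; rewrite !in_set; case: (x \in A); case: (y \in A).
move=> x /setUP[xC|xB]; first exact: (half B C x hC xC).
by rewrite /nbr /= setUC; exact: (half C B x hB xB).
Qed.

Lemma between_non B C x : C \in N B -> x \in hit Ga B C ->
  #|[set y in hit Ga C B | ~~ adj Ga x y]| = 4 - d.
Proof.
move=> hC xC; have hB : B \in N C by rewrite -(N_sym st).
by rewrite card_compl_in (hit_adj hC xC) (hd hC xC) (card_hit st hB) k4.
Qed.

Lemma between_iso : 0 < d -> d <= 4 ->
  [\/ all_between Ga P (@iso_4K2 T), all_between Ga P (@iso_K44_minus_4K2 T)
    | all_between Ga P (@iso_K44 T)].
Proof.
move=> d0 d4; have := degree_neq2.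
have : [\/ d = 1, d = 2, d = 3 | d = 4].
  by case: d d0 d4 => [|[|[|[|[|]]]]] // _ _; constructor.
case=> ed //; [move=> _; constructor 1|move=> _; constructor 2|move=> _; constructor 3];
  move=> B C; rewrite -mem_N => hC; have hB : B \in N C by rewrite -(N_sym st).
- have [sb rb] := between_regular hC; rewrite ed in rb.
  have c4 : #|vert (between Ga B C)| %/ 2 = 4.
    rewrite between_hit /= cardsU disjoint_setI0 ?(disjoint_hit st) // cards0 subn0.
    by rewrite (card_hit st hC) (card_hit st hB) k4.
  suff : giso (between Ga B C) (copies (#|vert (between Ga B C)| %/ 2) (Kgraph 2)).
    by rewrite c4.
  apply: regular1_giso => //; rewrite between_hit /= -card_gt0.
  apply: (@leq_trans #|hit Ga B C|); first by rewrite (card_hit st hC) k4.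
  exact/subset_leq_card/subsetUl.
- apply: K44_minus; rewrite between_hit; apply: giso_bip_minus.
  + exact: (st_adjC st).
  + exact: (disjoint_hit st).
  + by rewrite (card_hit st hC) k4.
  + by rewrite (card_hit st hB) k4.
  + exact: (indep_hit st).
  + exact: (indep_hit st).
  + by move=> x xC; rewrite (between_non hC xC) ed.
  + move=> y yB; have := between_non hB yB; rewrite ed -[RHS]/1 => <-; congr #|pred_of_set _|.
    by apply/setP=> z; rewrite !in_set (st_adjC st).
- rewrite /iso_K44 between_hit; apply: giso_bip_full.
  + exact: (st_adjC st).
  + exact: (disjoint_hit st).
  + by rewrite (card_hit st hC) k4.
  + by rewrite (card_hit st hB) k4.
  + exact: (indep_hit st).
  + exact: (indep_hit st).
  move=> x y xC yB; apply: contraT => na.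
  have := between_non hC xC; rewrite ed subnn => /eqP; rewrite cards_eq0 => /eqP/setP/(_ y).
  by rewrite in_set yB na in_set0.
Qed.

(** The three candidate graphs have degrees 1, 3 and 4, so knowing which one occurs determines d. *)
Lemma between_degree_eq (isoto : graph T -> Prop) m :
  (forall Si x, isoto Si -> x \in vert Si -> degree_in Si x = m) ->
  all_between Ga P isoto -> d = m.
Proof.
move=> hm al; have [B PB] := st_P0 st.
have /card_gt0P[C hC] : 0 < #|N B| by rewrite (card_N st PB) (leq_trans _ (st_b_ge2 st)).
have [x Bx nx] := N_flag st hC; have xC : x \in hit Ga B C by rewrite in_hit Bx.
rewrite -(between_degree hC xC); apply: hm; first by apply: al; rewrite -mem_N.
by rewrite between_hit in_setU xC.
Qed.

(** A vertex meets r = 4 blocks and has d neighbours in each. *)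
Lemma fano_regular : regular Ga (4 * d).
Proof.
move=> x Vx; have [B PB Bx] := block_of st Vx; have [/and3P[_ ti _] _] := st_partition st.
have pbE y C : C \in P -> y \in C -> pblock P y = C by exact: def_pblock.
have im : pblock P @: nbr Ga x = blocks_at Ga P x.
  rewrite (blocks_atE st PB Bx); apply/setP=> C; rewrite [RHS]in_set; apply/imsetP/andP.
    case=> y; rewrite in_set => a ->; have [_ Vy] := adj_vert st a.
    have [D PD Dy] := block_of st Vy; rewrite (pbE y D) //; split.
      exact: (edge_blocks st a PB PD Bx Dy).
    by apply/nbrsP; exists y; rewrite // (st_adjC st).
  case=> hC /nbrsP[y Cy a]; have [_ PC] := N_block hC.
  by exists y; rewrite ?(pbE y C) // in_set (st_adjC st).
rewrite (@card_fibers _ _ (nbr Ga x) (pblock P) d) im.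
  by case: hp => _ _ hr _; rewrite hr.
move=> C; rewrite (blocks_atE st PB Bx) in_set => /andP[hC nx]; have [_ PC] := N_block hC.
rewrite -(hd (B := B) (C := C) (x := x)) ?in_hit ?Bx //; congr #|pred_of_set _|.
apply/setP=> y; rewrite !in_set andbC; have [a|] := boolP (adj Ga x y); rewrite ?andbF ?andbT //.
have [_ Vy] := adj_vert st a; have [D PD Dy] := block_of st Vy.
rewrite (pbE y D) //; apply/eqP/idP=> [<- //|Cy]; exact: (block_uniq st PD PC Dy Cy).
Qed.

(** Two points of B lie on at most 3 + 3 < 7 lines altogether, so some C meets both. Each has at
    least three neighbours among the four available vertices of C, hence they share one.
    Connectedness of the quotient does the rest. *)
Lemma fano_connected : 2 < d -> connected Ga.
Proof.
move=> d3; have csym : connect_sym (adj Ga) by apply: sym_connect_sym; exact: (st_adjC st).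
have same B x y : B \in P -> x \in B -> y \in B -> connect (adj Ga) x y.
  move=> PB Bx By; have F := fano_block st hp PB.
  have [C [hC nx ny]] : exists C, [/\ C \in N B, x \in nbrs Ga C & y \in nbrs Ga C].
    have : 0 < #|N B :\: ([set C in N B | x \notin nbrs Ga C] :|: [set C in N B | y \notin nbrs Ga C])|.
      rewrite cardsD (fano_lines F) subn_gt0.
      apply: (@leq_ltn_trans (3 + 3)) => //.
      rewrite -{1}(fano_pencil F Bx) -(fano_pencil F By).
      apply: leq_trans (subset_leq_card (subsetIr _ _)) _.
      by rewrite cardsU leq_subr.
    case/card_gt0P=> C; rewrite in_setD in_setU !in_set -/(nbr _ _) => /andP[h hC].
    exists C; rewrite mem_N hC; split=> //; move: h; rewrite hC /= negb_or !negbK => /andP[] //.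
  have xC : x \in hit Ga B C by rewrite in_hit Bx.
  have yC : y \in hit Ga B C by rewrite in_hit By.
  have hB : B \in N C by rewrite -(N_sym st).
  have : 0 < #|[set z in hit Ga C B | adj Ga x z] :&: [set z in hit Ga C B | adj Ga y z]|.
    have := cardsUI [set z in hit Ga C B | adj Ga x z] [set z in hit Ga C B | adj Ga y z].
    rewrite {3}(hit_adj hC xC) {3}(hit_adj hC yC) (hd hC xC) (hd hC yC).
    have : #|[set z in hit Ga C B | adj Ga x z] :|: [set z in hit Ga C B | adj Ga y z]| <= 4.
      rewrite -k4 -(card_hit st hB) subset_leq_card //; apply/subsetP=> z.
      by rewrite in_setU !in_set => /orP[] /andP[].
    move: (#|_ :|: _|) (#|_ :&: _|) => m1 m2; move: d3; clear; lia.
  case/card_gt0P=> z; rewrite in_setI !in_set => /andP[/andP[_ a1] /andP[_ a2]].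
  apply: (connect_trans (connect1 a1)); rewrite csym; exact: connect1.
move=> x y Vx Vy; have [B PB Bx] := block_of st Vx; have [C PC Cy] := block_of st Vy.
pose S := [set Y in P | [forall z in Y, connect (adj Ga) x z]].
have cl : closed (adj GaP) S.
  apply: intro_closed.
    by apply: sym_connect_sym; case: (st_simpleP st).
  move=> Y Z /quot_adjP[PY PZ _ [u [w [Yu Zw a]]]]; rewrite !in_set PY PZ /=.
  move/forall_inP=> h; apply/forall_inP=> z Zz.
  apply: (connect_trans (h u Yu)); apply: (connect_trans (connect1 a)).
  exact: (same Z).
have SB : B \in S by rewrite in_set PB; apply/forall_inP=> z Bz; exact: (same B).
have := closed_connect cl (st_connected st PB PC); rewrite SB => /esym.
by rewrite in_set => /andP[_ /forall_inP]; apply.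
Qed.

(** With d = 1 a neighbour of x is named by its block. In the dual plane x is a line and the four
    blocks it meets are the points off it, so [fano_affine_trans2] fixes x while moving an ordered
    pair of neighbours. *)
Lemma fano_arc_transitive2 : d = 1 -> arc_transitive 'P G Ga 2.
Proof.
move=> d1; have [tv _ [x0 [y0 a0]]] := st_trans st; have [Vx0 _] := adj_vert st a0.
have : 1 < #|nbr Ga x0| by rewrite (fano_regular Vx0) d1.
case/card_gt1P=> y1 [z1 []]; rewrite !in_set => ay az ne.
apply: (arc_transitive2_intro (st_simple st) _ _ (x0 := y1) (y0 := x0) (z0 := z1)) => //.
- by move=> x y g Gg; exact: (adjG st).
- by move=> x g Gg Vx; rewrite [_ \in _](vertG st).
- by rewrite (st_adjC st) ay az.
have uq B C x y z : C \in N B -> x \in B -> y \in C -> z \in C -> adj Ga x y -> adj Ga x z -> y = z.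
  move=> hC Bx Cy Cz axy axz.
  have xC : x \in hit Ga B C.
    by rewrite in_hit Bx; apply/nbrsP; exists y; rewrite // (st_adjC st).
  have := hd hC xC; rewrite d1 => /cards1P_ex[w /setP e].
  have := e y; have := e z; rewrite !in_set Cy Cz axy axz !in_set1.
  by move=> /esym/eqP-> /esym/eqP->.
move=> y x z y' x' z' /and3P[ay0 az0 ne0] /and3P[ay0' az0' ne0'].
rewrite (st_adjC st) in ay0; rewrite (st_adjC st) in ay0'.
have blk u w : adj Ga u w -> exists B C, [/\ C \in N B, B \in P, u \in B, w \in C & u \in nbrs Ga C].
  move=> a; have [Vu Vw] := adj_vert st a; have [B PB Bu] := block_of st Vu.
  have [C PC Cw] := block_of st Vw; exists B, C; split=> //.
    exact: (edge_blocks st a).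
  by apply/nbrsP; exists w; rewrite // (st_adjC st).
have [B [C [hC PB Bx Cy xC]]] := blk _ _ ay0.
have [B1 [D [hD PB1 B1x Dz xD]]] := blk _ _ az0.
have eB := block_uniq st PB1 PB B1x Bx; subst B1.
have [B' [C' [hC' PB' Bx' Cy' xC']]] := blk _ _ ay0'.
have [B1 [D' [hD' PB1' B1x' Dz' xD']]] := blk _ _ az0'.
have eB := block_uniq st PB1' PB' B1x' Bx'; subst B1.
have [h Gh [hx hB]] := vert_trans_block st PB PB' Bx Bx'.
have CD : C != D by apply: contra ne0 => /eqP e; apply/eqP/(uq B C x); rewrite // e.
have CD' : C' != D' by apply: contra ne0' => /eqP e; apply/eqP/(uq B' C' x'); rewrite // e.
have F := fano_block st hp PB'.
have incH : forall g X u, g \in stab B' -> X \in N B' -> u \in B' ->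
    ('P%act u g \notin nbrs Ga (X ^^ g)) = (u \notin nbrs Ga X).
  by move=> g X u Sg hX Bu; exact: (fano_block_act st Sg Bu hX).
have hC1 : C ^^ h \in N B' by rewrite -hB (N_act st).
have hD1 : D ^^ h \in N B' by rewrite -hB (N_act st).
have nc X : x' \in nbrs Ga X -> ~~ (x' \notin nbrs Ga X) by rewrite negbK.
have xC1 : x' \in nbrs Ga (C ^^ h) by rewrite -hx (nbrsG st).
have xD1 : x' \in nbrs Ga (D ^^ h) by rewrite -hx (nbrsG st).
have CD1 : C ^^ h != D ^^ h by rewrite (inj_eq (act_inj _ h)).
have [g Sg [gx gC gD]] := fano_affine_trans2 (fano_dual F) (acts_stab_N st B') (acts_stab_block G B')
   incH (tr2N PB') Bx' hC1 hD1 hC' hD' (nc _ xC1) (nc _ xD1) (nc _ xC') (nc _ xD') CD1 CD'.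
have /stabP[Gg gB] := Sg; have {}gx : g x' = x' by [].
exists (h * g)%g; first exact: groupM.
have ey : (h * g)%g x = x' by rewrite permM hx.
have Ghg : (h * g)%g \in G by exact: groupM.
have aE u : 'P%act u (h * g)%g = (h * g)%g u by [].
rewrite !aE; split; [apply: (uq B' C' x')| by [] | apply: (uq B' D' x')] => //.
- by rewrite -gC -actM; exact: (mem_setact 'P%act (h * g)%g Cy).
- by rewrite -ey [adj _ _ _](adjG st).
- by rewrite -gD -actM; exact: (mem_setact 'P%act (h * g)%g Dz).
- by rewrite -ey [adj _ _ _](adjG st).
Qed.

End Degree.

Lemma case_c_more : more_c Ga G P.
Proof.
have [d [d0 d4 hd]] := flag_degree; split.
- by move=> B PB; exact: (fano_PG2 (fano_block st hp PB)).
- by move=> B PB; exact: (fano_block_PSL_dual st hp PB (tr2N PB)).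
- exact: fano_faithful.
- exact: (between_iso hd d0 d4).
have deg4 : all_between Ga P (@iso_4K2 T) -> d = 1.
  by apply: (between_degree_eq hd) => Si x [f iso] Vx; rewrite -(is_giso_degree iso Vx) degree_nK2.
have deg3 : all_between Ga P (@iso_K44_minus_4K2 T) -> d = 3.
  apply: (between_degree_eq hd) => Si x [M [sM isoM [f iso]]] Vx.
  by rewrite -(is_giso_degree iso Vx) (degree_del_matching _ sM isoM).
have deg44 : all_between Ga P (@iso_K44 T) -> d = 4.
  by apply: (between_degree_eq hd) => Si x [f iso] Vx; rewrite -(is_giso_degree iso Vx) degree_Kbip.
have reg := fano_regular hd; split.
- by move/deg4; exact: (fano_arc_transitive2 hd).
- by move/deg3=> e; split; [apply: (fano_connected hd); rewrite e | rewrite e in reg].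
- by move/deg44=> e; split; [apply: (fano_connected hd); rewrite e | rewrite e in reg].
Qed.

End FanoCaseMore.

(** * Cases (d) and (e) *)

Section ThreeArcOrbit.
Variables (T : finType) (Ga : graph T) (G : {group {perm T}}).
Variables (P : {set {set T}}) (v k b : nat).
Hypothesis st : setting Ga G P v k b.

Local Notation GaP := (quot Ga P).
Local Notation "B ^^ g" := ('P^*%act B g) (at level 30).
Local Notation N B := (nbr GaP B).

(* The 2-path graph of case (e) arises from eps = true, the 3-arc graph of
   case (d) from eps = false. *)
Variable eps : bool.
Definition tail_at x (D : {set T}) := (x \in nbrs Ga D) == eps.

Hypothesis tail_uniq : forall B C x, C \in N B -> x \in hit Ga B C ->
  exists D, [/\ D \in N B, D != C, tail_at x D &
    forall E, E \in N B -> E != C -> tail_at x E -> E = D].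

(** The 3-arc attached to an arc (x, y) of the graph: the middle blocks contain x and y, the outer
    ones are the tails of x and y. *)
Definition arc_ends (D B C E : {set T}) : Prop :=
  exists x y, [/\ [/\ adj Ga x y, x \in B & y \in C], B \in P /\ C \in P,
    [/\ D \in N B, D != C & tail_at x D] & [/\ E \in N C, E != B & tail_at y E]].

(** Tails are unique, so an arc of the graph determines its 3-arc. Arc-transitivity therefore makes
    all these 3-arcs one orbit, and reversing the arc makes it self-paired. *)
Lemma three_arc_orbit : exists D : {set 4.-tuple {set T}},
  [/\ self_paired D, orbit_on_3arcs 'P^* G GaP D
    & forall X B C Y, [tuple X; B; C; Y] \in D <-> arc_ends X B C Y].
Proof.
have [_ ta [x0 [y0 a0]]] := st_trans st.
have adjhit x y B C : adj Ga x y -> B \in P -> C \in P -> x \in B -> y \in C ->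
    C \in N B /\ x \in hit Ga B C.
  move=> a PB PC Bx Cy; have hC := edge_blocks st a PB PC Bx Cy; split=> //.
  by rewrite in_hit Bx; apply/nbrsP; exists y; rewrite // (st_adjC st).
have [Vx0 Vy0] := adj_vert st a0.
have [B0 PB0 Bx0] := block_of st Vx0; have [C0 PC0 Cy0] := block_of st Vy0.
have a0' : adj Ga y0 x0 by rewrite (st_adjC st).
have [hC0 xC0] := adjhit _ _ _ _ a0 PB0 PC0 Bx0 Cy0.
have [hB0 yB0] := adjhit _ _ _ _ a0' PC0 PB0 Cy0 Bx0.
have [X0 [hX0 nX0 tX0 uX0]] := tail_uniq hC0 xC0.
have [Y0 [hY0 nY0 tY0 uY0]] := tail_uniq hB0 yB0.
have tauG g x D : g \in G -> tail_at (g x) (D ^^ g) = tail_at x D.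
  by move=> Gg; rewrite /tail_at (nbrsG st).
pose t0 := [tuple X0; B0; C0; Y0].
have orbE X B C Y : [tuple X; B; C; Y] \in orbit ('P^* * 4)%act G t0 <-> arc_ends X B C Y.
  split.
    case/orbitP=> g Gg e.
    have [eX eB eC eY] : [/\ X0 ^^ g = X, B0 ^^ g = B, C0 ^^ g = C & Y0 ^^ g = Y].
      by have := congr1 val e => /= -[<- <- <- <-].
    exists (g x0), (g y0); rewrite -eX -eB -eC -eY (adjG st) // !mem_setactP !(blockG st) //.
    by rewrite !(N_act st) // !tauG // !(inj_eq (act_inj _ g)).
  case=> x [y [[a Bx Cy] [PB PC] [hX nX tX] [hY nY tY]]].
  have [g Gg [gx gy]] := ta _ _ _ _ a0 a.
  have {}gx : g x0 = x by []. have {}gy : g y0 = y by [].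
  have eB : B0 ^^ g = B by apply: (block_image st Gg PB0 PB Bx0); rewrite gx.
  have eC : C0 ^^ g = C by apply: (block_image st Gg PC0 PC Cy0); rewrite gy.
  have a' : adj Ga y x by rewrite (st_adjC st).
  have [hC xC] := adjhit _ _ _ _ a PB PC Bx Cy.
  have [hB yB] := adjhit _ _ _ _ a' PC PB Cy Bx.
  have [X1 [_ _ _ uX]] := tail_uniq hC xC; have [Y1 [_ _ _ uY]] := tail_uniq hB yB.
  have eX : X0 ^^ g = X.
    rewrite (uX X) //; apply: uX.
    - by rewrite -eB (N_act st).
    - by rewrite -eC (inj_eq (act_inj _ g)).
    - by rewrite -gx tauG.
  have eY : Y0 ^^ g = Y.
    rewrite (uY Y) //; apply: uY.
    - by rewrite -eC (N_act st).
    - by rewrite -eB (inj_eq (act_inj _ g)).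
    - by rewrite -gy tauG.
  by apply/orbitP; exists g => //; apply: val_inj; rewrite /= -eX -eB -eC -eY.
exists (orbit ('P^* * 4)%act G t0); split=> //.
- move=> t; case/tupleP: t => X t; case/tupleP: t => B t; case/tupleP: t => C t.
  case/tupleP: t => Y t; rewrite tuple0 => /orbE h.
  have -> : [tuple of rev [tuple of [:: X, B, C, Y & [tuple]]]] = [tuple Y; C; B; X].
    by apply: val_inj.
  apply/orbE; case: h => x [y [[a Bx Cy] [PB PC] h1 h2]].
  by exists y, x; rewrite (st_adjC st).
exists t0 => //; rewrite (sarcs3E (st_simpleP st)) -!mem_N -(N_sym st) hX0 hC0 hY0 nX0.
by rewrite eq_sym.
Qed.

End ThreeArcOrbit.

(** * Case (e): vertices as 2-paths of the quotient *)

Section TwoPathCase.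
Variables (T : finType) (Ga : graph T) (G : {group {perm T}}).
Variables (P : {set {set T}}) (v k b : nat).
Hypothesis st : setting Ga G P v k b.
Hypothesis hp : params Ga P 6 4 2 1.

Local Notation V := (vert Ga).
Local Notation GaP := (quot Ga P).
Local Notation N B := (nbr GaP B).

Lemma in_blocks_at x B C : B \in P -> x \in B ->
  (C \in blocks_at Ga P x) = (C \in N B) && (x \in nbrs Ga C).
Proof. by move=> PB Bx; rewrite (blocks_atE st PB Bx) in_set. Qed.

Lemma two_path_tail B C x : C \in N B -> x \in hit Ga B C ->
  exists D, [/\ D \in N B, D != C, tail_at Ga true x D &
    forall E, E \in N B -> E != C -> tail_at Ga true x E -> E = D].
Proof.
move=> hC; rewrite in_hit => /andP[Bx xC]; have [PB _] := N_block hC.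
case: hp => _ _ hr _; have := hr x (block_vert st PB Bx).
rewrite (cardsD1 C) (in_blocks_at _ PB Bx) hC xC => -[] /cards1P_ex[D /setP e].
have h E : [&& E != C, E \in N B & x \in nbrs Ga E] = (E == D).
  by rewrite -(in_blocks_at E PB Bx) -in_setD1 e in_set1.
exists D; have := h D; rewrite eqxx => /and3P[nD hD xD]; split=> //.
  by rewrite /tail_at xD.
by move=> E hE nE; rewrite /tail_at => /eqP xE; apply/eqP; rewrite -h nE hE xE.
Qed.

Lemma two_path_uniq B C D x y : C \in N B -> D \in N B -> C != D ->
  x \in B -> y \in B -> x \in nbrs Ga C -> x \in nbrs Ga D ->
  y \in nbrs Ga C -> y \in nbrs Ga D -> x = y.
Proof.
move=> hC hD ne Bx By xC xD yC yD; have [PB _] := N_block hC; case: hp => _ _ _ hl.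
have /cards1P_ex[z /setP e] := hl B C D PB hC hD ne.
have := e x; have := e y; rewrite !in_setI xC xD yC yD Bx By !in_set1.
by move=> /esym/eqP-> /esym/eqP->.
Qed.

Lemma case_e_more : more_e Ga G P.
Proof.
have [D [sp orb DE]] := three_arc_orbit st two_path_tail; exists D; split=> //.
have [/and3P[_ ti _] _] := st_partition st; case: (hp) => _ _ hr hl.
(* By r = 2 the second component is a pair of neighbours of the block, and by lambda = 1 each such
   pair comes from exactly one vertex. *)
exists (fun x => (pblock P x, blocks_at Ga P x)).
have bl x : x \in V -> exists2 B, B \in P & x \in B /\ pblock P x = B.
  by move=> Vx; have [B PB Bx] := block_of st Vx; exists B; rewrite // (def_pblock ti PB Bx).
have pair x B : B \in P -> x \in B -> exists C E, [/\ C \in N B, E \in N B, C != E,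
    x \in nbrs Ga C /\ x \in nbrs Ga E & blocks_at Ga P x = [set C; E]].
  move=> PB Bx; have /eqP := hr x (block_vert st PB Bx).
  case/cards2P=> C [E [ne e]]; exists C, E.
  have : C \in blocks_at Ga P x by rewrite e in_set2 eqxx.
  have : E \in blocks_at Ga P x by rewrite e in_set2 eqxx orbT.
  by rewrite !(in_blocks_at _ PB Bx) => /andP[hE xE] /andP[hC xC].
split=> /=.
- move=> x y Vx Vy; have [B PB [Bx ->]] := bl x Vx; have [B' PB' [By ->]] := bl y Vy.
  case=> eB eb; rewrite -eB in By.
  have [C [E [hC hE ne [xC xE] e]]] := pair _ _ PB Bx.
  have : C \in blocks_at Ga P y by rewrite -eb e in_set2 eqxx.
  have : E \in blocks_at Ga P y by rewrite -eb e in_set2 eqxx orbT.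
  rewrite !(in_blocks_at _ PB By) => /andP[_ yE] /andP[_ yC].
  exact: (two_path_uniq hC hE ne).
- apply/setP=> -[B A]; rewrite [in RHS]in_set; apply/imsetP/idP.
    case=> x Vx [-> ->]; have [B' PB' [Bx ->]] := bl x Vx; rewrite /= hr // eqxx andbT.
    by apply/subsetP=> C; rewrite (in_blocks_at _ PB' Bx) => /andP[].
  case/andP=> /= sA /cards2P[C [E [ne eA]]].
  have hC : C \in N B by rewrite (subsetP sA) // eA in_set2 eqxx.
  have hE : E \in N B by rewrite (subsetP sA) // eA in_set2 eqxx orbT.
  have [PB _] := N_block hC.
  have /cards1P_ex[x /setP/(_ x)] := hl B C E PB hC hE ne.
  rewrite set11 !in_setI => /andP[/andP[xC xE] Bx].
  have Vx := block_vert st PB Bx; exists x => //; rewrite (def_pblock ti PB Bx).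
  congr (_, _); apply/eqP; rewrite eqEcard hr // eA cards2 ne andbT.
  by apply/subsetP=> F; rewrite in_set2 => /orP[] /eqP->; rewrite (in_blocks_at _ PB Bx) ?hC ?hE.
move=> x y Vx Vy; have [B PB [Bx eB]] := bl x Vx; have [C PC [Cy eC]] := bl y Vy.
have inp z X : X \in P -> z \in X -> (X, blocks_at Ga P z) \in
    [set p : {set T} * {set {set T}} | (p.2 \subset nbr GaP p.1) && (#|p.2| == 2)].
  move=> PX Xz; rewrite in_set /= hr ?(block_vert st PX Xz) // eqxx andbT.
  by apply/subsetP=> Y; rewrite (in_blocks_at _ PX Xz) => /andP[].
rewrite !eB !eC !inp //=; apply/andP/idP.
  (* The arc (x1, y1) that produced the 3-arc carries the same pairs of blocks as x and y, so it is
     (x, y). *)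
  case=> _ /existsP[t /existsP[u /and4P[/eqP ex /eqP ey /DE h _]]].
  case: h => x1 [y1 [[a1 Bx1 Cy1] _ [ht nt tt] [hu nu tu]]].
  rewrite /tail_at in tt tu; move/eqP: tt => tt; move/eqP: tu => tu.
  have hC : C \in N B := edge_blocks st a1 PB PC Bx1 Cy1.
  have hB : B \in N C by rewrite -(N_sym st).
  have x1C : x1 \in nbrs Ga C by apply/nbrsP; exists y1; rewrite // (st_adjC st).
  have y1B : y1 \in nbrs Ga B by apply/nbrsP; exists x1.
  have [xC xt] : x \in nbrs Ga C /\ x \in nbrs Ga t.
    have : C \in blocks_at Ga P x by rewrite ex in_set2 eqxx.
    have : t \in blocks_at Ga P x by rewrite ex in_set2 eqxx orbT.
    by rewrite !(in_blocks_at _ PB Bx) => /andP[_ ?] /andP[_ ?].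
  have [yB yu] : y \in nbrs Ga B /\ y \in nbrs Ga u.
    have : B \in blocks_at Ga P y by rewrite ey in_set2 eqxx.
    have : u \in blocks_at Ga P y by rewrite ey in_set2 eqxx orbT.
    by rewrite !(in_blocks_at _ PC Cy) => /andP[_ ?] /andP[_ ?].
  rewrite eq_sym in nt; rewrite eq_sym in nu.
  rewrite (two_path_uniq hC ht nt Bx Bx1 xC xt x1C tt).
  by rewrite (two_path_uniq hB hu nu Cy Cy1 yB yu y1B tu).
move=> a; have hC : C \in N B := edge_blocks st a PB PC Bx Cy.
have hB : B \in N C by rewrite -(N_sym st).
have xC : x \in nbrs Ga C by apply/nbrsP; exists y; rewrite // (st_adjC st).
have yB : y \in nbrs Ga B by apply/nbrsP; exists x.
have xh : x \in hit Ga B C by rewrite in_hit Bx.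
have yh : y \in hit Ga C B by rewrite in_hit Cy.
have [t [ht nt tt _]] := two_path_tail hC xh; have [u [hu nu tu _]] := two_path_tail hB yh.
split; first by apply/eqP=> -[e _]; have := N_irr hC; rewrite e eqxx.
apply/existsP; exists t; apply/existsP; exists u.
have two z X Y W : X \in P -> z \in X -> Y \in N X -> W \in N X -> W != Y -> z \in nbrs Ga Y ->
    tail_at Ga true z W -> blocks_at Ga P z == [set Y; W].
  move=> PX Xz hY hW ne zY /eqP zW.
  rewrite eq_sym eqEcard hr ?(block_vert st PX Xz) // cards2 eq_sym ne andbT.
  by apply/subsetP=> F; rewrite in_set2 => /orP[] /eqP->; rewrite (in_blocks_at _ PX Xz) ?hY ?hW.
rewrite (two x B C t) // (two y C B u) //=; apply/andP; split; apply/DE.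
  by exists x, y.
by exists y, x; rewrite (st_adjC st).
Qed.

End TwoPathCase.

(** * Case (d): triples of vertices as arcs of the quotient *)

Section ThreeArcCase.
Variables (T : finType) (Ga : graph T) (G : {group {perm T}}).
Variables (P : {set {set T}}) (v k b : nat).
Hypothesis st : setting Ga G P v k b.
Variable a : nat.
Hypothesis a3 : 3 <= a.
Hypothesis hp : params Ga P (3 * a) a (a - 1) (3 * a - 6).

Local Notation V := (vert Ga).
Local Notation GaP := (quot Ga P).
Local Notation "B ^^ g" := ('P^*%act B g) (at level 30).
Local Notation N B := (nbr GaP B).

Lemma three_arc_tail B C x : C \in N B -> x \in hit Ga B C ->
  exists D, [/\ D \in N B, D != C, tail_at Ga false x D &
    forall E, E \in N B -> E != C -> tail_at Ga false x E -> E = D].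
Proof.
move=> hC; rewrite in_hit => /andP[Bx xC]; have [PB _] := N_block hC.
have [D [hD xD u]] := miss_uniq st a3 hp PB Bx; exists D.
have := xD; rewrite in_miss => /andP[_ nD]; split=> //.
- by apply: contraNneq nD => ->.
- by rewrite /tail_at (negPf nD).
by move=> E hE nE tE; apply: u => //; rewrite in_miss Bx /=; move: tE; rewrite /tail_at; case: (_ \in _).
Qed.

Definition arcs_of_quot := [set p : {set T} * {set T} | adj GaP p.1 p.2].
(** The refined partition: two vertices of a block are together when they miss the same neighbouring
    block. *)
Definition miss_blocks := [set miss Ga p.1 p.2 | p in arcs_of_quot].
Local Notation Q := miss_blocks.

Lemma missQ B C : C \in N B -> miss Ga B C \in Q.
Proof. by rewrite mem_N => h; apply/imsetP; exists (B, C); rewrite // in_set. Qed.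

Lemma QP A : A \in Q -> exists B C, C \in N B /\ A = miss Ga B C.
Proof. by case/imsetP=> -[B C]; rewrite in_set -mem_N /=; exists B, C. Qed.

Lemma miss_sub B C x : x \in miss Ga B C -> x \in B.
Proof. by rewrite in_miss => /andP[]. Qed.

Lemma miss_pair_inj B C B' C' x : C \in N B -> C' \in N B' -> x \in miss Ga B C ->
  x \in miss Ga B' C' -> B = B' /\ C = C'.
Proof.
move=> hC hC' xA xA'; have [[PB _] [PB' _]] := (N_block hC, N_block hC').
have eB := block_uniq st PB PB' (miss_sub xA) (miss_sub xA'); subst B'.
by split=> //; exact: (miss_inj st a3 hp hC hC' xA xA').
Qed.

Lemma miss_eq B C B' C' : C \in N B -> C' \in N B' -> miss Ga B C = miss Ga B' C' ->
  B = B' /\ C = C'.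
Proof.
move=> hC hC' e; have [x xA] := miss_ex st hC.
by apply: (miss_pair_inj hC hC' xA); rewrite -e.
Qed.

Lemma vert_Q x B : B \in P -> x \in B -> exists2 C, C \in N B & x \in miss Ga B C.
Proof. by move=> PB Bx; have [C [hC xC _]] := miss_uniq st a3 hp PB Bx; exists C. Qed.

Lemma acts_of_stable (aT : finGroupType) (S : finType) (to : {action aT &-> S})
    (H : {group aT}) (X : {set S}) :
  (forall x h, h \in H -> x \in X -> to x h \in X) -> [acts H, on X | to].
Proof.
move=> h; apply/subsetP=> g Hg; apply/astabsP=> x; apply/idP/idP; last exact: h.
by move/(h _ g^-1%g); rewrite groupV actK; apply.
Qed.

Lemma Q_invariant : invariant_partition 'P G Q V.
Proof.
split.
  apply/and3P; split.
  - apply/eqP/setP=> x; apply/bigcupP/idP=> [[A /QP[B [C [hC ->]]] xA]|Vx].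
      by have [PB _] := N_block hC; exact: (block_vert st PB (miss_sub xA)).
    have [B PB Bx] := block_of st Vx; have [C hC xC] := vert_Q PB Bx.
    by exists (miss Ga B C) => //; exact: missQ.
  - apply/trivIsetP=> A A' /QP[B [C [hC ->]]] /QP[B' [C' [hC' ->]]] ne.
    rewrite -setI_eq0; apply/eqP/setP=> x; rewrite in_setI in_set0.
    apply/negP=> /andP[xA xA']; have [eB eC] := miss_pair_inj hC hC' xA xA'.
    by rewrite eB eC eqxx in ne.
  - by apply/negP=> /QP[B [C [hC e]]]; have [x] := miss_ex st hC; rewrite -e in_set0.
apply: acts_of_stable => A g Gg /QP[B [C [hC ->]]].
by rewrite -(missG st) //; apply: missQ; rewrite (N_act st).
Qed.

Lemma hatE B C D : B \in P -> D \in N C -> (miss Ga C D \in hat Q B) = (C == B).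
Proof.
move=> PB hD; rewrite in_set missQ //=; apply/subsetP/eqP=> [s|<- x]; last exact: miss_sub.
have [x xA] := miss_ex st hD; have [PC _] := N_block hD.
exact: (block_uniq st PC PB (miss_sub xA) (s x xA)).
Qed.

Lemma cover_hat B : B \in P -> cover (hat Q B) = B.
Proof.
move=> PB; apply/setP=> x; apply/bigcupP/idP=> [[A]|Bx].
  by rewrite in_set => /andP[_ /subsetP]; apply.
have [C hC xC] := vert_Q PB Bx; exists (miss Ga B C) => //.
by rewrite hatE.
Qed.

Lemma hat_inj : {in P &, injective (hat Q)}.
Proof. by move=> B C PB PC e; rewrite -(cover_hat PB) e cover_hat. Qed.

Lemma hatsP H : H \in hats Q P -> exists2 B, B \in P & H = hat Q B.
Proof. by case/imsetP=> B PB ->; exists B. Qed.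

Lemma mem_hats B : B \in P -> hat Q B \in hats Q P.
Proof. exact: imset_f. Qed.

Lemma hat_imset B : B \in P -> hat Q B = [set miss Ga B C | C in N B].
Proof.
move=> PB; apply/setP=> A; apply/idP/imsetP=> [hA|[C hC ->]]; last by rewrite hatE.
have : A \in Q by move: hA; rewrite in_set => /andP[].
case/QP=> C [D [hD e]]; move: hA; rewrite e hatE // => /eqP eC.
by exists D; rewrite -eC.
Qed.

Lemma miss_injN B : {in N B &, injective (miss Ga B)}.
Proof. by move=> C D hC hD e; have [] := miss_eq hC hD e. Qed.

Lemma hatG g B : g \in G -> B \in P -> ('P^*)^*%act (hat Q B) g = hat Q (B ^^ g).
Proof.
move=> Gg PB; have PBg : B ^^ g \in P by rewrite (blockG st).
rewrite !hat_imset //; apply/setP=> A; apply/imsetP/imsetP.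
  case=> _ /imsetP[C hC ->] ->; exists (C ^^ g); first by rewrite (N_act st).
  by rewrite (missG st).
case=> C hC ->; exists (miss Ga B (C ^^ g^-1%g)).
  by apply/imsetP; exists (C ^^ g^-1%g) => //; rewrite -(N_act st _ _ Gg) actKV.
by rewrite -[X in miss Ga _ X](actKV 'P^*%act g C) (missG st).
Qed.

Lemma hats_invariant : invariant_partition 'P^* G (hats Q P) Q.
Proof.
split.
  apply/and3P; split.
  - apply/eqP/setP=> A; apply/bigcupP/idP=> [[H /hatsP[B PB ->]]|].
      by rewrite in_set => /andP[].
    case/QP=> B [C [hC ->]]; have [PB _] := N_block hC.
    by exists (hat Q B); rewrite ?mem_hats // hatE.
  - apply/trivIsetP=> H H' /hatsP[B PB ->] /hatsP[C PC ->] ne.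
    rewrite -setI_eq0; apply/eqP/setP=> A; rewrite in_setI in_set0; apply/negP=> /andP[hB hC].
    have : A \in Q by move: hB; rewrite in_set => /andP[].
    case/QP=> X [Y [hY e]]; move: hB hC; rewrite e !hatE // => /eqP eB /eqP eC.
    by rewrite -eB -eC eqxx in ne.
  - apply/negP=> /hatsP[B PB e]; have [x Bx] := block_nonempty st PB.
    by rewrite -(cover_hat PB) -e in Bx; case/bigcupP: Bx => A; rewrite in_set0.
apply: acts_of_stable => H g Gg /hatsP[B PB ->].
by rewrite hatG // mem_hats // (blockG st).
Qed.

Lemma quotQ_adj B D C E : D \in N B -> E \in N C ->
  adj (quot Ga Q) (miss Ga B D) (miss Ga C E) <->
  exists x y, [/\ x \in miss Ga B D, y \in miss Ga C E & adj Ga x y].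
Proof.
move=> hD hE; split=> [/quot_adjP[]//|[x [y [xA yA ad]]]]; apply/quot_adjP; split.
- exact: missQ.
- exact: missQ.
- have [[PB _] [PC _]] := (N_block hD, N_block hE).
  have hC := edge_blocks st ad PB PC (miss_sub xA) (miss_sub yA).
  by apply/eqP=> e; have [eB _] := miss_eq hD hE e; have := N_irr hC; rewrite eB eqxx.
by exists x, y.
Qed.

(** A vertex of the triple of (B, D) misses D and meets every other neighbour of B. This one
    equivalence yields the quotient and the parameters of the refined partition. *)
Lemma miss_adj_hat B D C : D \in N B -> C \in P ->
  (exists2 A, A \in hat Q C & adj (quot Ga Q) (miss Ga B D) A) <-> C \in N B /\ C != D.
Proof.
move=> hD PC; have [PB _] := N_block hD; split.
  case=> A; rewrite hat_imset // => /imsetP[E hE ->] /(quotQ_adj hD hE)[x [y [xA yA ad]]].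
  split; first exact: (edge_blocks st ad PB PC (miss_sub xA) (miss_sub yA)).
  have xC : x \in nbrs Ga C by apply/nbrsP; exists y; rewrite ?(miss_sub yA) // (st_adjC st).
  by apply: contraTneq xC => ->; move: xA; rewrite in_miss => /andP[].
case=> hC ne; have [x xA] := miss_ex st hD.
have /nbrsP[y Cy ad] := miss_hit st a3 hp hD hC xA ne.
have [E hE yE] := vert_Q PC Cy; exists (miss Ga C E); first by rewrite hatE.
by apply/(quotQ_adj hD hE); exists x, y; rewrite (st_adjC st).
Qed.

Lemma hats_adj B C : B \in P -> C \in P ->
  adj (quot (quot Ga Q) (hats Q P)) (hat Q B) (hat Q C) = adj GaP B C.
Proof.
move=> PB PC; apply/quot_adjP/idP.
  case=> _ _ _ [A [A' [hA hA' ad]]]; move: hA; rewrite hat_imset // => /imsetP[D hD eA].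
  rewrite -mem_N; rewrite eA in ad.
  by have [] := (miss_adj_hat hD PC).1 (ex_intro2 _ _ A' hA' ad).
rewrite -mem_N => hC; split; rewrite ?mem_hats //.
  by rewrite (inj_in_eq hat_inj) //; exact: N_irr hC.
(* An edge towards C must start in a triple of B other than the one that misses C; b >= 2 provides
   it. *)
have : 0 < #|N B :\ C|.
  by have := cardsD1 C (N B); rewrite hC (card_N st PB); have := st_b_ge2 st; lia.
case/card_gt0P=> D; rewrite in_setD1 => /andP[ne hD].
have [|A hA ad] := (miss_adj_hat hD PC).2; first by rewrite hC eq_sym.
by exists (miss Ga B D), A; rewrite hatE.
Qed.

Lemma case_d_more : more_d Ga G P a.
Proof.
have [_ eb] := params_vb st hp; exists Q; split.
- split; first exact: Q_invariant.
  by move=> A /QP[B [C [hC ->]]]; exact: (card_miss st hC).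
- move=> A /QP[B [C [hC ->]]]; have [PB _] := N_block hC; exists B => //.
  by apply/subsetP=> x; exact: miss_sub.
- have [D [sp orb DE]] := three_arc_orbit st three_arc_tail; exists D; split=> //.
  (* The inverse of (B, C) |-> [miss Ga B C]; the default value concerns only sets outside Q. *)
  pose f A := odflt (set0, set0) [pick p in arcs_of_quot | miss Ga p.1 p.2 == A].
  have fE B C : C \in N B -> f (miss Ga B C) = (B, C).
    move=> hC; rewrite /f; case: pickP => [[B' C']|/(_ (B, C))] /=.
      rewrite in_set -mem_N /= => /andP[hC' /eqP e].
      by have [-> ->] := miss_eq hC' hC e.
    by rewrite in_set -mem_N /= hC eqxx.
  exists f; split=> /=.
  + by move=> A A' /QP[B [C [hC ->]]] /QP[B' [C' [hC' ->]]]; rewrite !fE // => -[-> ->].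
  + apply/setP=> -[B C]; rewrite [in RHS]in_set /=; apply/imsetP/idP.
      by case=> A /QP[B' [C' [hC' ->]]]; rewrite fE // => -[-> ->]; rewrite -[X in is_true X]/(adj GaP B' C') -mem_N.
    by rewrite -[X in is_true X -> _]/(adj GaP B C) -mem_N => hC; exists (miss Ga B C); rewrite ?missQ ?fE.
  move=> A A' /QP[B [C [hC ->]]] /QP[B' [C' [hC' ->]]].
  rewrite !fE // -[RHS]/(adj (quot Ga Q) (miss Ga B C) (miss Ga B' C')).
  rewrite -[LHS]/[&& (B, C) \in arcs_of_quot, (B', C') \in arcs_of_quot
                  & [tuple C; B; B'; C'] \in D].
  have inA X Y : Y \in N X -> (X, Y) \in arcs_of_quot.
    by move=> h; rewrite in_set -mem_N.
  rewrite !inA // !andTb.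
  have [[PB _] [PB' _]] := (N_block hC, N_block hC').
  apply/idP/idP.
    move/DE=> [x [y [[ad Bx By] _ [_ nC tC] [_ nC' tC']]]].
    have nE z X : tail_at Ga false z X -> z \notin nbrs Ga X by rewrite /tail_at; case: (_ \in _).
    by apply/(quotQ_adj hC hC'); exists x, y; rewrite !in_miss Bx By !nE.
  move/(quotQ_adj hC hC')=> [x [y [xA yA ad]]]; apply/DE.
  have := xA; rewrite in_miss => /andP[Bx nx]; have := yA; rewrite in_miss => /andP[By ny].
  exists x, y; split=> //; rewrite /tail_at.
    split=> //; last by rewrite (negPf nx).
    by apply: contraNneq nx => ->; apply/nbrsP; exists y; rewrite // (st_adjC st).
  split=> //; last by rewrite (negPf ny).
  by apply: contraNneq ny => ->; apply/nbrsP; exists x.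
- split; first exact: hats_invariant.
  exists (fun H => cover H); split=> /=.
  + by move=> H H' /hatsP[B PB ->] /hatsP[C PC ->]; rewrite !cover_hat // => ->.
  + apply/setP=> B; apply/imsetP/idP=> [[H /hatsP[C PC ->]]|PB].
      by rewrite cover_hat // => ->.
    by exists (hat Q B); rewrite ?mem_hats ?cover_hat.
  + move=> H H' /hatsP[B PB ->] /hatsP[C PC ->]; rewrite !cover_hat //.
    exact: (esym (hats_adj PB PC)).
split.
- move=> H /hatsP[B PB ->]; rewrite hat_imset // card_in_imset; last exact: miss_injN.
  by rewrite (card_N st PB) eb.
- move=> _ /hatsP[B PB ->].
  have -> : nbr (quot (quot Ga Q) (hats Q P)) (hat Q B) = hat Q @: N B.
    apply/setP=> H'; rewrite in_set; apply/idP/imsetP=> [h|[C hC ->]].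
      have /quot_adjP[_ /hatsP[C PC eH] _ _] := h.
      by exists C; rewrite // mem_N -(hats_adj PB PC) -eH.
    by have [_ PC] := N_block hC; rewrite hats_adj // -mem_N.
  rewrite card_in_imset ?(card_N st PB) // => C D hC hD; apply: hat_inj.
    by have [] := N_block hC.
  by have [] := N_block hD.
- move=> H H' h; have /quot_adjP[/hatsP[B PB eB] /hatsP[C PC eC] _ _] := h.
  subst H H'; rewrite hats_adj // -mem_N in h.
  have -> : hat Q B :&: nbrs (quot Ga Q) (hat Q C) = miss Ga B @: (N B :\ C).
    apply/setP=> A; rewrite in_setI hat_imset //; apply/andP/imsetP.
      case=> /imsetP[D hD ->] /nbrsP[A' hA' ad]; exists D => //.
      have [sy _ _] := quot_simple Q (st_adjC st); rewrite sy in ad.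
      by rewrite in_setD1 hD andbT eq_sym; have [] := (miss_adj_hat hD PC).1 (ex_intro2 _ _ A' hA' ad).
    case=> D; rewrite in_setD1 => /andP[ne hD] ->; split; first exact: imset_f.
    have [|A' hA' ad] := (miss_adj_hat hD PC).2; first by rewrite h eq_sym.
    have [sy _ _] := quot_simple Q (st_adjC st); rewrite sy in ad.
    by apply/nbrsP; exists A'.
  rewrite card_in_imset; last first.
    by move=> D E; rewrite !in_setD1 => /andP[_ hD] /andP[_ hE]; exact: miss_injN.
  by have := cardsD1 C (N B); rewrite h (card_N st PB) eb add1n => ->; rewrite subn1.
move=> A /QP[B [D [hD ->]]]; have [PB PD] := N_block hD.
have -> : blocks_at (quot Ga Q) (hats Q P) (miss Ga B D) = hat Q @: (N B :\ D).
  apply/setP=> H; rewrite in_set; apply/andP/imsetP.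
    case=> /hatsP[C PC ->] /set0Pn[A']; rewrite in_setI in_set => /andP[ad hA'].
    have [hC ne] := (miss_adj_hat hD PC).1 (ex_intro2 _ _ A' hA' ad).
    by exists C; rewrite // in_setD1 ne.
  case=> C; rewrite in_setD1 => /andP[ne hC] ->; have [_ PC] := N_block hC.
  split; first exact: mem_hats.
  have [|A' hA' ad] := (miss_adj_hat hD PC).2; first by [].
  by apply/set0Pn; exists A'; rewrite in_setI in_set ad.
rewrite card_in_imset; last first.
  move=> C E; rewrite !in_setD1 => /andP[_ hC] /andP[_ hE]; apply: hat_inj.
    by have [] := N_block hC.
  by have [] := N_block hE.
by have := cardsD1 D (N B); rewrite hD (card_N st PB) eb add1n => ->; rewrite subn1.
Qed.

End ThreeArcCase.

(** * Four-valent examples *)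

Section StarAction.
Variable S : finType.

Definition star_act (p : S * {set S}) (h : {perm S}) : S * {set S} :=
  (h p.1, 'P^*%act p.2 h).

Lemma star_act1 : star_act^~ 1%g =1 id.
Proof. by case=> s A; rewrite /star_act perm1 act1. Qed.

Lemma star_actM p : act_morph star_act p.
Proof. by move=> h1 h2; rewrite /star_act permM actM. Qed.

Definition star_action := TotalAction star_act1 star_actM.

Lemma star_actK h p : star_act (star_act p h) h^-1%g = p.
Proof. exact: (actK star_action). Qed.

End StarAction.

(** * Examples on pairs of a vertex and m of its neighbours, for m = 1 and m = 2 together *)

Section Stars.
Variables (S : finType) (Si : graph S) (H : {group {perm S}}) (m : nat).
Hypothesis sSi : simple_graph Si.
Hypothesis cSi : connected Si.
Hypothesis rSi : regular Si 4.
Hypothesis sH : H \subset gaut Si.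
Hypothesis tr2 : arc_transitive 'P H Si 2.
(** This says that m is 1 or 2, in the form used: at each vertex three stars avoid a given
    neighbour, which is the equation k = v - 3. *)
Hypothesis m3 : 'C(3, m) = 3.

Local Notation U := (S * {set S})%type.

Definition stars := [set p : U | (p.2 \subset nbr Si p.1) && (#|p.2| == m)].
Local Notation R := stars.

Variable adjU : rel U.
Hypothesis adjU_sym : symmetric adjU.
Hypothesis adjU_in : forall p q, adjU p q -> [/\ p \in R, q \in R, q.1 \in p.2 & p.1 \in q.2].
Hypothesis adjU_H : forall p q h, h \in H -> adjU p q -> adjU (star_act p h) (star_act q h).
Hypothesis adjU_trans : forall p q p' q', adjU p q -> adjU p' q' ->
  exists2 h, h \in H & star_act p h = p' /\ star_act q h = q'.
Hypothesis adjU_ex : forall (p : U) e, p \in R -> e \in p.2 -> exists2 q, q.1 = e & adjU p q.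
Hypothesis star_trans : forall p q : U, p \in R -> q \in R -> exists2 h, h \in H & star_act p h = q.

Let Ga : graph U := Graph R adjU.
Definition star_block s := [set p in R | p.1 == s].
Local Notation Bl := star_block.
Let P := [set Bl s | s in vert Si].
Local Notation "B ^^ g" := ('P^*%act B g) (at level 30).

Let symS : symmetric (adj Si). Proof. by case: sSi. Qed.

Lemma H_adj h x y : h \in H -> adj Si (h x) (h y) = adj Si x y.
Proof.
by move/(subsetP sH); rewrite inE => /andP[_ /forallP/(_ x)/forallP/(_ y)/eqP].
Qed.

Lemma H_vert h x : h \in H -> (h x \in vert Si) = (x \in vert Si).
Proof. by move/(subsetP sH); rewrite inE => /andP[/perm_closed->]. Qed.

Lemma H_nbr h x A : h \in H -> ('P^*%act A h \subset nbr Si (h x)) = (A \subset nbr Si x).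
Proof.
move=> Hh; apply/subsetP/subsetP=> s y.
  by move=> Ay; have := s (h y); rewrite mem_setactP !inE H_adj //; apply.
by rewrite -(permKV h y) mem_setactP => /s; rewrite !inE H_adj.
Qed.

Lemma star_actR h p : h \in H -> (star_act p h \in R) = (p \in R).
Proof. by move=> Hh; rewrite !inE /= H_nbr // card_setact. Qed.

Lemma acts_stars : [acts H, on R | star_action S].
Proof. by apply/subsetP=> h Hh; apply/astabsP=> p; rewrite [LHS]star_actR. Qed.

(** The action is first restricted to the stars by [actby], so that the permutations fix every other
    pair, as [gaut] demands. *)
Definition star_mor := actperm <[acts_stars]>%act.
Local Notation phi := star_mor.
Definition star_group : {group {perm U}} := [group of (phi @* H)%g].
Local Notation G := star_group.

Lemma phiE h p : h \in H -> p \in R -> phi h p = star_act p h.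
Proof. by move=> Hh Rp; rewrite /phi actpermE [LHS]actbyE. Qed.

Lemma phi_out h p : h \in H -> p \notin R -> phi h p = p.
Proof. by move=> Hh nRp; rewrite /phi actpermE /= /actby (negPf nRp). Qed.

Lemma phi_in h : h \in H -> phi h \in G.
Proof. by move=> Hh; apply: mem_morphim. Qed.

Lemma GP g : g \in G -> exists2 h, h \in H & g = phi h.
Proof. by case/morphimP=> h _ Hh ->; exists h. Qed.

Lemma phiR h p : h \in H -> (phi h p \in R) = (p \in R).
Proof.
move=> Hh; have [Rp|nRp] := boolP (p \in R); first by rewrite phiE // star_actR.
by rewrite phi_out // (negPf nRp).
Qed.

Lemma adjU_phi h p q : h \in H -> adjU (phi h p) (phi h q) = adjU p q.
Proof.
move=> Hh; apply/idP/idP=> a.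
  have [Rp Rq _ _] := adjU_in a; rewrite !phiR // in Rp Rq.
  rewrite !phiE // in a; have := adjU_H (groupVr Hh) a.
  by rewrite !star_actK.
by have [Rp Rq _ _] := adjU_in a; rewrite !phiE //; exact: adjU_H.
Qed.

Lemma mem_Bl s p : (p \in Bl s) = (p \in R) && (p.1 == s).
Proof. by rewrite in_set. Qed.

Lemma BlG h s : h \in H -> Bl s ^^ phi h = Bl (h s).
Proof.
move=> Hh; apply/setP=> p; rewrite -(permKV (phi h) p) mem_setactP !mem_Bl phiR //.
move: ((phi h)^-1%g p) => q; have [Rq|//] := boolP (q \in R).
by rewrite phiE //= (inj_eq perm_inj).
Qed.

Lemma star_vert p : 0 < m -> p \in R -> p.1 \in vert Si.
Proof.
move=> m0; rewrite inE => /andP[s /eqP c]; have /card_gt0P[y Ay] : 0 < #|p.2| by rewrite c.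
have := subsetP s y Ay; rewrite inE => a; case: sSi => _ _; apply; exact: a.
Qed.

Let m_gt0 : 0 < m. Proof. by case: m m3. Qed.
Let m_le2 : m <= 2.
Proof. by case: m m3 => [|[|[|[|j]]]] //; rewrite bin_small. Qed.

Lemma card_draw s (A : {set S}) : A \subset nbr Si s -> #|[set p in Bl s | p.2 \subset A]| = 'C(#|A|, m).
Proof.
move=> sA; have injs : injective (pair s : {set S} -> U) by move=> X Y [].
rewrite -cards_draws -[RHS](card_imset _ injs).
congr #|pred_of_set _|; apply/setP=> -[t X]; rewrite in_set mem_Bl in_set /=; apply/idP/imsetP.
  by case/andP=> /andP[/andP[_ cX] /eqP->] sX; exists X; rewrite // in_set sX.
case=> Y; rewrite in_set => /andP[sY cY] [-> ->]; rewrite eqxx cY sY !andbT.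
exact: subset_trans sY sA.
Qed.

Lemma card_Bl s : s \in vert Si -> #|Bl s| = 'C(4, m).
Proof.
move=> Vs; rewrite -(rSi Vs) -(card_draw (subxx _)); congr #|pred_of_set _|.
apply/setP=> p; rewrite [in RHS]in_set; have [Bp|//] := boolP (p \in Bl s).
by move: Bp; rewrite mem_Bl in_set => /andP[/andP[h _] /eqP <-]; rewrite h.
Qed.

Lemma binom_ge : 'C(4, m) = 3 + 'C(3, m.-1) /\ 0 < 'C(3, m.-1).
Proof. by have := m_gt0; have := m_le2; case: (m) m3 => [|[|[|]]]. Qed.

(** There are C(4,m) > 3 stars at s, and only C(3,m) = 3 of them avoid e. *)
Lemma Bl_nonempty s e : adj Si s e -> exists2 p, p \in Bl s & e \in p.2.
Proof.
move=> a; have Vs : s \in vert Si by case: sSi => _ _; apply; exact: a.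
have c3 : #|nbr Si s :\ e| = 3.
  by have := cardsD1 e (nbr Si s); rewrite inE a rSi // => -[].
have sub : nbr Si s :\ e \subset nbr Si s by exact: subsetDl.
have := card_draw sub; rewrite c3 m3 => c.
have : #|Bl s :\: [set p in Bl s | p.2 \subset nbr Si s :\ e]| != 0.
  rewrite cardsD card_Bl //; have -> : Bl s :&: [set p in Bl s | p.2 \subset nbr Si s :\ e] = [set p in Bl s | p.2 \subset nbr Si s :\ e].
    by apply/setIidPr/subsetP=> p; rewrite in_set => /andP[].
  by rewrite c; have [-> h] := binom_ge; rewrite addKn -lt0n.
rewrite cards_eq0 => /set0Pn[p]; rewrite in_setD in_set => /andP[np Bp]; exists p => //.
move: np; rewrite Bp /=; apply: contraNT => ne; apply/subsetP=> y py; rewrite in_setD1.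
apply/andP; split; first by apply: contraNneq ne => <-.
by move: Bp; rewrite mem_Bl in_set => /andP[/andP[/subsetP sp _] /eqP <-]; exact: sp.
Qed.

Lemma nbr_ex s : s \in vert Si -> exists e, adj Si s e.
Proof.
by move=> Vs; have /card_gt0P[e] : 0 < #|nbr Si s| by [rewrite rSi]; rewrite inE; exists e.
Qed.

Lemma Bl_inj : {in vert Si &, injective Bl}.
Proof.
move=> s t Vs Vt e; have [u a] := nbr_ex Vs; have [p Bp _] := Bl_nonempty a.
have := Bp; rewrite e !mem_Bl => /andP[_ /eqP <-]; move: Bp; rewrite mem_Bl.
by case/andP=> _ /eqP ->.
Qed.

Lemma star_quot_adj s e : s \in vert Si -> e \in vert Si ->
  adj (quot Ga P) (Bl s) (Bl e) = adj Si s e.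
Proof.
move=> Vs Ve; apply/quot_adjP/idP.
  case=> _ _ _ [p [q [Bp Bq a]]]; have [_ _ qp _] := adjU_in a.
  move: Bp Bq; rewrite !mem_Bl in_set => /andP[/andP[/subsetP sp _] /eqP <-] /andP[_ /eqP <-].
  by have := sp _ qp; rewrite inE.
move=> a; split.
- exact: imset_f.
- exact: imset_f.
- by rewrite (inj_in_eq Bl_inj) //; apply: contraTneq a => ->; case: sSi => _ ->.
have [p Bp pe] := Bl_nonempty a; have Rp : p \in R by move: Bp; rewrite mem_Bl => /andP[].
have [q qe apq] := adjU_ex Rp pe; exists p, q; split=> //.
by rewrite mem_Bl qe eqxx andbT; have [] := adjU_in apq.
Qed.

(** A star at s has a neighbour centred at e exactly when it contains e, so the three stars avoiding
    e are the ones that miss. *)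
Lemma star_hit s e : adj Si s e -> #|Bl s :&: nbrs Ga (Bl e)| = 'C(4, m) - 3.
Proof.
move=> a; have Vs : s \in vert Si by case: sSi => _ _; apply; exact: a.
have c3 : #|nbr Si s :\ e| = 3.
  by have := cardsD1 e (nbr Si s); rewrite inE a rSi // => -[].
have sub : nbr Si s :\ e \subset nbr Si s by exact: subsetDl.
rewrite -(card_Bl Vs); have := card_draw sub; rewrite c3 m3 => <-; rewrite -card_compl_in.
congr #|pred_of_set _|; apply/setP=> p; rewrite in_setI [in RHS]in_set.
have [Bp|//] := boolP (p \in Bl s); rewrite /=.
have := Bp; rewrite mem_Bl => /andP[Rp /eqP ps].
have sp : p.2 \subset nbr Si s by move: Rp; rewrite in_set ps => /andP[].
apply/nbrsP/idP.
  case=> q; rewrite mem_Bl => /andP[_ /eqP qe] apq; have [_ _ _ pq] := adjU_in apq.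
  by apply/negP=> /subsetP/(_ e); rewrite -qe pq in_setD1 eqxx => /(_ isT).
move=> np; have pe : e \in p.2.
  apply: contraNT np => ne; apply/subsetP=> y py; rewrite in_setD1 (subsetP sp) // andbT.
  by apply: contraNneq ne => <-.
have [q qe apq] := adjU_ex Rp pe; exists q; last by rewrite /= adjU_sym.
by rewrite mem_Bl qe eqxx andbT; have [] := adjU_in apq.
Qed.

Lemma star_edge : exists s e, adj Si s e.
Proof.
have [/imsetP[s Vs _] _] := tr2; have [e a] := nbr_ex Vs; by exists s, e.
Qed.

Lemma star_setting : setting Ga G P 'C(4, m) ('C(4, m) - 3) 4.
Proof.
have [s0 [e0 a0]] := star_edge.
have Vs s e : adj Si s e -> s \in vert Si by case: sSi => _ _ h; exact: h.
have Ve s e : adj Si s e -> e \in vert Si by rewrite symS; exact: Vs.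
have sGa : simple_graph Ga.
  split=> //= [p|p q /adjU_in[]//]; apply/negP=> /adjU_in[Rp _ pp _].
  move: Rp; rewrite in_set => /andP[/subsetP/(_ _ pp)]; rewrite in_set.
  by case: sSi => _ ->.
have RV p : p \in R -> p.1 \in vert Si by apply: star_vert; exact: m_gt0.
have Bl0 s : s \in vert Si -> exists p, p \in Bl s.
  by case/nbr_ex=> e /Bl_nonempty[p Bp _]; exists p.
split=> //.
- apply/subsetP=> g /GP[h Hh ->]; rewrite inE; apply/andP; split.
    by apply/subsetP=> p; rewrite inE; apply: contraNT => nRp; rewrite phi_out.
  by apply/forallP=> p; apply/forallP=> q; rewrite /= adjU_phi.
- have [p Bp pe] := Bl_nonempty a0.
  have Rp : p \in R by move: Bp; rewrite mem_Bl => /andP[].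
  have [q _ apq] := adjU_ex Rp pe.
  apply: (arc_transitive1_intro sGa _ _ (x0 := p) (y0 := q)) => //.
  + by move=> x y g /GP[h Hh ->]; exact: adjU_phi.
  + by move=> x g /GP[h Hh ->] Rx; rewrite [_ \in _]phiR.
  + move=> x y Rx Ry; have [h Hh e] := star_trans Rx Ry; exists (phi h); first exact: phi_in.
    by rewrite -e; exact: phiE.
  move=> x y x' y' a1 a2; have [Rx Ry _ _] := adjU_in a1.
  have [h Hh [ex ey]] := adjU_trans a1 a2; exists (phi h); first exact: phi_in.
  by rewrite -ex -ey; split; exact: phiE.
- split.
    apply/and3P; split.
    + apply/eqP/setP=> p; apply/bigcupP/idP=> [[B /imsetP[s _ ->]]|Rp].
        by rewrite mem_Bl => /andP[].
      by exists (Bl p.1); [apply: imset_f; exact: RV | rewrite mem_Bl Rp eqxx].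
    + apply/trivIsetP=> B C /imsetP[s _ ->] /imsetP[t _ ->] ne.
      rewrite -setI_eq0; apply/eqP/setP=> p; rewrite in_setI !mem_Bl in_set0.
      by apply/negP=> /andP[/andP[_ /eqP es] /andP[_ /eqP et]]; rewrite -es -et eqxx in ne.
    + by apply/negP=> /imsetP[s /Bl0[p Bp] e]; rewrite -e in_set0 in Bp.
  apply: acts_of_stable => B g /GP[h Hh ->] /imsetP[s Vs' ->].
  by rewrite BlG //; apply: imset_f; rewrite H_vert.
- move=> B /imsetP[s Vs' ->]; rewrite card_Bl //; apply/andP; split.
    by have [-> _] := binom_ge.
  have [e ae] := nbr_ex Vs'; have [p Bp] := Bl0 _ (Ve _ _ ae).
  rewrite -(card_Bl Vs'); apply: proper_card; apply/properP; split.
    by apply/subsetP=> q; rewrite mem_Bl => /andP[].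
  exists p; first by move: Bp; rewrite mem_Bl => /andP[].
  move: Bp; rewrite !mem_Bl => /andP[_ /eqP->]; rewrite negb_and; apply/orP; right.
  by apply: contraTneq ae => ->; case: sSi => _ ->.
- by move=> B /imsetP[s Vs' ->]; exact: card_Bl.
- move=> B C ad; have /quot_adjP[/imsetP[s Vs' eB] /imsetP[e Ve' eC] _ _] := ad.
  by rewrite eB eC star_quot_adj // in ad *; exact: star_hit.
- by have [-> h] := binom_ge; rewrite addKn.
- move=> B C /imsetP[s Vs' ->] /imsetP[e Ve' ->].
  pose X := [set t | (t \in vert Si) && connect (adj (quot Ga P)) (Bl s) (Bl t)].
  have cl : closed (adj Si) X.
    apply: intro_closed; first exact: sym_connect_sym.
    move=> x y a; rewrite !in_set (Ve _ _ a) => /andP[Vx c] /=.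
    by apply: (connect_trans c); apply: connect1; rewrite star_quot_adj // (Ve _ _ a).
  have := closed_connect cl (cSi Vs' Ve'); rewrite in_set Vs' connect0 => /esym.
  by rewrite in_set => /andP[].
move=> B /imsetP[s Vs' ->]; rewrite -(rSi Vs').
have -> : nbr (quot Ga P) (Bl s) = Bl @: nbr Si s.
  apply/setP=> C; rewrite in_set; apply/idP/imsetP=> [ad|[e]].
    have /quot_adjP[_ /imsetP[e Ve' eC] _ _] := ad; exists e => //.
    by rewrite in_set -star_quot_adj // -eC.
  by rewrite in_set => a ->; rewrite star_quot_adj // (Ve _ _ a).
rewrite card_in_imset // => x y; rewrite !in_set => ax ay.
by apply: Bl_inj; [exact: Ve ax | exact: Ve ay].
Qed.

Lemma star_arc_transitive2 : arc_transitive 'P^* G (quot Ga P) 2.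
Proof.
have st := star_setting; have [tv ta2] := arc_transitive2_elim sSi tr2.
have [s0 [e0 a0]] := star_edge.
have Vs s e : adj Si s e -> s \in vert Si by case: sSi => _ _ h; exact: h.
have : 1 < #|nbr Si s0| by rewrite rSi // (Vs _ _ a0).
case/card_gt1P=> e1 [e2 []]; rewrite !inE => a1 a2 ne.
have Ve s e : adj Si s e -> e \in vert Si by rewrite symS; exact: Vs.
have V0 := Vs _ _ a0; have [V1 V2] := (Ve _ _ a1, Ve _ _ a2).
apply: (arc_transitive2_intro (st_simpleP st) _ _ (x0 := Bl e1) (y0 := Bl s0) (z0 := Bl e2)).
- by move=> X Y g Gg; rewrite (quot_adjG st).
- by move=> X g Gg /=; rewrite (blockG st).
- by rewrite !star_quot_adj // symS a1 a2 (inj_in_eq Bl_inj).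
- exact: (quot_vertex_trans st).
have un X Y Z : [&& adj (quot Ga P) X Y, adj (quot Ga P) Y Z & X != Z] -> exists x y z,
    [/\ X = Bl x, Y = Bl y, Z = Bl z & [&& adj Si x y, adj Si y z & x != z]].
  case/and3P=> aXY aYZ nXZ; have /quot_adjP[/imsetP[x Vx eX] /imsetP[y Vy eY] _ _] := aXY.
  have /quot_adjP[_ /imsetP[z Vz eZ] _ _] := aYZ; exists x, y, z; split=> //.
  by move: aXY aYZ nXZ; rewrite eX eY eZ !star_quot_adj // (inj_in_eq Bl_inj) // => -> -> ->.
move=> X Y Z X' Y' Z' /un[x [y [z [-> -> -> h]]]] /un[x' [y' [z' [-> -> -> h']]]].
have [g Hg [gx gy gz]] := ta2 _ _ _ _ _ _ h h'; exists (phi g); first exact: phi_in.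
by rewrite !BlG // -gx -gy -gz.
Qed.

(** A block is sent to its common centre. The group isomorphism is the inverse of the morphism from
    H, injective because the stars fixed by h have fixed centres and every vertex is such a
    centre. *)
Lemma star_giso_equivariant : giso_equivariant 'P^* G (quot Ga P) 'P H Si.
Proof.
have [s0 [e0 a0]] := star_edge.
pose f (B : {set U}) := if [pick p in B] is Some p then p.1 else s0.
have fE s : s \in vert Si -> f (Bl s) = s.
  move=> Vs; rewrite /f; case: pickP => [p|h]; first by rewrite mem_Bl => /andP[_ /eqP].
  by have [e a] := nbr_ex Vs; have [p Bp _] := Bl_nonempty a; rewrite h in Bp.
have inj : ('injm phi)%g.
  apply/subsetP=> h /morphpreP[Hh]; rewrite !inE => /eqP ph.
  apply/eqP/permP=> s; rewrite perm1; have [Vs|nVs] := boolP (s \in vert Si).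
    have [u a] := nbr_ex Vs; have [p Bp _] := Bl_nonempty a.
    have := Bp; rewrite mem_Bl => /andP[Rp /eqP <-].
    have := phiE Hh Rp; rewrite (ph : phi h = 1%g) perm1 => e.
    exact: (esym (congr1 fst e)).
  by have := subsetP sH _ Hh; rewrite inE => /andP[pg _]; exact: (out_perm pg nVs).
exists f, (invm_morphism inj); split.
- split=> /=.
  + by move=> B C /imsetP[s Vs ->] /imsetP[t Vt ->]; rewrite !fE // => ->.
  + apply/setP=> s; apply/imsetP/idP=> [[B /imsetP[t Vt ->]]|Vs]; first by rewrite fE // => ->.
    by exists (Bl s); rewrite ?fE //; exact: imset_f.
  + move=> B C /imsetP[s Vs ->] /imsetP[t Vt ->]; rewrite !fE //.
    exact: (esym (star_quot_adj Vs Vt)).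
- apply/isomP; split; first exact: injm_invm.
  by rewrite /= morphim_invm.
move=> B g /imsetP[s Vs ->] /GP[h Hh ->]; rewrite BlG // !fE ?H_vert //=.
by rewrite invmE.
Qed.

End Stars.

Section Existence.
Variables (S : finType) (Si : graph S) (H : {group {perm S}}).
Hypothesis sSi : simple_graph Si.
Hypothesis cSi : connected Si.
Hypothesis rSi : regular Si 4.
Hypothesis sH : H \subset gaut Si.
Hypothesis tr2 : arc_transitive 'P H Si 2.

Let symS : symmetric (adj Si). Proof. by case: sSi. Qed.
Let irrS : irreflexive (adj Si). Proof. by case: sSi. Qed.
Let adjV x y : adj Si x y -> x \in vert Si. Proof. by case: sSi => _ _; apply. Qed.

Lemma arc_extend x y : adj Si x y -> exists z, [&& adj Si x y, adj Si y z & x != z].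
Proof.
move=> a; have Vy : y \in vert Si by rewrite symS in a; exact: adjV a.
have c : #|nbr Si y :\ x| = 3.
  by have := cardsD1 x (nbr Si y); rewrite inE symS a rSi // => -[].
have /card_gt0P[z] : 0 < #|nbr Si y :\ x| by rewrite c.
by rewrite !inE => /andP[ne ayz]; exists z; rewrite a ayz eq_sym.
Qed.

Lemma arc2_trans_arc : arc_trans Si 'P H.
Proof.
have [_ ta2] := arc_transitive2_elim sSi tr2.
move=> x y x' y' /arc_extend[z h] /arc_extend[z' h'].
by have [g Hg [gx gy _]] := ta2 _ _ _ _ _ _ h h'; exists g.
Qed.

(** An arc is joined to its reverse only, so this graph is a perfect matching on the arcs. *)
Definition flag_adj (p q : S * {set S}) :=
  [&& p \in stars Si 1, q \in stars Si 1, p.2 == [set q.1] & q.2 == [set p.1]].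

Lemma stars1P (p : S * {set S}) : p \in stars Si 1 -> exists2 e, p = (p.1, [set e]) & adj Si p.1 e.
Proof.
rewrite inE => /andP[s /eqP/cards1P_ex[e ee]]; exists e; first by rewrite -ee; case: (p).
by have := subsetP s e; rewrite ee !inE eqxx => /(_ isT).
Qed.

Lemma star_act_set1 (s e : S) (h : {perm S}) : star_act (s, [set e]) h = (h s, [set h e]).
Proof. by rewrite /star_act /= setactE imset_set1. Qed.

Lemma mem_stars1 (s e : S) : adj Si s e -> (s, [set e]) \in stars Si 1.
Proof. by move=> a; rewrite inE /= cards1 sub1set inE a. Qed.

Lemma flag_adjP p q : flag_adj p q ->
  [/\ p = (p.1, [set q.1]), q = (q.1, [set p.1]) & adj Si p.1 q.1].
Proof.
case/and4P=> /stars1P[e ep a] _ /eqP e1 /eqP e2; split.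
- by rewrite -e1; case: (p).
- by rewrite -e2; case: (q).
by have := e1; rewrite {1}ep /= => /set1_inj <-.
Qed.

Lemma flag_adj_intro (s e : S) : adj Si s e -> flag_adj (s, [set e]) (e, [set s]).
Proof.
move=> a; have a' : adj Si e s by rewrite symS.
by rewrite /flag_adj !mem_stars1 // !eqxx.
Qed.

Lemma flag_existence : exists (T : finType) (Ga : graph T) (G : {group {perm T}})
    (P : {set {set T}}),
  [/\ setting Ga G P 4 1 4, arc_transitive 'P^* G (quot Ga P) 2
    & giso_equivariant 'P^* G (quot Ga P) 'P H Si].
Proof.
have tv := arc2_trans_arc.
have h1 : symmetric flag_adj.
  by move=> p q; rewrite /flag_adj; apply/and4P/and4P=> -[? ? ? ?]; split.
have h2 p q : flag_adj p q -> [/\ p \in stars Si 1, q \in stars Si 1, q.1 \in p.2 & p.1 \in q.2].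
  by case/and4P=> ? ? /eqP-> /eqP->; rewrite !set11.
have h3 p q h : h \in H -> flag_adj p q -> flag_adj (star_act p h) (star_act q h).
  move=> Hh /flag_adjP[-> -> a] /=; rewrite !star_act_set1; apply: flag_adj_intro.
  by rewrite (H_adj sH).
have h4 p q p' q' : flag_adj p q -> flag_adj p' q' ->
    exists2 h, h \in H & star_act p h = p' /\ star_act q h = q'.
  move=> /flag_adjP[ep eq a] /flag_adjP[ep' eq' a'].
  have [h Hh [hx hy]] := tv _ _ _ _ a a'; exists h => //.
  have {}hx : h p.1 = p'.1 by []. have {}hy : h q.1 = q'.1 by [].
  by rewrite ep eq ep' eq' !star_act_set1 hx hy.
have h5 (p : S * {set S}) e : p \in stars Si 1 -> e \in p.2 -> exists2 q, q.1 = e & flag_adj p q.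
  case/stars1P=> e' ep a; rewrite ep inE => /eqP->; exists (e', [set p.1]) => //.
  exact: flag_adj_intro.
have h6 p q : p \in stars Si 1 -> q \in stars Si 1 -> exists2 h, h \in H & star_act p h = q.
  move=> /stars1P[e ep a] /stars1P[e' eq a'].
  have [h Hh [hx hy]] := tv _ _ _ _ a a'; exists h => //.
  have {}hx : h p.1 = q.1 by []. have {}hy : h e = e' by [].
  by rewrite ep eq star_act_set1 hx hy.
exists (S * {set S})%type, (Graph (stars Si 1) flag_adj), (star_group 1 sH),
  [set star_block Si 1 s | s in vert Si]; split.
- exact: star_setting.
- exact: star_arc_transitive2.
- exact: star_giso_equivariant.
Qed.

(* Among the three neighbours of s other than e, one is fixed by g^2 or all are
   fixed by g^6, where g reverses the arc (s, e); so g or g^3 reverses a 3-arc. *)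
Lemma self_paired_orbit : exists D : {set 4.-tuple S},
  self_paired D /\ orbit_on_3arcs 'P H Si D.
Proof.
have [s Vs] : exists s, s \in vert Si by have [/imsetP[s Vs _] _] := tr2; exists s.
have /card_gt0P[e] : 0 < #|nbr Si s| by rewrite rSi.
rewrite inE => ase; have aes : adj Si e s by rewrite symS.
have [g Hg [gs ge]] := arc2_trans_arc ase aes.
have {}gs : g s = e by []. have {}ge : g e = s by [].
suff [h [Hh hs he [t [at_ nt ht]]]] : exists h, [/\ h \in H, h s = e, h e = s &
    exists t, [/\ adj Si s t, t != e & h (h t) = t]].
  (* Since h exchanges s and e and its square fixes t, it reverses this 3-arc, and so the orbit is
     self-paired. *)
  pose t0 := [tuple t; s; e; h t]; exists (orbit ('P * 4)%act H t0); split.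
    move=> u /orbitP[k Hk <-]; apply/orbitP; exists (h * k)%g; first exact: groupM.
    by apply: val_inj; rewrite /= /aperm !permM hs he ht.
  exists t0 => //; rewrite (sarcs3E sSi) symS at_ ase nt /=.
  rewrite -{1}hs (H_adj sH) // at_ /=; apply/eqP=> e1.
  by move: nt; rewrite -(inj_eq (@perm_inj _ h)) -e1 he eqxx.
pose Y := nbr Si s :\ e.
have cY : #|Y| = 3.
  by have := cardsD1 e (nbr Si s); rewrite inE ase rSi // => -[].
pose k t := g (g t).
have ke : k e = e by rewrite /k ge.
have ks : k s = s by rewrite /k gs.
have kY t : t \in Y -> k t \in Y.
  rewrite !in_setD1 !inE => /andP[ne a]; apply/andP; split.
    by rewrite -ke /k !(inj_eq perm_inj).
  by rewrite -ks /k !(H_adj sH).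
have kI : injective k by move=> x y /perm_inj/perm_inj.
have inY t : t \in Y -> adj Si s t /\ t != e by rewrite in_setD1 inE => /andP[].
(* An injective map of a three-element set to itself has a fixed point or is a 3-cycle. *)
clearbody Y; have [t [tY tk]] : exists t, t \in Y /\ (k t = t \/ k (k (k t)) = t).
  have /card_gt0P[y Yy] : 0 < #|Y| by rewrite cY.
  have [e0|n0] := eqVneq (k y) y; first by exists y; split; [|left].
  have third z : z \in Y -> z != y -> z != k y -> Y = [set y; k y; z].
    move=> Yz n1 n2; apply/esym/eqP; rewrite eqEcard cY.
    have -> : #|[set y; k y; z]| = 3.
      by rewrite setUC cardsU1 !inE negb_or n1 n2 cards2 eq_sym n0.
    rewrite andbT; apply/subsetP=> w; rewrite !in_setU !in_set1.
    by case/orP=> [/orP[]|] /eqP-> //; exact: kY.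
  have [e1|n1] := eqVneq (k (k y)) y.
    have /card_gt0P[z] : 0 < #|Y :\ y :\ k y|.
      have c1 : #|Y :\ y| = 2 by have := cardsD1 y Y; rewrite Yy cY => -[].
      by have := cardsD1 (k y) (Y :\ y); rewrite c1 in_setD1 n0 kY // add1n => -[<-].
    rewrite !in_setD1 => /and3P[z2 z1 Yz]; exists z; split=> //; left.
    have := kY _ Yz; rewrite (third z Yz z1 z2) !in_setU !in_set1.
    case/orP=> [/orP[]|] /eqP // e2.
      by move: z2; rewrite -(inj_eq kI) e2 e1 eqxx.
    by move: z1; rewrite -(inj_eq kI) e2 eqxx.
  exists y; split=> //; right.
  have Yk2 : k (k y) \in Y by exact: (kY _ (kY _ Yy)).
  have n2 : k (k y) != k y by rewrite (inj_eq kI).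
  have := kY _ Yk2; rewrite (third _ Yk2 n1 n2) !in_setU !in_set1.
  case/orP=> [/orP[]|] /eqP // e2.
    by move: n1; rewrite -(inj_eq kI) e2 eqxx.
  by move: n2; rewrite -(inj_eq kI) e2 eqxx.
have [a ne] := inY _ tY; case: tk => tk.
  by exists g; split=> //; exists t.
(* An odd power of g still exchanges s and e, and the square of this one is the cube of k. *)
exists (g * g * g)%g; split; rewrite ?groupM // ?permM ?gs ?ge ?gs ?ge //.
exists t; split=> //; rewrite !permM; exact: tk.
Qed.

Section TwoPaths.
Variable D : {set 4.-tuple S}.
Hypothesis spD : self_paired D.
Hypothesis orbD : orbit_on_3arcs 'P H Si D.

Lemma D_act t u x y h : h \in H -> [tuple t; x; y; u] \in D ->
  [tuple h t; h x; h y; h u] \in D.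
Proof.
case: orbD => t0 _ -> Hh /orbitP[k Hk e]; apply/orbitP; exists (k * h)%g; first exact: groupM.
by rewrite actM e; apply: val_inj.
Qed.

Lemma D_trans t x y u t' x' y' u' : [tuple t; x; y; u] \in D -> [tuple t'; x'; y'; u'] \in D ->
  exists2 h, h \in H & [/\ h t = t', h x = x', h y = y' & h u = u'].
Proof.
case: orbD => t0 _ -> /orbitP[k1 H1 d1] /orbitP[k2 H2 d2].
have Hk : (k1^-1 * k2)%g \in H by rewrite groupM ?groupV.
have : ('P * 4)%act [tuple t; x; y; u] (k1^-1 * k2)%g = [tuple t'; x'; y'; u'].
  by rewrite -d1 actM actK.
by move/(congr1 val) => /= [<- <- <- <-]; exists (k1^-1 * k2)%g.
Qed.

Lemma D_arc t x y u : [tuple t; x; y; u] \in D ->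
  [&& adj Si t x, adj Si x y, adj Si y u, t != y & x != u].
Proof.
case: (orbD) => t0; case/tupleP: t0 => t1 t0; case/tupleP: t0 => x1 t0.
case/tupleP: t0 => y1 t0; case/tupleP: t0 => u1 t0; rewrite tuple0 (sarcs3E sSi).
move=> h eD; rewrite eD => /orbitP[k Hk /(congr1 val) /= [<- <- <- <-]].
by rewrite /aperm !(H_adj sH) // !(inj_eq perm_inj).
Qed.

Lemma D_rev t x y u : [tuple t; x; y; u] \in D -> [tuple u; y; x; t] \in D.
Proof.
move/spD; have -> // : [tuple of rev [tuple t; x; y; u]] = [tuple u; y; x; t].
exact: val_inj.
Qed.

Lemma D_ex : exists t x y u, [tuple t; x; y; u] \in D.
Proof.
case: orbD => t0 _ ->; have := orbit_refl ('P * 4)%act H t0.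
case/tupleP: (t0) => t1 t2; case/tupleP: t2 => x1 t2; case/tupleP: t2 => y1 t2.
by case/tupleP: t2 => u1 t2; rewrite tuple0 => h; exists t1, x1, y1, u1.
Qed.

Local Notation tadj := (adj (two_path_graph Si D)).

(** Distinctness is automatic because the two centres are adjacent, and self-pairing supplies the
    reverse 3-arc. *)
Lemma two_path_adjP (p q : S * {set S}) : reflect (exists t u, [/\ p = (p.1, [set q.1; t]), q = (q.1, [set p.1; u]),
    p \in stars Si 2, q \in stars Si 2 & [tuple t; p.1; q.1; u] \in D]) (tadj p q).
Proof.
apply: (iffP idP).
  case/and4P=> Rp Rq _ /existsP[t /existsP[u /and4P[/eqP ep /eqP eq Dt _]]].
  exists t, u; split=> //; first by rewrite -ep; case: (p).
  by rewrite -eq; case: (q).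
case=> t [u [ep eq Rp Rq Dt]]; apply/and4P; split=> //.
  by have /and5P[_ a _ _ _] := D_arc Dt; apply: contraTneq a => ->; rewrite irrS.
apply/existsP; exists t; apply/existsP; exists u; apply/and4P; split=> //.
- exact/eqP/(congr1 snd ep).
- exact/eqP/(congr1 snd eq).
- exact: D_rev.
Qed.

Lemma star_act_set2 (s e t : S) (h : {perm S}) : star_act (s, [set e; t]) h = (h s, [set h e; h t]).
Proof. by rewrite /star_act /= setactE imsetU !imset_set1. Qed.

Lemma mem_stars2 (s e t : S) : adj Si s e -> adj Si s t -> e != t -> (s, [set e; t]) \in stars Si 2.
Proof. by move=> a1 a2 ne; rewrite inE /= cards2 ne subUset !sub1set !inE a1 a2. Qed.

Lemma stars2P (p : S * {set S}) e : p \in stars Si 2 -> e \in p.2 ->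
  exists t, [/\ p = (p.1, [set e; t]), adj Si p.1 e, adj Si p.1 t & e != t].
Proof.
rewrite inE => /andP[/subsetP s c2] pe.
have := cardsD1 e p.2; rewrite pe (eqP c2) => -[] /esym/cards1P_ex[t et]; exists t.
have := set11 t; rewrite -et in_setD1 => /andP[te pt]; split.
- by rewrite setD1K //; case: (p).
- by have := s _ pe; rewrite inE.
- by have := s _ pt; rewrite inE.
by rewrite eq_sym.
Qed.

Lemma two_path_existence : exists (T : finType) (Ga : graph T) (G : {group {perm T}})
    (P : {set {set T}}),
  [/\ setting Ga G P 6 3 4, arc_transitive 'P^* G (quot Ga P) 2
    & giso_equivariant 'P^* G (quot Ga P) 'P H Si].
Proof.
have [_ ta2] := arc_transitive2_elim sSi tr2.
have h1 : symmetric tadj.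
  suff one p q : tadj p q -> tadj q p by move=> p q; apply/idP/idP; exact: one.
  case/two_path_adjP=> t [u [ep eq Rp Rq Dt]]; apply/two_path_adjP; exists u, t.
  by split=> //; exact: D_rev.
have h2 p q : tadj p q -> [/\ p \in stars Si 2, q \in stars Si 2, q.1 \in p.2 & p.1 \in q.2].
  case/two_path_adjP=> t [u [ep eq Rp Rq _]]; split=> //.
    by rewrite ep in_set2 eqxx.
  by rewrite eq in_set2 eqxx.
have h3 p q h : h \in H -> tadj p q -> tadj (star_act p h) (star_act q h).
  move=> Hh /two_path_adjP[t [u [ep eq Rp Rq Dt]]]; apply/two_path_adjP.
  exists (h t), (h u); rewrite !(star_actR _ sH) //; split=> //.
  - by rewrite {1}ep star_act_set2.
  - by rewrite {1}eq star_act_set2.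
  exact: D_act.
have h4 p q p' q' : tadj p q -> tadj p' q' ->
    exists2 h, h \in H & star_act p h = p' /\ star_act q h = q'.
  move=> /two_path_adjP[t [u [ep eq _ _ Dt]]] /two_path_adjP[t' [u' [ep' eq' _ _ Dt']]].
  have [h Hh [ht hp hq hu]] := D_trans Dt Dt'; exists h => //.
  by rewrite ep eq ep' eq' !star_act_set2 ht hp hq hu.
have h5 (p : S * {set S}) e : p \in stars Si 2 -> e \in p.2 -> exists2 q, q.1 = e & tadj p q.
  (* 2-arc-transitivity takes the first three vertices of a 3-arc in D to (t, p.1, e); the image of
     its last vertex completes the neighbour centred at e. *)
  move=> Rp pe; have [t [ep ae at_ ne]] := stars2P Rp pe.
  have [t0 [x0 [y0 [u0 D0]]]] := D_ex; have /and5P[a1 a2 _ n1 _] := D_arc D0.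
  have [] := ta2 t0 x0 y0 t p.1 e; first by rewrite a1 a2 n1.
    by rewrite symS at_ ae eq_sym.
  move=> h Hh [ht hx hy]; have {}ht : h t0 = t by []. have {}hx : h x0 = p.1 by [].
  have {}hy : h y0 = e by []. have := D_act Hh D0; rewrite ht hx hy => Dt.
  exists (e, [set p.1; h u0]) => //; have /and5P[_ _ a3 _ n3] := D_arc Dt.
  apply/two_path_adjP; exists t, (h u0); split=> //; apply: mem_stars2 => //.
  by rewrite symS.
have h6 p q : p \in stars Si 2 -> q \in stars Si 2 -> exists2 h, h \in H & star_act p h = q.
  have ex r : r \in stars Si 2 -> exists e, e \in r.2.
    by rewrite inE => /andP[_ /eqP c]; apply/card_gt0P; rewrite c.
  move=> Rp Rq; have [e pe] := ex _ Rp; have [e' qe'] := ex _ Rq.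
  have [t [ep ae at_ ne]] := stars2P Rp pe; have [t' [eq ae' at' ne']] := stars2P Rq qe'.
  have [] := ta2 e p.1 t e' q.1 t'; first by rewrite symS ae at_.
    by rewrite symS ae' at'.
  move=> h Hh [he hp ht]; exists h => //.
  have {}he : h e = e' by []. have {}hp : h p.1 = q.1 by []. have {}ht : h t = t' by [].
  by rewrite ep eq star_act_set2 he hp ht.
exists (S * {set S})%type, (Graph (stars Si 2) tadj), (star_group 2 sH),
  [set star_block Si 2 s | s in vert Si]; split.
- exact: star_setting.
- exact: star_arc_transitive2.
- exact: star_giso_equivariant.
Qed.

End TwoPaths.

End Existence.

Lemma gaut_group_set (S : finType) (Si : graph S) : group_set (gaut Si).
Proof.
apply/group_setP; split.
  by rewrite inE perm_on1; apply/forallP=> x; apply/forallP=> y; rewrite !perm1.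
move=> g h; rewrite !inE => /andP[pg /forallP ag] /andP[ph /forallP ah].
rewrite perm_onM //; apply/forallP=> x; apply/forallP=> y; rewrite !permM.
by rewrite (eqP (forallP (ah _) _)) (eqP (forallP (ag _) _)).
Qed.

Lemma setting_arc_transitive2 (T : finType) (Ga : graph T) (G : {group {perm T}})
    (P : {set {set T}}) (v k b : nat) :
  setting Ga G P v k b ->
  (arc_transitive 'P^* G (quot Ga P) 2 <->
        [\/ case_a Ga G P, case_b Ga P, case_c Ga G P
          | (exists a : nat, case_d Ga P a) \/ case_e Ga G P]).
Proof.
move=> st; split; last exact: (cases_arc_transitive2 st).
move=> tr; apply: (arc_transitive2_cases st tr) => b2 v6.
by rewrite (card_vert st) v6 mulnK //; exact: (quot_giso_cycle st b2).
Qed.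

Theorem theorem3p2 :
  (forall (T : finType) (Ga : graph T) (G : {group {perm T}})
          (P : {set {set T}}) (v k b : nat),
     setting Ga G P v k b ->
     (arc_transitive 'P^* G (quot Ga P) 2 <->
        [\/ case_a Ga G P, case_b Ga P, case_c Ga G P
          | (exists a : nat, case_d Ga P a) \/ case_e Ga G P]) /\
     [/\ case_a Ga G P -> more_a Ga G P,
         case_b Ga P -> more_b Ga G P,
         case_c Ga G P -> more_c Ga G P,
         forall a : nat, case_d Ga P a -> more_d Ga G P a
       & case_e Ga G P -> more_e Ga G P]) /\
  (forall (S : finType) (Si : graph S),
     simple_graph Si -> connected Si -> regular Si 4 ->
     arc_transitive 'P (gaut Si) Si 2 ->
     exists (T : finType) (Ga : graph T) (G : {group {perm T}})
            (P : {set {set T}}) (v k b : nat),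
       [/\ setting Ga G P v k b, case_a Ga G P & giso (quot Ga P) Si]) /\
  (forall (S : finType) (Si : graph S) (H : {group {perm S}}),
     simple_graph Si -> connected Si -> regular Si 4 ->
     H \subset gaut Si -> arc_transitive 'P H Si 2 ->
     exists (T : finType) (Ga : graph T) (G : {group {perm T}})
            (P : {set {set T}}) (v k b : nat),
       [/\ setting Ga G P v k b, case_e Ga G P
         & giso_equivariant 'P^* G (quot Ga P) 'P H Si]).
Proof.
split; [|split].
- move=> T Ga G P v k b st; split; first exact: (setting_arc_transitive2 st).
  split.
  + exact: (case_a_more st).
  + by case=> hp _; have [_ b2] := params_vb st hp; exact: (case_b_more st b2 hp).
  + case=> hp psl; apply: (case_c_more st hp) => B PB.
    exact: (PSL32_trans2 (acts_stab_block G B) (psl B PB)).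
  + by move=> a [a3 hp]; exact: (case_d_more st a3 hp).
  + by case=> hp _; exact: (case_e_more st hp).
- move=> S Si sSi cSi rSi tr.
  have [T [Ga [G [P [st tr2 [f [psi [iso _ _]]]]]]]] :=
    flag_existence (H := Group (gaut_group_set Si)) sSi cSi rSi (subxx _) tr.
  exists T, Ga, G, P, 4, 1, 4; split=> //; last by exists f.
  (* Block size 4 occurs in case (a) only; in particular it is no multiple of 3. *)
  case: ((setting_arc_transitive2 st).1 tr2) => //.
  + by case=> hp _; have [] := params_vb st hp.
  + by case=> hp _; have [] := params_vb st hp.
  + case=> [[a [a3 hp]]|[hp _]]; last by have [] := params_vb st hp.
    by have [] := params_vb st hp; lia.
move=> S Si H sSi cSi rSi sH tr.
have [D [spD orbD]] := self_paired_orbit sSi rSi sH tr.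
have [T [Ga [G [P [st tr2 iso]]]]] := two_path_existence sSi cSi rSi sH tr spD orbD.
exists T, Ga, G, P, 6, 3, 4; split=> //.
(* With v = 6 and b = 4 only (e) remains: case (b) has b = 2, and case (d) would need 3a = 6 and a =
   4. *)
case: ((setting_arc_transitive2 st).1 tr2) => //.
- by case=> hp _; have [] := params_vb st hp.
- by case=> hp _; have [] := params_vb st hp.
- by case=> hp _; have [] := params_vb st hp.
- case=> [[a [a3 hp]]|//].
  by have [] := params_vb st hp; lia.
Qed.
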